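(* Let a (possibly infinite-dimensional) Lie group $\mathcal{G}$ act on a connected symplectic manifold $(\mathfrak{X},\Omega)$ with $\pi_1(\mathfrak{X})=0$, preserving $\Omega$, with an equivariant moment map $\mu$. Let $\mathcal{P}_\Omega=\langle\Omega,\pi_2(\mathfrak{X})\rangle\subset\mathbb{R}$ be the group of spherical periods of $\Omega$. For $a\in\pi_1(\mathcal{G},\mathrm{Id})$ represented by a smooth loop $\{\phi_t\}_{t\in\mathbb{R}/\mathbb{Z}}$ with $\phi_0=\mathrm{Id}$ and $X_t=\frac{d}{d\tau}\big|_{\tau=t}\phi_\tau\phi_t^{-1}\in\mathrm{Lie}(\mathcal{G})$, choose $x\in\mathfrak{X}$ and a smooth disk $D:\{z\in\mathbb{C}:|z|\le1\}\to\mathfrak{X}$ with $D(e^{2\pi it})=\phi_t\cdot x$ for all $t$, and set $$\mathcal{A}_\mu(a)=\int_D\Omega-\int_0^1\mu(X_t)(\phi_t\cdot x)\,dt .$$ Then the class of $\mathcal{A}_\mu(a)$ in $\mathbb{R}/\mathcal{P}_\Omega$ is independent of the choice of $D$, of $x$, and of the loop representing $a$, and $\mathcal{A}_\mu:\pi_1(\mathcal{G})\to\mathbb{R}/\mathcal{P}_\Omega$ is a group homomorphism.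
   Context: Equivariant moment map: a map $\mu:\mathrm{Lie}(\mathcal{G})\times\mathfrak{X}\to\mathbb{R}$, written $\mu(X)(x)$, linear in $X$, with $\iota_{\Xi}\Omega=-d\mu(X)$ for the vector field $\Xi$ on $\mathfrak{X}$ generated by $X$ (i.e. $\Xi_x=\frac{d}{dt}|_{t=0}g_t\cdot x$ for a path $g_t$ with $g_0=\mathrm{Id}$, $\dot g_0=X$), and with $\mu(\mathrm{Ad}_\phi X)(\phi\cdot x)=\mu(X)(x)$ for all $\phi\in\mathcal{G}$, $X\in\mathrm{Lie}(\mathcal G)$, $x\in\mathfrak X$. Infinite-dimensional Lie groups may be taken to be regular Fréchet Lie groups.
   Formalization: The moment map μ(X)(x) is additionally assumed continuous in X at each point x; this is automatic in finite dimension, and for a discontinuous linear μ on an infinite-dimensional Lie algebra the claim fails. *)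

(* Defs.v *)
From HB Require Import structures.
From mathcomp Require Import all_boot all_order all_algebra ring lra.
From mathcomp Require Import all_classical all_reals all_analysis.

Set Implicit Arguments.
Unset Strict Implicit.
Unset Printing Implicit Defensive.

Import Order.TTheory GRing.Theory Num.Theory.
Import numFieldNormedType.Exports.

Local Open Scope classical_set_scope.
Local Open Scope ring_scope.

Section Calculus.
Context {R : realType}.

(* Completeness is phrased with neighbourhoods of 0, and not with completeType,
   because the uniformity carried by a tvsType is not required to be the
   translation-invariant one. *)
Definition frechet_space (E : tvsType R) : Prop :=
  [/\ hausdorff_space E,
      exists B : nat -> set E, (forall n, nbhs (0 : E) (B n)) /\
        (forall V, nbhs (0 : E) V -> exists n, B n `<=` V)
    & forall u : nat -> E,
        (forall V, nbhs (0 : E) V -> exists N, forall m n : nat,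
           (N <= m)%N -> (N <= n)%N -> V (u m - u n)) ->
        exists l : E, u @ \oo --> l].

Definition diff_quot (E F : tvsType R) (f : E -> F) (x v : E) (h : R) : F :=
  h^-1 *: (f (x + h *: v) - f x).

Definition ddiff (E F : tvsType R) (f : E -> F) (x v : E) : F :=
  xget 0 [set w | diff_quot f x v h @[h --> (0 : R)^'] --> w].

Definition ddifferentiable (E F : tvsType R) (f : E -> F) (x v : E) : Prop :=
  exists w : F, diff_quot f x v h @[h --> (0 : R)^'] --> w.

(* Michal-Bastiani (on Frechet spaces: Hamilton) calculus: f is C^(n+1) when it
   is continuous and its directional derivative (x, v) |-> df(x; v) exists and
   is C^n on U x E. *)
Fixpoint Ck (n : nat) : forall E F : tvsType R, set E -> (E -> F) -> Prop :=
  match n with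
  | 0 => fun E F U f => forall x, U x -> {for x, continuous f}
  | n'.+1 => fun E F U f =>
      [/\ forall x, U x -> {for x, continuous f},
          forall x v, U x -> ddifferentiable f x v
        & @Ck n' (E * E)%type F (U `*` setT) (fun p => ddiff f p.1 p.2)]
  end.

Definition Cinfty (E F : tvsType R) (U : set E) (f : E -> F) : Prop :=
  open U /\ forall n, Ck n U f.

(* chart_to and chart_from are total functions with arbitrary values outside
   chart_dom and chart_cod. *)
Record chart (M : topologicalType) (E : tvsType R) := Chart {
  chart_dom : set M;
  chart_cod : set E;
  chart_to : M -> E;
  chart_from : E -> M;
  chart_dom_open : open chart_dom;
  chart_cod_open : open chart_cod;
  chart_to_cod : forall x, chart_dom x -> chart_cod (chart_to x);
  chart_from_dom : forall y, chart_cod y -> chart_dom (chart_from y);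
  chart_toK : forall x, chart_dom x -> chart_from (chart_to x) = x;
  chart_fromK : forall y, chart_cod y -> chart_to (chart_from y) = y;
  chart_to_continuous : forall x, chart_dom x -> {for x, continuous chart_to};
  chart_from_continuous :
    forall y, chart_cod y -> {for y, continuous chart_from} }.

(* The tangent space at x is by definition the model
   space, a vector being identified with its coordinates in the preferred chart
   chart_at x; nothing depends on which charts are preferred. *)
Record manifold (E : tvsType R) := Manifold {
  manifold_sort :> topologicalType;
  atlas : set (chart manifold_sort E);
  chart_at : manifold_sort -> chart manifold_sort E;
  manifold_hausdorff : hausdorff_space manifold_sort;
  chart_at_atlas : forall x, atlas (chart_at x);
  chart_at_dom : forall x, chart_dom (chart_at x) x;
  atlas_compatible : forall c d, atlas c -> atlas d ->
    Cinfty (chart_cod c `&` chart_from c @^-1` chart_dom d)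
           (chart_to d \o chart_from c) }.

Section id_chart.
Variable E : tvsType R.
Let T (x : E) : [set: E] x -> [set: E] x. Proof. by []. Qed.
Let K (x : E) : [set: E] x -> id (id x) = x. Proof. by []. Qed.
Let C (x : E) : [set: E] x -> {for x, continuous (id : E -> E)}.
Proof. by move=> _; exact: cvg_id. Qed.
Definition id_chart : chart E E :=
  @Chart E E setT setT id id openT openT T T K K C C.
End id_chart.

Section prod_chart.
Variables (M N : topologicalType) (E F : tvsType R).
Variables (c : chart M E) (d : chart N F).
Let pto (x : M * N) : E * F := (chart_to c x.1, chart_to d x.2).
Let pfrom (y : E * F) : M * N := (chart_from c y.1, chart_from d y.2).
Let pdom : set (M * N) := chart_dom c `*` chart_dom d.
Let pcod : set (E * F) := chart_cod c `*` chart_cod d.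

Let pdom_open : open pdom.
Proof.
rewrite openE => -[x y] [/= xc yd].
exists (chart_dom c, chart_dom d) => //.
by split; apply: open_nbhs_nbhs; split => //; exact: chart_dom_open.
Qed.
Let pcod_open : open pcod.
Proof.
rewrite openE => -[x y] [/= xc yd].
exists (chart_cod c, chart_cod d) => //.
by split; apply: open_nbhs_nbhs; split => //; exact: chart_cod_open.
Qed.
Let pto_cod x : pdom x -> pcod (pto x).
Proof. by case=> ? ?; split; exact: chart_to_cod. Qed.
Let pfrom_dom y : pcod y -> pdom (pfrom y).
Proof. by case=> ? ?; split; exact: chart_from_dom. Qed.
Let ptoK x : pdom x -> pfrom (pto x) = x.
Proof. by case: x => x y [/= ? ?]; rewrite /pfrom /= !chart_toK. Qed.
Let pfromK y : pcod y -> pto (pfrom y) = y.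
Proof. by case: y => x y [/= ? ?]; rewrite /pto /= !chart_fromK. Qed.
Let pto_continuous x : pdom x -> {for x, continuous pto}.
Proof.
case: x => x y [/= xc yd]; apply: cvg_pair => /=.
  by apply: (cvg_comp _ _ cvg_fst); exact: chart_to_continuous.
by apply: (cvg_comp _ _ cvg_snd); exact: chart_to_continuous.
Qed.
Let pfrom_continuous y : pcod y -> {for y, continuous pfrom}.
Proof.
case: y => x y [/= xc yd]; apply: cvg_pair => /=.
  by apply: (cvg_comp _ _ cvg_fst); exact: chart_from_continuous.
by apply: (cvg_comp _ _ cvg_snd); exact: chart_from_continuous.
Qed.
Definition prod_chart : chart (M * N)%type (E * F)%type :=
  Chart pdom_open pcod_open pto_cod pfrom_dom ptoK pfromK
        pto_continuous pfrom_continuous.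
End prod_chart.

Definition vec_atlas (E : tvsType R) : set (chart E E) := [set id_chart E].

Definition prod_atlas (M N : topologicalType) (E F : tvsType R)
    (A : set (chart M E)) (B : set (chart N F)) :
    set (chart (M * N)%type (E * F)%type) :=
  [set k | exists c d, [/\ A c, B d & k = prod_chart c d]].

Section Smooth.
Variables (M N : topologicalType) (E F : tvsType R).
Variables (A : set (chart M E)) (B : set (chart N F)).

Definition smooth_on_open (U : set M) (f : M -> N) : Prop :=
  [/\ open U, forall x, U x -> {for x, continuous f}
    & forall c d, A c -> B d ->
        Cinfty (chart_cod c `&` chart_from c @^-1` (U `&` f @^-1` chart_dom d))
               (chart_to d \o f \o chart_from c)].

Definition smooth (f : M -> N) : Prop := smooth_on_open setT f.

(* Smoothness on an arbitrary subset: local smooth extendability. *)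
Definition smooth_on_subset (S : set M) (f : M -> N) : Prop :=
  forall z, S z -> exists (U : set M) (g : M -> N),
    [/\ U z, smooth_on_open U g & forall y, U y -> S y -> g y = f y].
End Smooth.

(* The derivative at z, in the direction v, of a map defined on a vector space;
   a tangent vector at f z. *)
Definition mderiv (V E : tvsType R) (M : manifold E) (f : V -> M) (z v : V)
    : E :=
  ddiff (chart_to (chart_at (f z)) \o f) z v.

Definition velocity (E : tvsType R) (M : manifold E) (f : R -> M) (t : R) : E :=
  @mderiv R^o E M f t 1.

(* T_x f : T_x M -> T_(f x) N *)
Definition tangent_map (E F : tvsType R) (M : manifold E) (N : manifold F)
    (f : M -> N) (x : M) (v : E) : F :=
  mderiv (f \o chart_from (chart_at x)) (chart_to (chart_at x) x) v.

(* df_x : T_x M -> R *)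
Definition differential (E : tvsType R) (M : manifold E) (f : M -> R) (x : M)
    (v : E) : R :=
  @ddiff E R^o (f \o chart_from (chart_at x)) (chart_to (chart_at x) x) v.

(* om x : T_x M * T_x M -> R, with T_x M read in the chart chart_at x. *)
Definition form2 (E : tvsType R) (M : manifold E) := M -> E -> E -> R.

Section Forms.
Variables (E : tvsType R) (M : manifold E) (om : form2 M).

(* om in the chart c: a function of the base point and of two vectors. *)
Definition form2_in_chart (c : chart M E) (p : E * E * E) : R^o :=
  om (chart_from c p.1.1) (mderiv (chart_from c) p.1.1 p.1.2)
                          (mderiv (chart_from c) p.1.1 p.2).

Definition smooth_form2 : Prop :=
  [/\ forall x u, linear (om x u : E -> R^o),
      forall x u v, om x u v = - om x v u
    & forall c, atlas c ->
        Cinfty (chart_cod c `*` setT `*` setT) (form2_in_chart c)].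

(* d om (u, v, w) evaluated on constant vector fields in a chart. *)
Definition closed_form2 : Prop :=
  forall c y u v w, atlas c -> chart_cod c y ->
    ddiff (fun z => form2_in_chart c (z, v, w)) y u
    + ddiff (fun z => form2_in_chart c (z, w, u)) y v
    + ddiff (fun z => form2_in_chart c (z, u, v)) y w = 0.

(* In infinite dimension, nondegeneracy is meant in the weak sense. *)
Definition symplectic : Prop :=
  [/\ smooth_form2, closed_form2
    & forall x u, (forall v, om x u v = 0) -> u = 0].

(* The coefficient of dx /\ dy in the pull-back of om by u. *)
Definition pullback2 (u : R^o * R^o -> M) (z : R^o * R^o) : R :=
  om (u z) (mderiv u z (1, 0)) (mderiv u z (0, 1)).

Definition closed_disk : set (R^o * R^o) :=
  [set z | z.1 ^+ 2 + z.2 ^+ 2 <= 1].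

Definition smooth_disk (D : R^o * R^o -> M) : Prop :=
  smooth_on_subset (@vec_atlas (R^o * R^o)%type) (@atlas E M) closed_disk D.

(* The integral is taken over the open disk, where the derivatives of D only
   depend on the restriction of D to the closed disk. *)
Definition disk_integral (D : R^o * R^o -> M) : R :=
  (\int[(lebesgue_measure \x lebesgue_measure)%E]_(z in
     [set z : R * R | (z.1 ^+ 2 + z.2 ^+ 2 < 1)%R]) pullback2 D z)%R.

Definition sphere2 : set (R^o * R^o * R^o) :=
  [set p | p.1.1 ^+ 2 + p.1.2 ^+ 2 + p.2 ^+ 2 = 1].

Definition spherical_coord (z : R^o * R^o) : R^o * R^o * R^o :=
  (sin z.1 * cos z.2, sin z.1 * sin z.2, cos z.1).

Definition smooth_sphere (u : R^o * R^o * R^o -> M) : Prop :=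
  smooth_on_subset (@vec_atlas (R^o * R^o * R^o)%type) (@atlas E M) sphere2 u.

Definition sphere_integral (u : R^o * R^o * R^o -> M) : R :=
  (\int[(lebesgue_measure \x lebesgue_measure)%E]_(z in
     `[0%R, pi] `*` `[0%R, (2 * pi)%R]) pullback2 (u \o spherical_coord) z)%R.

(* < om, pi_2(M) >: the pairing is computed on smooth representatives. *)
Definition spherical_periods : set R :=
  [set r | exists2 u, smooth_sphere u & r = sphere_integral u].

End Forms.

Record loop (T : topologicalType) (x : T) := Loop {
  loop_fun :> R -> T;
  loop_continuous : {within `[0%R, 1%R], continuous loop_fun};
  loop0 : loop_fun 0 = x;
  loop1 : loop_fun 1 = x }.

Definition loop_homotopic (T : topologicalType) (x : T) (p q : loop x) : Prop :=
  exists H : R * R -> T,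
    [/\ {within `[0%R, 1%R] `*` `[0%R, 1%R], continuous H},
        forall t, 0 <= t <= 1 -> H (0, t) = p t /\ H (1, t) = q t
      & forall s, 0 <= s <= 1 -> H (s, 0) = x /\ H (s, 1) = x].

Section loop_concat.
Variables (T : topologicalType) (x : T) (p q : loop x).
Let pq (t : R) : T := if t <= 2^-1 then p (2 * t) else q (2 * t - 1).
Let within_comp (f : R -> T) (g : R -> R) (A B : set R) :
  {within B, continuous f} -> continuous g -> (forall t, A t -> B (g t)) ->
  {within A, continuous (f \o g)}.
Proof.
move=> /subspace_continuousP cf cg gAB; apply/subspace_continuousP => t At.
move=> U fU; have := cf _ (gAB _ At) _ fU => /cg; rewrite /= !nbhs_simpl /=.
by apply: filterS => s Bs As; exact: Bs (gAB _ As).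
Qed.
Let pq_continuous : {within `[0%R, 1%R], continuous pq}.
Proof.
have c1 : {within `[0, 2^-1], continuous pq}.
  apply: (@subspace_eq_continuous _ _ _ (p \o (fun t => 2 * t))).
    move=> t /set_mem; rewrite /= in_itv /= => /andP[_ t2].
    by rewrite /from_subspace /pq /= t2.
  apply: (within_comp (@loop_continuous _ _ p)); first exact: mulrl_continuous.
  by move=> t; rewrite /= !in_itv /= => /andP[? ?]; apply/andP; split; lra.
have c2 : {within `[2^-1, 1], continuous pq}.
  apply: (@subspace_eq_continuous _ _ _ (q \o (fun t => 2 * t - 1))).
    move=> t /set_mem; rewrite /= in_itv /= => /andP[t2 _].
    rewrite /from_subspace /pq /=; case: ifPn => // t2'; have -> : t = 2^-1 by apply/eqP; rewrite eq_le t2'.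
    by rewrite mulfV// subrr loop0 loop1.
  apply: (within_comp (@loop_continuous _ _ q)).
    move=> t; apply: continuousB; last exact: cst_continuous.
    exact: mulrl_continuous.
  by move=> t; rewrite /= !in_itv /= => /andP[? ?]; apply/andP; split; lra.
have -> : `[0, 1]%classic = `[0, 2^-1]%classic `|` `[2^-1, 1]%classic :> set R.
  apply/seteqP; split => t /=; rewrite !in_itv /=.
    by move=> /andP[-> ->]; rewrite andbT; apply/orP; exact: le_total.
  by move=> [|] /andP[? ?]; apply/andP; split; lra.
by apply: withinU_continuous => //; exact: itv_closed.
Qed.
Let pq0 : pq 0 = x.
Proof. by rewrite /pq invr_ge0 ler0n mulr0 loop0. Qed.
Let pq1 : pq 1 = x.
Proof.
by rewrite /pq leNgt invf_lt1 ?ltr1n// mulr1 (_ : 2 - 1 = 1 :> R) ?loop1//; lra.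
Qed.
Definition loop_concat : loop x := Loop pq_continuous pq0 pq1.
End loop_concat.

Definition pi1 (T : topologicalType) (x : T) : Type :=
  {C : set (loop x) | exists p, C = [set q | loop_homotopic p q]}.

Definition pi1_class (T : topologicalType) (x : T) (p : loop x) : pi1 x :=
  exist _ [set q | loop_homotopic p q] (ex_intro _ p erefl).

Definition pi1_repr (T : topologicalType) (x : T) (a : pi1 x) : loop x :=
  projT1 (cid (proj2_sig a)).

(* The class of the product does not depend on the chosen representatives. *)
Definition pi1_mul (T : topologicalType) (x : T) (a b : pi1 x) : pi1 x :=
  pi1_class (loop_concat (pi1_repr a) (pi1_repr b)).

Definition pi1_trivial (T : topologicalType) (x : T) : Prop :=
  forall a b : pi1 x, a = b.

Record lieGroup (E : tvsType R) := LieGroup {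
  lie_manifold :> manifold E;
  lie_mul : lie_manifold -> lie_manifold -> lie_manifold;
  lie_one : lie_manifold;
  lie_inv : lie_manifold -> lie_manifold;
  lie_mulA : associative lie_mul;
  lie_mul1g : left_id lie_one lie_mul;
  lie_mulVg : left_inverse lie_one lie_inv lie_mul;
  lie_mul_smooth :
    smooth (prod_atlas (@atlas E lie_manifold) (@atlas E lie_manifold))
           (@atlas E lie_manifold) (fun gh => lie_mul gh.1 gh.2);
  lie_inv_smooth :
    smooth (@atlas E lie_manifold) (@atlas E lie_manifold) lie_inv }.

Section Actions.
Variables (E F : tvsType R) (G : lieGroup E) (X : manifold F).
Variables (om : form2 X) (act : G -> X -> X) (mu : E -> X -> R).

(* Lie(G) is the tangent space of G at the identity, that is, E read in the
   chart chart_at (lie_one G). *)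
Definition Ad (g : G) (V : E) : E :=
  tangent_map (fun h : G => lie_mul (lie_mul g h) (lie_inv g)) (lie_one G) V.

Definition smooth_path (g : R -> G) : Prop :=
  smooth (@vec_atlas R^o) (@atlas E G) (g : R^o -> G).

Definition smooth_action : Prop :=
  [/\ forall x, act (lie_one G) x = x,
      forall g h x, act (lie_mul g h) x = act g (act h x)
    & smooth (prod_atlas (@atlas E G) (@atlas F X)) (@atlas F X)
             (fun gx : G * X => act gx.1 gx.2)].

Definition preserves_form : Prop :=
  forall g x u v,
    om (act g x) (tangent_map (act g) x u) (tangent_map (act g) x v) = om x u v.

(* xi is the value at x of the vector field on X generated by V. *)
Definition generated_by (V : E) (x : X) (xi : F) : Prop :=
  exists g : R -> G,
    [/\ smooth_path g, g 0 = lie_one G, velocity g 0 = V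
      & xi = velocity (fun t => act (g t) x) 0].

(* Continuity in V, which is automatic in finite dimension, makes the moment
   map take its values in the continuous dual of Lie(G). *)
Definition equivariant_moment_map : Prop :=
  [/\ forall x, linear (mu^~ x : E -> R^o) /\ continuous (mu^~ x : E -> R^o),
      forall V, smooth (@atlas F X) (@vec_atlas R^o) (mu V : X -> R^o),
      forall V x xi, generated_by V x xi ->
        forall w, om x xi w = - differential (mu V) x w
    & forall g V x, mu (Ad g V) (act g x) = mu V x].

Definition smooth_loop (phi : R -> G) : Prop :=
  [/\ smooth_path phi, forall t, phi (t + 1) = phi t & phi 0 = lie_one G].

Definition represents (phi : R -> G) (a : pi1 (lie_one G)) : Prop :=
  exists2 p : loop (lie_one G),
    forall t, 0 <= t <= 1 -> p t = phi t & a = pi1_class p.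

(* X_t = d/dtau |_(tau = t) phi_tau phi_t^-1, a tangent vector at the identity. *)
Definition right_velocity (phi : R -> G) (t : R) : E :=
  velocity (fun tau => lie_mul (phi tau) (lie_inv (phi t))) t.

Definition spanning_disk (phi : R -> G) (x : X) (D : R^o * R^o -> X) : Prop :=
  smooth_disk D /\
  forall t : R, D (cos (2 * pi * t), sin (2 * pi * t)) = act (phi t) x.

Definition action_value (phi : R -> G) (x : X) (D : R^o * R^o -> X) : R :=
  disk_integral om D -
  (\int[lebesgue_measure]_(t in `[0%R, 1%R])
     mu (right_velocity phi t) (act (phi t) x))%R.

End Actions.

End Calculus.

Section Cosets.
Context {R : realType}.
Implicit Types (P A B : set R) (r : R).

Definition additive_subgroup P : Prop :=
  P 0 /\ forall r s, P r -> P s -> P (r - s).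

Definition coset P r : set R := [set s | P (s - r)].

(* The Minkowski sum; on cosets of a subgroup P it is the group law of R/P. *)
Definition coset_add A B : set R := [set t | exists r s, [/\ A r, B s & t = r + s]].

End Cosets.

(* Main.v *)
(* Disks and spheres are replaced by tubes: smooth maps f (r, t) on the plane,
   1-periodic in t, seen as homotopies between the loops f (0, .) and f (1, .).
   The areas J of tubes are additive under concatenation, and the spherical
   periods are exactly the areas of the tubes joining two constant loops. A disk
   bounding a loop has the area of a tube contracting this loop, so that two
   contractions of the same loop have areas that differ by a spherical period.

   If phi and psi are loops in G and f is a tube from a point x0 to psi_t x, then
   H (r, t) = phi_t f (r, t) satisfies, by the moment map equation,
     om (H_r, H_t) = om (f_r, f_t) + d/dr mu (X_t) (H),
   while the right velocities obey X^(phi psi) = X^phi + Ad_phi X^psi. Hence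
   A (phi psi, x) = A (phi, x0) + A (psi, x). For psi = 1 and f a path, this is
   the independence of x.

   If psi is contractible, a null-homotopy of psi is smoothed into a tube Psi from
   1 to psi. With C = Psi x, a = mu (Psi_t Psi^-1) (C) and b = mu (Psi_r Psi^-1) (C),
   the moment map equation and the symmetry of second derivatives give
   d_r a - d_t b = om (C_r, C_t), so that A (psi) = 0. Applied to the pointwise
   quotient of two homotopic loops, this is the homotopy invariance; and the
   pointwise product of loops represents the product in pi_1. *)

From HB Require Import structures.
Require Import Defs.
From mathcomp Require Import all_boot all_order all_algebra ring lra zify.
From mathcomp Require Import all_classical all_reals all_analysis measurable_realfun.

Set Implicit Arguments.
Unset Strict Implicit.
Unset Printing Implicit Defensive.

Import Order.TTheory GRing.Theory Num.Theory.
Import numFieldNormedType.Exports.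

Local Open Scope classical_set_scope.
Local Open Scope ring_scope.

(** * Michal-Bastiani calculus *)

(** The model spaces have no norm, so the calculus rests on one mean value principle: a curve whose
    derivative stays in an open convex set has its mean slope in that set. Strict differentiability,
    the linearity of the derivative, the chain rule and the symmetry of second derivatives follow.

    The moment map is assumed continuous in [V] and smooth in [x] only separately. Its joint
    continuity along orbits comes from equivariance, as [mu V (act g x)] is [mu] at [x] of [V]
    transported by [Ad] of the inverse of [g]. For the same reason the r-increments of mu (Psi_t
    Psi^-1) (C) are first written as exact values of [mu] on the derivative of a quotient in [G].

    Maps are glued rather than mollified: each piece is made constant near its ends by the step
    function [lam], so that matching values suffice for smoothness. A homotopy is cut into cells
    that fit in convex charts; smooth edges are chosen first, then the cells are filled by convex
    combinations.

    The area of a disk is computed along horizontal chords, by Fubini and one-variable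
    substitutions. *)

Section SegmentInduction.
Context {R : realType}.

(** The supremum of the points reachable from [a] is reached by the leftward half of the local
    hypothesis, and the rightward half would push past it unless it is [b]. It turns pointwise
    derivatives into a statement on the whole segment. *)
Lemma segment_induction (P : R -> R -> Prop) (a b : R) : a < b ->
  (forall x y z, a <= x -> x < y -> y < z -> z <= b -> P x y -> P y z -> P x z) ->
  (forall x, a <= x <= b -> exists2 e, 0 < e &
     (forall u, a <= u -> x - e < u < x -> P u x) /\
     (forall v, v <= b -> x < v < x + e -> P x v)) ->
  P a b.
Proof.
move=> ab Pcat Ploc.
(* The alternative [t = a] stands in for [P a a], which is not assumed. *)
pose S := [set t | a <= t <= b /\ (t = a \/ P a t)].
have Sa : S a by split; [rewrite lexx ltW|left].
have hS : has_sup S by split; [exists a|exists b => t [/andP[]]].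
have aS : a <= sup S by apply: ub_le_sup => //; case: hS.
have Sb : sup S <= b by apply: sup_le_ub; [exists a|move=> t [/andP[]]].
have [e e0 [Pl Pr]] := Ploc (sup S) (introT andP (conj aS Sb)).
have Ss : S (sup S).
  split; first by rewrite aS.
  have [t [/andP[at_ tb] Pt] te] := sup_adherent e0 hS.
  have : t <= sup S by apply: ub_le_sup; [case: hS|split => //; rewrite at_].
  rewrite le_eqVlt => /orP[/eqP ts|ts]; first by rewrite -ts.
  right; have Pts : P t (sup S) by apply: Pl => //; rewrite te.
  by case: Pt => [<-//|Pat]; move: at_; rewrite le_eqVlt => /orP[/eqP->//|at_]; apply: (Pcat _ t).
case: (ltP (sup S) b) => [sb|bs]; last first.
  have sbE : sup S = b by apply/eqP; rewrite eq_le Sb.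
  by case: Ss => _; rewrite sbE => -[ba|//]; move: ab; rewrite ba ltxx.
pose v := Num.min b (sup S + e / 2).
have sv : sup S < v by rewrite lt_min sb ltrDl divr_gt0.
have vb : v <= b by rewrite ge_min lexx.
have Psv : P (sup S) v.
  apply: Pr => //; rewrite sv gt_min; apply/orP; right.
  by rewrite ltrD2l ltr_pdivrMr// ltr_pMr// ltr1n.
have : v <= sup S.
  apply: ub_le_sup; first by case: hS.
  split; first by rewrite vb (le_trans aS (ltW sv)).
  right; case: Ss => _ [sa|Pas]; first by rewrite -sa.
  by move: aS; rewrite le_eqVlt => /orP[/eqP->//|aS]; apply: (Pcat _ (sup S)).
by rewrite leNgt sv.
Qed.
End SegmentInduction.

(** * Convexity and the mean value principle in topological vector spaces *)

Section Tvs.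
Context {R : realType}.
Implicit Types E F H : tvsType R.

Lemma cvg_pairT (T : Type) (X : set_system T) {FX : Filter X} (U V : topologicalType)
    (f : T -> U) (g : T -> V) (a : U) (b : V) :
  f @ X --> a -> g @ X --> b -> (fun t => (f t, g t)) @ X --> ((a, b) : (U * V)%type).
Proof.
move=> fa gb A [[A1 A2] [/= /fa fA1 /gb gA2] sub].
move: fA1 gA2; rewrite !nbhs_simpl/=; apply: filterS2 => t ? ?.
exact: (sub (f t, g t)).
Qed.

Lemma cvg_comp_at (T : Type) (X : set_system T) (U V : topologicalType)
    (f : T -> U) (g : U -> V) (a : U) :
  f @ X --> a -> {for a, continuous g} -> (fun t => g (f t)) @ X --> g a.
Proof. by move=> fa ga A /ga /fa. Qed.

Lemma near_cvg (T : Type) (X : set_system T) {FX : Filter X} (U : topologicalType) (f g : T -> U) (a : U) :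
  (\forall t \near X, f t = g t) -> f @ X --> a -> g @ X --> a.
Proof. by move=> fg fa; apply: cvg_trans fa; exact: near_eq_cvg. Qed.

Lemma near_cst_cvg (T : Type) (X : set_system T) {FX : Filter X} (U : topologicalType) (f : T -> U) (a : U) :
  (\forall t \near X, f t = a) -> f @ X --> a.
Proof.
move=> fa; apply: (@near_cvg _ _ _ _ (fun=> a)); last exact: cvg_cst.
by apply: filterS fa.
Qed.

Lemma dnbhs0P (P : set R) : (\forall h \near (0:R)^', P h) <->
  exists2 e, 0 < e & forall h, `|h| < e -> h != 0 -> P h.
Proof.
split.
  move=> /nbhs_ballP[e /= e0 He]; exists e => // h he h0; apply: He => //=.
  by rewrite /ball/= sub0r normrN.
move=> [e e0 He]; apply/nbhs_ballP; exists e => //= h; rewrite /ball/= sub0r normrN.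
exact: He.
Qed.

Lemma tvs_cvgD E (T : Type) (X : set_system T) {FX : Filter X} (f g : T -> E) (a b : E) :
  f @ X --> a -> g @ X --> b -> (fun t => f t + g t) @ X --> a + b.
Proof.
move=> fa gb.
exact: (cvg_comp_at (cvg_pairT fa gb) (@add_continuous E (a, b))).
Qed.

Lemma tvs_cvgZ E (T : Type) (X : set_system T) {FX : Filter X} (k : T -> R^o) (g : T -> E) (a : R^o) (b : E) :
  k @ X --> a -> g @ X --> b -> (fun t => k t *: g t) @ X --> a *: b.
Proof.
move=> fa gb.
exact: (cvg_comp_at (cvg_pairT fa gb) (@scale_continuous R E (a, b))).
Qed.

Definition convexs E (K : set E) := forall x y (t : R), K x -> K y -> 0 <= t <= 1 ->
  K ((1 - t) *: x + t *: y).

Lemma locally_convexs E (x : E) (V : set E) : nbhs x V ->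
  exists K, [/\ open K, convexs K, K x & K `<=` V].
Proof.
have [B Bc [Bo Bb]] := @locally_convex R E.
move=> /(Bb x)[K [BK Kx] KV]; exists K; split => //; first exact: Bo.
move=> u v t Ku Kv /andP[t0 t1].
have Kc := Bc K (mem_set BK).
(* The convexity of the members of [B] takes its weight in an interval type, into which [1 - t] is
   packed. *)
have t01 : Itv.spec (@Itv.num_sem R) (Itv.Real `[0%Z, 1%Z]) (1 - t).
  by rewrite /Itv.spec/= /Itv.num_sem/= num_real/= in_itv/=; apply/andP; split; lra.
have := Kc u v (Itv.mk t01) (mem_set Ku) (mem_set Kv).
rewrite inE; suff -> : (1 - t) *: u + t *: v = (1 - t) *: u + (1 - (1 - t)) *: v by [].
by congr (_ + _ *: _); lra.
Qed.

(** With [a] and [b] the lengths of adjacent intervals, this averages their mean slopes into the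
    slope over the union. *)
Lemma convexs_open_between E (K : set E) : convexs K -> forall x y (a b : R), 0 < a -> 0 < b ->
  K x -> K y -> K ((a + b)^-1 *: (a *: x + b *: y)).
Proof.
move=> Kc x y a b a0 b0 Kx Ky.
have ab0 : 0 < a + b by rewrite addr_gt0.
have := Kc x y (b / (a + b)) Kx Ky.
rewrite scalerDr !scalerA (_ : 1 - b / (a + b) = (a + b)^-1 * a); last by field; lra.
rewrite (mulrC b); apply; apply/andP; split.
  by rewrite mulr_ge0 ?invr_ge0// ?ltW.
by rewrite mulrC ler_pdivrMr// mul1r lerDr ltW.
Qed.

(** Mean slopes over adjacent intervals average with convex weights, and slopes over short intervals
    ending or starting at [t] are close to [c' t], hence in the open set [K]. Segment induction
    passes from short intervals to [[a, b]]; it does the work of integrating [c']. *)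
Lemma convex_mean_value F (K : set F) (c c' : R -> F) (a b : R) : open K -> convexs K -> a < b ->
  (forall t, a <= t <= b -> @diff_quot R R^o F c t 1 h @[h --> (0 : R)^'] --> c' t) ->
  (forall t, a <= t <= b -> K (c' t)) ->
  K ((b - a)^-1 *: (c b - c a)).
Proof.
move=> oK cK ab dc Kc.
pose P (u v : R) := K ((v - u)^-1 *: (c v - c u)).
apply: (@segment_induction R P a b ab).
  move=> x y z _ xy yz _ Pxy Pyz; rewrite /P.
  have yx0 : 0 < y - x by rewrite subr_gt0.
  have zy0 : 0 < z - y by rewrite subr_gt0.
  have := convexs_open_between cK yx0 zy0 Pxy Pyz.
  rewrite !scalerA !mulfV ?gt_eqF// !scale1r (_ : y - x + (z - y) = z - x); last by lra.
  by rewrite (addrC (c y - c x)) addrA subrK.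
move=> x xab.
have /dc := xab => /(_ K (open_nbhs_nbhs (conj oK (Kc x xab)))).
rewrite nbhs_simpl/= => /dnbhs0P[e /= e0 He].
exists e => //; split.
  move=> u au /andP[xu ux].
  have /= := He (u - x); rewrite ler0_norm ?subr_le0 1?ltW// opprB.
  rewrite ltrBlDl -ltrBlDr => /(_ xu); rewrite subr_eq0 lt_eqF// => /(_ isT).
  rewrite /diff_quot /P/= [_ *: (1 : R^o)]mulr1 (addrC x) subrK => Ku.
  by rewrite -(opprB u x) -(opprB (c u) (c x)) invrN scaleNr scalerN opprK.
move=> v vb /andP[xv vx].
have /= := He (v - x); rewrite gtr0_norm ?subr_gt0//.
rewrite ltrBlDl => /(_ vx); rewrite subr_eq0 gt_eqF// => /(_ isT).
by rewrite /diff_quot /P/= [_ *: (1 : R^o)]mulr1 (addrC x) subrK.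
Qed.

(** A class, so that the Hausdorff property of products, such as the domains of iterated
    derivatives, is inferred. *)
Class hausT F : Prop := haus : hausdorff_space F.

#[global] Instance hausR : hausT R^o.
Proof. exact: Rhausdorff. Qed.

#[global] Instance haus_prod E F {hE : hausT E} {hF : hausT F} : hausT (E * F)%type.
Proof.
move=> [p1 p2] [q1 q2] pq; congr pair.
  apply: hE => A B Ap Bq.
  have [||[z1 z2] [/= ? ?]] := pq (A `*` setT) (B `*` setT).
  - by exists (A, setT) => //; split => //; exact: filterT.
  - by exists (B, setT) => //; split => //; exact: filterT.
  by exists z1; split; tauto.
apply: hF => A B Ap Bq.
have [||[z1 z2] [/= ? ?]] := pq (setT `*` A) (setT `*` B).
- by exists (setT, A) => //; split => //; exact: filterT.
- by exists (setT, B) => //; split => //; exact: filterT.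
by exists z2; split; tauto.
Qed.
End Tvs.

(** * Directional derivatives and C^n maps *)

Section Ddiff.
Context {R : realType}.
Implicit Types E F H : tvsType R.

Lemma ddiffP E F (f : E -> F) x v : ddifferentiable f x v ->
  diff_quot f x v h @[h --> (0 : R)^'] --> ddiff f x v.
Proof. by move=> df; exact: (xgetPex 0 df). Qed.

Lemma ddiffE E F {hF : hausT F} (f : E -> F) x v w :
  diff_quot f x v h @[h --> (0 : R)^'] --> w -> ddiff f x v = w.
Proof.
move=> fw; apply: (cvg_unique hF (F := diff_quot f x v h @[h --> (0 : R)^'])) => //.
by apply: ddiffP; exists w.
Qed.

Lemma dnbhs0_cvg : (fun h : R => h) @ ((0 : R)^') --> (0 : R^o).
Proof. by move=> A; exact: nbhs_dnbhs. Qed.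

Lemma line_cvg E (x v : E) : (fun h : R => x + h *: v) @ ((0 : R)^') --> x.
Proof.
have -> : x = x + (0 : R^o) *: v by rewrite scale0r addr0.
apply: tvs_cvgD; first by rewrite scale0r addr0; exact: cvg_cst.
by apply: tvs_cvgZ; [exact: dnbhs0_cvg|exact: cvg_cst].
Qed.

Lemma near_ddiff E F {hF : hausT F} (f g : E -> F) x v :
  (\forall y \near x, f y = g y) -> ddiff f x v = ddiff g x v.
Proof.
move=> fg; congr xget; apply/funext => w; apply/propext.
have H : \forall h \near (0:R)^', diff_quot f x v h = diff_quot g x v h.
  have := @line_cvg E x v _ fg; rewrite nbhs_simpl/=; apply: filterS => h.
  by rewrite /diff_quot => ->; rewrite (nbhs_singleton fg).
split; first exact: near_cvg.
by apply: near_cvg; apply: filterS H => h.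
Qed.

Lemma near_ddifferentiable E F (f g : E -> F) x v :
  (\forall y \near x, f y = g y) -> ddifferentiable f x v -> ddifferentiable g x v.
Proof.
move=> fg [w fw]; exists w; apply: near_cvg fw.
have := @line_cvg E x v _ fg; rewrite nbhs_simpl/=; apply: filterS => h.
by rewrite /diff_quot => ->; rewrite (nbhs_singleton fg).
Qed.

Lemma Ck_continuous n E F U (f : E -> F) x : Ck n U f -> U x -> {for x, continuous f}.
Proof. by case: n => [|n] /=; [|case] => cf *; exact: cf. Qed.

Lemma Ck_subset n E F (U V : set E) (f : E -> F) : V `<=` U -> Ck n U f -> Ck n V f.
Proof.
elim: n E F U V f => [|n IH] E F U V f VU /=; first by move=> cf x /VU; exact: cf.
move=> [cf df ddf]; split; [by move=> x /VU; exact: cf|by move=> x v /VU; exact: df|].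
by apply: IH ddf => -[x v] [/= /VU ? ?].
Qed.

(** [Ck] tests continuity and differentiability at each point in the ambient topology, so it
    restricts to arbitrary subsets, and [V] may be any set containing the point. *)
Lemma Ck_pointwise n E F (U : set E) (f : E -> F) :
  (forall x, U x -> exists2 V, V x & Ck n V f) -> Ck n U f.
Proof.
elim: n E F U f => [|n IH] E F U f Uf /=; first by move=> x /Uf[V Vx]; exact.
split; first by move=> x /Uf[V Vx [cf _ _]]; exact: cf.
  by move=> x v /Uf[V Vx [_ df _]]; exact: df.
by apply: IH => -[x v] [/= /Uf[V Vx [_ _ df]] _]; exists (V `*` setT).
Qed.

Lemma CkS n E F (U : set E) (f : E -> F) : Ck n.+1 U f -> Ck n U f.
Proof.
elim: n E F U f => [|n IH] E F U f; first by case.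
by move=> [cf df ddf]; split => //; exact: IH.
Qed.

Lemma Ck_leq m n E F (U : set E) (f : E -> F) : (m <= n)%N -> Ck n U f -> Ck m U f.
Proof.
elim: n m => [|n IH] m; first by rewrite leqn0 => /eqP->.
rewrite leq_eqVlt => /orP[/eqP->//|]; rewrite ltnS => /IH mn /CkS; exact: mn.
Qed.

Lemma open_setXT E F (U : set E) : open U -> open (U `*` [set: F]).
Proof.
move=> oU; rewrite openE => -[x v] [/= Ux _].
by exists (U, setT) => //; split; [exact: open_nbhs_nbhs|exact: filterT].
Qed.

Lemma Ck_eq n E F {hF : hausT F} (U : set E) (f g : E -> F) : open U ->
  (forall x, U x -> f x = g x) -> Ck n U f -> Ck n U g.
Proof.
elim: n E F hF U f g => [|n IH] E F hF U f g oU fg /=.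
  move=> cf x Ux; have fgx : \forall y \near x, f y = g y.
    by apply: filterS (open_nbhs_nbhs (conj oU Ux)).
  by rewrite /prop_for /continuous_at -(fg x Ux); apply: near_cvg (cf x Ux).
have fgx x : U x -> \forall y \near x, f y = g y.
  by move=> Ux; apply: filterS (open_nbhs_nbhs (conj oU Ux)).
move=> [cf df ddf]; split.
- move=> x Ux; rewrite /prop_for /continuous_at -(fg x Ux); apply: near_cvg (cf x Ux).
  exact: fgx.
- by move=> x v Ux; apply: near_ddifferentiable (df x v Ux); exact: fgx.
- apply: IH ddf; first exact: open_setXT.
  by move=> [x v] [/= Ux _]; apply: near_ddiff; exact: fgx.
Qed.

(* Strict differentiability. *)
Lemma C1_strict E F {hF : hausT F} (U : set E) (f : E -> F) x v (K : set F) :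
  open U -> Ck 1 U f -> U x -> nbhs (ddiff f x v) K ->
  \forall p \near ((x, v), 0 : R^o), p.2 != 0 -> K (diff_quot f p.1.1 p.1.2 p.2).
Proof.
move=> oU [cf df cdf] Ux /locally_convexs[K0 [oK0 cK0 K0v K0K]].
have HO : \forall q \near ((x, v) : E * E), U q.1 /\ K0 (ddiff f q.1 q.2).
  apply: filterI.
    by exists (U, setT) => //; [split; [exact: open_nbhs_nbhs|exact: filterT]|move=> [a b] []].
  have := cdf (x, v); apply; first by split.
  exact: open_nbhs_nbhs.
have mc : (fun p : E * E * R^o => (p.1.1 + p.2 *: p.1.2, p.1.2)) @ ((x, v), 0 : R^o) --> ((x, v) : (E * E)%type).
  have c1 : (fun p : E * E * R^o => p.1.1) @ ((x, v), 0 : R^o) --> x.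
    by apply: (cvg_comp _ _ cvg_fst) => /=; exact: cvg_fst.
  have c2 : (fun p : E * E * R^o => p.1.2) @ ((x, v), 0 : R^o) --> v.
    by apply: (cvg_comp _ _ cvg_fst) => /=; exact: cvg_snd.
  have c3 : (fun p : E * E * R^o => p.2) @ ((x, v), 0 : R^o) --> (0 : R^o) by exact: cvg_snd.
  apply: cvg_pairT => //.
  have := tvs_cvgD c1 (tvs_cvgZ c3 c2).
  by move=> /(_ _ _); rewrite scale0r addr0; exact.
have [[A B] /= [HA /nbhs_ballP[d /= d0 Hd]] AB] := mc _ HO.
exists (A, ball (0 : R^o) d); first by split => //; exact: nbhsx_ballx.
move=> [[y w] h] [/= Ayw]; rewrite /ball/= sub0r normrN => hd h0; apply: K0K.
have Oh k : `|k| < d -> U (y + k *: w) /\ K0 (ddiff f (y + k *: w) w).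
  by move=> kd; apply: (AB ((y, w), k)); split => //; apply: Hd; rewrite /ball/= sub0r normrN.
(* The difference quotient is the mean slope of [f] along the segment from [y] to [y + h w], where
   the derivatives stay in [K0]. *)
pose c (s : R) := f (y + s *: w).
have dc s : `|s| < d -> @diff_quot R R^o F c s 1 k @[k --> (0 : R)^'] --> ddiff f (y + s *: w) w.
  move=> sd; have [Us _] := Oh s sd; have := ddiffP (df _ w Us).
  apply: near_cvg; near=> k.
  by rewrite /diff_quot /c [_ *: (1 : R^o)]mulr1 scalerDl addrA.
move: h0; rewrite neq_lt => /orP[h0|h0].
  have H t : h <= t <= 0 -> `|t| < d.
    by move=> /andP[ht t0]; rewrite (le_lt_trans _ hd)// !ler0_norm ?(ltW h0)// lerN2.
  have := @convex_mean_value _ F K0 c (fun s => ddiff f (y + s *: w) w) h 0 oK0 cK0 h0.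
  rewrite /c scale0r addr0 sub0r invrN scaleNr -scalerN opprB; apply.
    by move=> t /H; exact: dc.
  by move=> t /H /Oh[].
have H t : 0 <= t <= h -> `|t| < d.
  by move=> /andP[t0 th]; rewrite (le_lt_trans _ hd)// !ger0_norm ?(ltW h0).
have := @convex_mean_value _ F K0 c (fun s => ddiff f (y + s *: w) w) 0 h oK0 cK0 h0.
rewrite /c scale0r addr0 subr0; apply.
  by move=> t /H; exact: dc.
by move=> t /H /Oh[].
Unshelve. all: by end_near. Qed.

Lemma C1_strict_cvg E F {hF : hausT F} (U : set E) (f : E -> F) x v (T : Type)
    (X : set_system T) {FX : Filter X} (y w : T -> E) (h : T -> R) :
  open U -> Ck 1 U f -> U x -> y @ X --> x -> w @ X --> v -> h @ X --> (0 : R^o) ->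
  (\forall t \near X, h t != 0) ->
  (fun t => diff_quot f (y t) (w t) (h t)) @ X --> ddiff f x v.
Proof.
move=> oU f1 Ux yx wv h0 hn0 K /(C1_strict oU f1 Ux) HK.
have : (fun t => ((y t, w t), h t : R^o)) @ X --> ((x, v), 0 : R^o).
  by apply: cvg_pairT => //; exact: cvg_pairT.
move=> /(_ _ HK); rewrite !nbhs_simpl/= => HH.
by apply: filterS2 hn0 HH => t h0t; exact.
Qed.

(** Additivity is not built into the directional derivative. The step [h (u + v)] is cut at
    [x + h u]; strict differentiability handles the second half, whose base point moves with [h]. *)
Lemma ddiffD E F {hF : hausT F} (U : set E) (f : E -> F) x u v :
  open U -> Ck 1 U f -> U x -> ddiff f x (u + v) = ddiff f x u + ddiff f x v.
Proof.
move=> oU f1 Ux; apply: ddiffE.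
have H1 : diff_quot f x u h @[h --> (0 : R)^'] --> ddiff f x u.
  by apply: ddiffP; case: f1 => _ df _; exact: df.
have H2 : diff_quot f (x + h *: u) v h @[h --> (0 : R)^'] --> ddiff f x v.
  apply: (@C1_strict_cvg _ _ _ U f x v R ((0:R)^') _ (fun h : R => x + h *: u) (fun=> v) id) => //.
  - exact: line_cvg.
  - exact: cvg_cst.
  - exact: dnbhs0_cvg.
  - exact: nbhs_dnbhs_neq.
apply: near_cvg (tvs_cvgD H1 H2); near=> h.
rewrite /diff_quot -[LHS]scalerDr (scalerDr h) [x + (_ + _)]addrA; congr (_ *: _).
by rewrite [LHS]addrC subrKA.
Unshelve. all: by end_near. Qed.

Lemma diff_quotZ E F (f : E -> F) x v (a : R) w :
  diff_quot f x v h @[h --> (0 : R)^'] --> w ->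
  diff_quot f x (a *: v) h @[h --> (0 : R)^'] --> a *: w.
Proof.
move=> df; have [->|a0] := eqVneq a 0.
  rewrite scale0r; apply: near_cst_cvg; near=> h.
  by rewrite /diff_quot scale0r scaler0 addr0 subrr scaler0.
have Z : (fun h : R => a * h) @ ((0:R)^') --> (0:R)^'.
  move=> A /= /dnbhs0P[e e0 He]; apply/dnbhs0P; exists (e / `|a|) => /=.
    by rewrite divr_gt0// normr_gt0.
  move=> h; rewrite ltr_pdivlMr ?normr_gt0// => ha h0.
  by apply: He; rewrite ?mulf_neq0// normrM mulrC.
have := cvg_comp _ _ Z df => H.
apply: near_cvg (tvs_cvgZ (cvg_cst (a : R^o)) H); near=> h; rewrite /diff_quot/= [LHS]scalerA invfM mulrA mulfV// mul1r.
by rewrite scalerA (mulrC h).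
Unshelve. all: by end_near. Qed.

Lemma ddiffZ E F {hF : hausT F} (f : E -> F) x v (a : R) :
  ddifferentiable f x v -> ddiff f x (a *: v) = a *: ddiff f x v.
Proof. by move=> /ddiffP df; apply: ddiffE; exact: diff_quotZ. Qed.

Lemma ddiff0 E F {hF : hausT F} (f : E -> F) x : ddiff f x 0 = 0.
Proof.
apply: ddiffE; apply: near_cst_cvg; near=> h.
by rewrite /diff_quot scaler0 addr0 subrr scaler0.
Unshelve. all: by end_near.
Qed.

(* The step of the composite: f (x + h v) = f x + h w_h with w_h -> df(x; v). *)
Lemma ddiff_comp_cvg E F H {hF : hausT F} {hH : hausT H} (V : set F) (f : E -> F) (g : F -> H) x v :
  ddifferentiable f x v -> open V -> Ck 1 V g -> V (f x) ->
  diff_quot (g \o f) x v h @[h --> (0 : R)^'] --> ddiff g (f x) (ddiff f x v).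
Proof.
move=> df oV g1 Vfx.
have : diff_quot g (f x) (diff_quot f x v h) h @[h --> (0 : R)^'] --> ddiff g (f x) (ddiff f x v).
  apply: (@C1_strict_cvg _ _ _ V g (f x) _ R ((0:R)^') _ (fun=> f x) (diff_quot f x v) id) => //.
  - exact: cvg_cst.
  - exact: ddiffP.
  - exact: dnbhs0_cvg.
  - exact: nbhs_dnbhs_neq.
apply: near_cvg; near=> h.
have h0 : h != 0 by near: h; exact: nbhs_dnbhs_neq.
by rewrite /diff_quot/= scalerA mulfV// scale1r (addrC (f x)) subrK.
Unshelve. all: by end_near. Qed.

Lemma ddiff_comp E F H {hF : hausT F} {hH : hausT H} (V : set F) (f : E -> F) (g : F -> H) x v :
  ddifferentiable f x v -> open V -> Ck 1 V g -> V (f x) ->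
  ddiff (g \o f) x v = ddiff g (f x) (ddiff f x v).
Proof. by move=> df oV g1 Vfx; apply: ddiffE; exact: (ddiff_comp_cvg df oV g1 Vfx). Qed.

Definition tvs_linear E F (f : E -> F) :=
  continuous f /\ forall (a : R) x y, f (a *: x + y) = a *: f x + f y.

Lemma tvs_linearD E F (f : E -> F) x y : tvs_linear f -> f (x + y) = f x + f y.
Proof. by move=> [_ lf]; rewrite -[x in LHS]scale1r lf scale1r. Qed.

Lemma tvs_linear0 E F (f : E -> F) : tvs_linear f -> f 0 = 0.
Proof. by move=> lf; apply: (addrI (f 0)); rewrite -tvs_linearD// !addr0. Qed.

Lemma tvs_linearZ E F (f : E -> F) a x : tvs_linear f -> f (a *: x) = a *: f x.
Proof. by move=> lf; rewrite -[a *: x]addr0 lf.2 tvs_linear0// addr0. Qed.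

Lemma linear_diff_quot E F (f : E -> F) x v : tvs_linear f ->
  diff_quot f x v h @[h --> (0 : R)^'] --> f v.
Proof.
move=> lf; apply: near_cst_cvg; near=> h.
have h0 : h != 0 by near: h; exact: nbhs_dnbhs_neq.
rewrite /diff_quot (tvs_linearD x (h *: v) lf) (tvs_linearZ h v lf).
by rewrite addrAC subrr add0r scalerA mulVf// scale1r.
Unshelve. all: by end_near. Qed.

Lemma ddiff_linear E F {hF : hausT F} (f : E -> F) x v : tvs_linear f -> ddiff f x v = f v.
Proof. by move=> lf; apply: ddiffE; exact: linear_diff_quot. Qed.

Lemma tvs_linear_comp E F H (f : E -> F) (g : F -> H) : tvs_linear f -> tvs_linear g -> tvs_linear (g \o f).
Proof.
move=> [cf lf] [cg lg]; split; first by move=> x; apply: continuous_comp; [exact: cf|exact: cg].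
by move=> a x y /=; rewrite lf lg.
Qed.

Lemma tvs_linear_fst E F : tvs_linear (fun p : E * F => p.1).
Proof. by split => // x; exact: cvg_fst. Qed.
Lemma tvs_linear_snd E F : tvs_linear (fun p : E * F => p.2).
Proof. by split => // x; exact: cvg_snd. Qed.
Lemma tvs_linear_add E : tvs_linear (fun p : E * E => p.1 + p.2).
Proof.
split; first exact: add_continuous.
by move=> a [x1 x2] [y1 y2] /=; rewrite scalerDr addrACA.
Qed.
Lemma tvs_linear_scale E (a : R) : tvs_linear (fun x : E => a *: x).
Proof.
split; first by move=> x; apply: tvs_cvgZ; [exact: cvg_cst|exact: cvg_id].
by move=> b x y; rewrite scalerDr !scalerA mulrC.
Qed.
Lemma tvs_linear_pair E F H (f : E -> F) (g : E -> H) :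
  tvs_linear f -> tvs_linear g -> tvs_linear (fun x => (f x, g x)).
Proof.
move=> [cf lf] [cg lg]; split; first by move=> x; apply: cvg_pairT; [exact: cf|exact: cg].
by move=> a x y /=; rewrite lf lg.
Qed.
Lemma tvs_linear_id E : tvs_linear (@id E).
Proof. by split => // x; exact: cvg_id. Qed.

(** The derivative of a continuous linear map is that map after [snd], again continuous and linear
    on a larger space: the induction generalises over the spaces. *)
Lemma Ck_linear n E F {hF : hausT F} (f : E -> F) (U : set E) : tvs_linear f -> Ck n U f.
Proof.
move=> lf; apply: (@Ck_subset n _ _ setT) => //.
elim: n E F hF f lf {U} => [|n IH] E F hF f lf /=; first by move=> x _; exact: lf.1.
split; first by move=> x _; exact: lf.1.
  by move=> x v _; exists (f v); exact: linear_diff_quot.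
apply: (@Ck_eq n _ _ _ _ (f \o snd)); first by apply: open_setXT; exact: openT.
  by move=> [x v] _ /=; rewrite ddiff_linear.
apply: (@Ck_subset n _ _ setT) => //.
by apply: IH; apply: tvs_linear_comp lf; exact: tvs_linear_snd.
Qed.

Lemma Ck_cst n E F {hF : hausT F} (U : set E) (a : F) : Ck n U (fun=> a).
Proof.
apply: (@Ck_subset n _ _ setT) => //.
have D E' (a' : F) x v : diff_quot (fun _ : E' => a') x v h @[h --> (0 : R)^'] --> (0 : F).
  apply: near_cst_cvg; near=> h.
  by rewrite /diff_quot subrr scaler0.
elim: n E U a => [|n IH] E U a /=; first by move=> x _; exact: cvg_cst.
split; first by move=> x _; exact: cvg_cst.
  by move=> x v _; exists 0.
apply: (@Ck_eq n _ _ _ _ (fun=> 0)); first by apply: open_setXT; exact: openT.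
  by move=> p _; apply/esym/ddiffE.
apply: (@Ck_subset n _ _ setT) => //.
exact: (IH _ setT (0 : F)).
Unshelve. all: by end_near. Qed.

Lemma diff_quot_pair E F H (f : E -> F) (g : E -> H) x v (a : F) (b : H) :
  diff_quot f x v h @[h --> (0 : R)^'] --> a -> diff_quot g x v h @[h --> (0 : R)^'] --> b ->
  diff_quot (fun x => (f x, g x)) x v h @[h --> (0 : R)^'] --> ((a, b) : (F * H)%type).
Proof. by move=> fa gb; exact: cvg_pairT fa gb. Qed.

Lemma ddiff_pair E F H {hF : hausT F} {hH : hausT H} (f : E -> F) (g : E -> H) x v :
  ddifferentiable f x v -> ddifferentiable g x v ->
  ddiff (fun x => (f x, g x)) x v = (ddiff f x v, ddiff g x v).
Proof. by move=> /ddiffP df /ddiffP dg; apply: ddiffE; exact: diff_quot_pair. Qed.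

Lemma Ck_pair n E F H {hF : hausT F} {hH : hausT H} (f : E -> F) (g : E -> H) (U : set E) :
  open U -> Ck n U f -> Ck n U g -> Ck n U (fun x => (f x, g x)).
Proof.
elim: n E F H hF hH f g U => [|n IH] E F H hF hH f g U oU /=.
  by move=> cf cg x Ux; apply: cvg_pairT; [exact: cf|exact: cg].
move=> [cf df ddf] [cg dg ddg]; split.
- by move=> x Ux; apply: cvg_pairT; [exact: cf|exact: cg].
- move=> x v Ux; exists (ddiff f x v, ddiff g x v); apply: diff_quot_pair.
    by apply: ddiffP; exact: df.
  by apply: ddiffP; exact: dg.
apply: (@Ck_eq n _ _ _ _ (fun p => (ddiff f p.1 p.2, ddiff g p.1 p.2))).
- exact: open_setXT.
- by move=> [x v] [/= Ux _]; rewrite ddiff_pair//; [exact: df|exact: dg].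
by apply: IH => //; exact: open_setXT.
Qed.

(** The derivative of [g \o f] is the derivative of [g] after [(x, v) |-> (f x, ddiff f x v)]: again
    a composite, on larger spaces, which is why the induction on [n] quantifies over all spaces. *)
Lemma Ck_comp n E F H {hE : hausT E} {hF : hausT F} {hH : hausT H} (f : E -> F) (g : F -> H) (U : set E) (V : set F) :
  open U -> open V -> (forall x, U x -> V (f x)) -> Ck n U f -> Ck n V g -> Ck n U (g \o f).
Proof.
elim: n E F H hE hF hH f g U V => [|n IH] E F H hE hF hH f g U V oU oV UV.
  by move=> cf cg x Ux; apply: continuous_comp; [exact: cf|exact: cg (UV _ Ux)].
move=> f1 g1; have [cf df ddf] := f1; have [cg dg ddg] := g1.
have g1' : Ck 1 V g by apply: Ck_leq g1.
split.
- by move=> x Ux; apply: continuous_comp; [exact: cf|exact: cg (UV _ Ux)].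
- move=> x v Ux; exists (ddiff g (f x) (ddiff f x v)).
  by apply: (ddiff_comp_cvg (df x v Ux) oV g1'); exact: UV.
apply: (@Ck_eq n _ _ _ _ ((fun q => ddiff g q.1 q.2) \o (fun p => (f p.1, ddiff f p.1 p.2)))).
- exact: open_setXT.
- move=> [x v] [/= Ux _]; rewrite (ddiff_comp (df x v Ux) oV g1') //.
  exact: UV.
apply: (IH _ _ _ _ _ _ _ _ _ (V `*` setT)) => //; [exact: open_setXT|exact: open_setXT| |].
  by move=> [x v] [/= Ux _]; split => //=; exact: UV.
apply: Ck_pair => //; first exact: open_setXT.
apply: (IH _ _ _ _ _ _ (fun p : E * E => p.1) f _ U).
- exact: open_setXT.
- exact: oU.
- by move=> [x v] [].
- by apply: Ck_linear; exact: tvs_linear_fst.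
- exact: CkS.
Qed.

(* Bilinear maps: db((x, y); (u, v)) = b(x, v) + b(u, y). *)
Lemma Ck_bilinear n E F H {hE : hausT E} {hF : hausT F} {hH : hausT H} (b : E * F -> H) (U : set (E * F)) :
  continuous b -> (forall a x y z, b (a *: x + y, z) = a *: b (x, z) + b (y, z)) ->
  (forall a x y z, b (x, a *: y + z) = a *: b (x, y) + b (x, z)) -> Ck n U b.
Proof.
move=> cb bl br; apply: (@Ck_subset n _ _ setT) => // {U}.
have bD1 x y z : b (x + y, z) = b (x, z) + b (y, z) by rewrite -[x]scale1r bl !scale1r.
have bD2 x y z : b (x, y + z) = b (x, y) + b (x, z) by rewrite -[y]scale1r br !scale1r.
have b0l z : b (0, z) = 0 by apply: (addrI (b (0, z))); rewrite -bD1 !addr0.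
have b0r z : b (z, 0) = 0 by apply: (addrI (b (z, 0))); rewrite -bD2 !addr0.
have bZ1 a x z : b (a *: x, z) = a *: b (x, z) by rewrite -[a *: x]addr0 bl b0l addr0.
have bZ2 a x z : b (x, a *: z) = a *: b (x, z) by rewrite -[a *: z]addr0 br b0r addr0.
have D (x v : E * F) : diff_quot b x v h @[h --> (0 : R)^'] --> b (x.1, v.2) + b (v.1, x.2).
  have : (fun h : R => b (x.1, v.2) + b (v.1, x.2 + h *: v.2)) @ ((0:R)^') -->
         b (x.1, v.2) + b (v.1, x.2).
    apply: tvs_cvgD; first exact: cvg_cst.
    apply: (@cvg_comp_at _ _ _ _ (fun h : R => (v.1, x.2 + h *: v.2)) b (v.1, x.2)); last exact: cb.
    by apply: cvg_pairT; [exact: cvg_cst|exact: line_cvg].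
  apply: near_cvg; near=> h.
  have h0 : h != 0 by near: h; exact: nbhs_dnbhs_neq.
  case: x v => [x1 x2] [v1 v2] /=; rewrite /diff_quot/= (_ : (x1, x2) + h *: (v1, v2) = (x1 + h *: v1, x2 + h *: v2))//.
  rewrite bD1 [b (x1, x2 + _)]bD2 bZ2 bZ1 (_ : forall P A B : H, P + A + B - P = A + B); last first.
    by move=> P A B; rewrite -[P + A + B]addrA (addrC P) addrK.
by rewrite -scalerDr scalerA mulVf// scale1r.
elim: n => [|n IH] /=; first by move=> x _; exact: cb.
split; first by move=> x _; exact: cb.
  by move=> x v _; exists (b (x.1, v.2) + b (v.1, x.2)).
pose l1 (p : (E * F) * (E * F)) := (p.1.1, p.2.2).
pose l2 (p : (E * F) * (E * F)) := (p.2.1, p.1.2).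
have cl1 : tvs_linear l1.
  apply: tvs_linear_pair.
    by apply: (@tvs_linear_comp _ _ _ fst fst); exact: tvs_linear_fst.
  by apply: (@tvs_linear_comp _ _ _ snd snd); exact: tvs_linear_snd.
have cl2 : tvs_linear l2.
  apply: tvs_linear_pair.
    by apply: (@tvs_linear_comp _ _ _ snd fst); [exact: tvs_linear_snd|exact: tvs_linear_fst].
  by apply: (@tvs_linear_comp _ _ _ fst snd); [exact: tvs_linear_fst|exact: tvs_linear_snd].
apply: (@Ck_eq n _ _ _ _ ((fun p : H * H => p.1 + p.2) \o (fun p => (b (l1 p), b (l2 p))))).
- by apply: open_setXT; exact: openT.
- by move=> [x v] _; apply/esym/ddiffE.
apply: (@Ck_subset n _ _ setT) => //.
apply: (@Ck_comp n _ _ _ _ _ _ _ _ setT setT) => //; [exact: openT|exact: openT| |].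
  apply: Ck_pair; first exact: openT.
    apply: (@Ck_comp n _ _ _ _ _ _ l1 b setT setT) => //; [exact: openT|exact: openT|].
    exact: Ck_linear.
  apply: (@Ck_comp n _ _ _ _ _ _ l2 b setT setT) => //; [exact: openT|exact: openT|].
  exact: Ck_linear.
by apply: Ck_linear; exact: tvs_linear_add.
Unshelve. all: by end_near. Qed.

End Ddiff.

(** * Elementary functions and the smooth step [lam] *)

Section Arith.
Context {R : realType}.
Implicit Types E F : tvsType R.

Lemma Ck_add n E F {hE : hausT E} {hF : hausT F} (U : set E) (f g : E -> F) : open U ->
  Ck n U f -> Ck n U g -> Ck n U (fun x => f x + g x).
Proof.
move=> oU fn gn.
apply: (@Ck_comp R n _ _ _ _ _ _ (fun x => (f x, g x)) (fun p : F * F => p.1 + p.2) U setT) => //.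
- exact: openT.
- exact: Ck_pair.
- by apply: Ck_linear; exact: tvs_linear_add.
Qed.

Lemma Ck_scale n E F {hE : hausT E} {hF : hausT F} (U : set E) (k : E -> R^o) (g : E -> F) : open U ->
  Ck n U k -> Ck n U g -> Ck n U (fun x => k x *: g x).
Proof.
move=> oU fn gn.
apply: (@Ck_comp R n _ _ _ _ _ _ (fun x => (k x, g x)) (fun p : R^o * F => p.1 *: p.2) U setT) => //.
- exact: openT.
- exact: Ck_pair.
- apply: Ck_bilinear; first exact: scale_continuous.
    by move=> a x y z /=; rewrite scalerDl scalerA.
  by move=> a x y z /=; rewrite scalerDr !scalerA mulrC.
Qed.

Lemma Ck_mul n E {hE : hausT E} (U : set E) (k g : E -> R^o) : open U ->
  Ck n U k -> Ck n U g -> Ck n U ((fun x => k x * g x) : E -> R^o).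
Proof. exact: Ck_scale. Qed.

Lemma Ck_opp n E F {hE : hausT E} {hF : hausT F} (U : set E) (f : E -> F) : open U ->
  Ck n U f -> Ck n U (fun x => - f x).
Proof.
move=> oU fn.
apply: (@Ck_comp R n _ _ _ _ _ _ f (fun p : F => - p) U setT) => //; first exact: openT.
apply: (@Ck_eq R n _ _ _ _ (fun x : F => (-1) *: x)); first exact: openT.
  by move=> x _; rewrite scaleN1r.
by apply: Ck_linear; exact: tvs_linear_scale.
Qed.

Lemma Ck_sub n E F {hE : hausT E} {hF : hausT F} (U : set E) (f g : E -> F) : open U ->
  Ck n U f -> Ck n U g -> Ck n U (fun x => f x - g x).
Proof. by move=> oU fn gn; apply: Ck_add => //; exact: Ck_opp. Qed.

Lemma is_derive_diff_quot (f : R^o -> R^o) (x l : R^o) :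
  is_derive x (1 : R^o) f l -> diff_quot f x 1 h @[h --> (0 : R)^'] --> l.
Proof.
move=> [df <-]; apply: near_cvg df; near=> h.
by rewrite /diff_quot; congr (_ *: (f _ - _)); exact: addrC.
Unshelve. all: by end_near. Qed.

Lemma diff_quot_is_derive (f : R^o -> R^o) (x l : R^o) :
  diff_quot f x 1 h @[h --> (0 : R)^'] --> l -> is_derive x (1 : R^o) f l.
Proof.
move=> df.
have H : h^-1 *: ((f \o shift x) (h *: (1 : R^o)) - f x) @[h --> (0 : R)^'] --> l.
  apply: near_cvg df; near=> h.
  by rewrite /diff_quot; congr (_ *: (f _ - _)); exact: addrC.
split; first by apply/cvg_ex; exists l.
exact: (cvg_lim (@Rhausdorff R) H).
Unshelve. all: by end_near. Qed.

Lemma Ck_R n (U : set R^o) (f f' : R^o -> R^o) : open U ->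
  (forall x, U x -> is_derive x (1 : R^o) f (f' x)) -> Ck n U f' -> Ck n.+1 U f.
Proof.
move=> oU ff' f'n.
have dq x v : U x -> diff_quot f x v h @[h --> (0 : R)^'] --> v *: f' x.
  move=> Ux; have -> : v = v *: (1 : R^o) by rewrite /GRing.scale/= mulr1.
  have := diff_quotZ (a := v) (is_derive_diff_quot (ff' x Ux)).
  by rewrite /GRing.scale/= mulr1.
split.
- move=> x Ux; apply: differentiable_continuous; apply/derivable1_diffP.
  by case: (ff' x Ux).
- by move=> x v Ux; exists (v *: f' x); exact: dq.
apply: (@Ck_eq R n _ _ _ _ (fun p : R^o * R^o => p.2 *: f' p.1)).
- exact: open_setXT.
- by move=> [x v] [/= Ux _]; apply/esym/ddiffE; exact: dq.
apply: Ck_scale; first exact: open_setXT.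
  by apply: Ck_linear; exact: tvs_linear_snd.
apply: (@Ck_comp R n _ _ _ _ _ _ fst f' _ U) => //; [exact: open_setXT|by case=> ? ? []|].
by apply: Ck_linear; exact: tvs_linear_fst.
Qed.

(** For families closed under differentiation up to arithmetic, all members become smooth at once:
    [sin] with [cos], the inverse, and the functions [flat k]. *)
Lemma Ck_family (I : Type) (U : set R^o) (f f' : I -> R^o -> R^o) : open U ->
  (forall i x, U x -> is_derive x (1 : R^o) (f i) (f' i x)) ->
  (forall n, (forall i, Ck n U (f i)) -> (forall i, Ck n U (f' i))) ->
  forall n i, Ck n U (f i).
Proof.
move=> oU ff' IHn; elim=> [|n IH] i; last by apply: (Ck_R oU (ff' i)); exact: IHn.
move=> x Ux; apply: differentiable_continuous; apply/derivable1_diffP.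
by case: (ff' i x Ux).
Qed.

Lemma Ck_sincos n : Ck n setT (sin : R^o -> R^o) /\ Ck n setT (cos : R^o -> R^o).
Proof.
suff H b : Ck n setT (if b then sin else cos : R^o -> R^o) by split; [exact: (H true)|exact: (H false)].
move: n b; apply: (@Ck_family bool setT _ (fun b => if b then cos else (fun x => - sin x))) => //.
- exact: openT.
- by case=> x _; [exact: is_derive_sin|exact: is_derive_cos].
move=> n H [|]; first exact: (H false).
by apply: Ck_opp; [exact: openT|exact: (H true)].
Qed.

Lemma open_neq0 : open [set x : R^o | x != 0].
Proof. exact: open_neq. Qed.

Lemma Ck_inv n : Ck n [set x : R^o | x != 0] (fun x : R^o => x^-1 : R^o).
Proof.
apply: (@Ck_family unit _ (fun=> (fun x : R^o => x^-1 : R^o)) (fun=> (fun x => - (x^-1 * x^-1))) _ _ _ n tt).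
- exact: open_neq0.
- move=> _ x /= x0.
  have := @is_deriveV R id x 1 1 x0 (is_derive_id x 1).
  by rewrite /GRing.scale/= mulr1 expr2 invfM.
move=> m H _; apply: Ck_opp; first exact: open_neq0.
by apply: Ck_mul; [exact: open_neq0|exact: H tt|exact: H tt].
Qed.

Lemma Ck_atan n : Ck n setT (atan : R^o -> R^o).
Proof.
case: n => [|n].
  move=> x _; apply: differentiable_continuous; apply/derivable1_diffP.
  by have [] := is_derive1_atan x.
apply: (Ck_R (f' := fun x => (1 + x ^+ 2)^-1)) => //; first exact: openT.
apply: (@Ck_comp R n _ _ _ _ _ _ (fun x : R^o => 1 + x ^+ 2 : R^o) _ setT [set x : R^o | x != 0]) => //.
- exact: openT.
- by move=> x _ /=; rewrite gt_eqF// ltr_pwDl// sqr_ge0.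
- apply: Ck_add; [exact: openT|exact: Ck_cst|].
  by apply: Ck_mul; [exact: openT| |]; apply: Ck_linear; exact: tvs_linear_id.
exact: Ck_inv.
Qed.

(* The family x^-k exp(-1/x), extended by 0, is stable under differentiation. *)
Definition flat (k : nat) (x : R^o) : R^o := if 0 < x then x^-1 ^+ k * expR (- x^-1) else 0.

(** With [u = x^-1], the exponential series gives [u ^+ k.+1 <= (k.+1)! e^u]; division by [u e^u] is
    the bound. *)
Lemma flat_bound k (x : R) : 0 < x -> flat k x <= (k.+1)`!%:R * x.
Proof.
move=> x0; rewrite /flat x0.
have xV0 : 0 <= x^-1 by rewrite invr_ge0 ltW.
have := expR_ge1Dxn k xV0; move: (expR x^-1) (expR_gt0 x^-1) (expRN x^-1) => e e0 -> H.
have {}H : x^-1 ^+ k.+1 <= (k.+1)`!%:R * e.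
  rewrite -ler_pdivrMl ?ltr0n ?fact_gt0//; apply: le_trans H.
  by rewrite mulrC lerDr ler01.
rewrite ler_pdivrMr// mulrAC; apply: le_trans (ler_wpM2r (ltW x0) H).
by rewrite exprSr -mulrA mulVf ?mulr1// gt_eqF.
Qed.

Lemma is_derive_flat k (x : R^o) : is_derive x (1 : R^o) (flat k) (- k%:R * flat k.+1 x + flat k.+2 x).
Proof.
have [x0|x0|x0] := ltgtP x 0.
- apply: (@near_eq_is_derive _ _ _ (cst 0)).
    near=> y; rewrite /flat ltNge ltW//=; near: y; exact: lt_nbhsl.
  rewrite /flat ltNge (ltW x0)/= mulr0 addr0; exact: is_derive_cst.
- apply: (@near_eq_is_derive _ _ _ (fun y : R^o => (fun y => y^-1) y ^+ k * expR (- y^-1) : R^o)).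
    near=> y; rewrite /flat ifT//; near: y; exact: lt_nbhsr.
  have xn0 : x != 0 by rewrite gt_eqF.
  have dV := @is_deriveV R id x 1 1 xn0 (is_derive_id x 1).
  have d1 := is_deriveX k dV.
  have d2 := is_derive1_comp (f := expR) (g := fun y : R => - y^-1) (is_derive_expR (- x^-1)) (is_deriveN dV).
  have := is_deriveM d1 d2.
  rewrite (_ : _ * _ = (fun y : R^o => y^-1 ^+ k * expR (- y^-1) : R^o)); last first.
    by apply/funext => y; rewrite !fctE.
  move=> /is_derive_eq; apply.
  rewrite /flat x0 /= /GRing.scale/= /id.
  rewrite (_ : ([eta GRing.inv] ^+ k) x = x^-1 ^+ k); last by rewrite !fctE.
  have key (u e : R) m : u ^+ m * (e * - (- (u ^+ 2) * 1)) + e * (m%:R * u ^+ m.-1 * (- (u ^+ 2) * 1)) =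
      - m%:R * (u ^+ m.+1 * e) + u ^+ m.+2 * e.
    by case: m => [|m] /=; rewrite ?exprS ?expr0; ring.
  by rewrite -[x ^- 2]exprVn; exact: key.
(* At 0 the quotient is [flat k.+1 h] for [h > 0] and 0 for [h < 0]; it tends to 0 by [flat_bound]
   at [k.+1], the source of the factorial of [k.+2]. *)
- subst x; apply: diff_quot_is_derive.
  rewrite /flat ltxx mulr0 addr0.
  apply/cvgrPdist_le => e e0; apply/dnbhs0P.
  have c0 : 0 < (k.+2)`!%:R :> R by rewrite ltr0n fact_gt0.
  exists (e / (k.+2)`!%:R); first by rewrite divr_gt0.
  move=> h; rewrite ltr_pdivlMr// => he h0.
  rewrite sub0r normrN /diff_quot [h *: (1 : R^o)]mulr1 add0r ltxx subr0.
  case: ltP => hp; last by rewrite scaler0 normr0 ltW.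
  have : flat k.+1 h <= (k.+2)`!%:R * h by exact: flat_bound.
  rewrite /flat hp exprS -mulrA /GRing.scale/= => H.
  rewrite ger0_norm; last by rewrite !mulr_ge0 ?invr_ge0 ?exprn_ge0 ?invr_ge0 ?expR_ge0 ?(ltW hp).
  by rewrite (le_trans H)// mulrC -(gtr0_norm hp) ltW.
Unshelve. all: by end_near. Qed.

Lemma Ck_flat n k : Ck n setT (flat k).
Proof.
move: n k; apply: (@Ck_family nat setT _ (fun k x => - k%:R * flat k.+1 x + flat k.+2 x : R^o)).
- exact: openT.
- by move=> k x _; exact: is_derive_flat.
move=> n H k; apply: Ck_add; [exact: openT| |exact: H].
by apply: Ck_mul; [exact: openT|exact: Ck_cst|exact: H].
Qed.

Lemma flat_gt0 k x : 0 < x -> 0 < flat k x.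
Proof. by move=> x0; rewrite /flat x0 mulr_gt0 ?exprn_gt0 ?invr_gt0// expR_gt0. Qed.

Lemma flat_ge0 k x : 0 <= flat k x.
Proof. by have [/(flat_gt0 k)/ltW//|x0] := ltP 0 x; rewrite /flat ltNge x0. Qed.

Lemma flat_eq0 k x : x <= 0 -> flat k x = 0.
Proof. by move=> x0; rewrite /flat ltNge x0. Qed.

(** A smooth step, 0 up to 1/3 and 1 from 2/3 on. The margins of width 1/3 at both ends of [[0, 1]]
    let consecutive pieces of a glued map overlap where both are constant. The denominator never
    vanishes, as one of its arguments is positive at every [t]. *)
Definition lam (t : R^o) : R^o := flat 0 (t - 3^-1) / (flat 0 (t - 3^-1) + flat 0 (2 / 3 - t)).

Let den_gt0 t : 0 < flat 0 (t - 3^-1) + flat 0 (2 / 3 - t).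
Proof.
have [t3|t3] := ltP 3^-1 t; last first.
  by apply: ltr_wpDl; [exact: flat_ge0|apply: flat_gt0; lra].
by apply: ltr_wpDr; [exact: flat_ge0|apply: flat_gt0; lra].
Qed.

Lemma Ck_lam n : Ck n setT lam.
Proof.
have id_ : Ck n setT (fun t : R^o => t : R^o) by apply: Ck_linear; exact: tvs_linear_id.
have c1 : Ck n setT (fun t : R^o => flat 0 (t - 3^-1)).
  apply: (@Ck_comp R n _ _ _ _ _ _ (fun t : R^o => t - 3^-1 : R^o) (flat 0) setT setT) => //; try exact: openT.
    by apply: Ck_add => //; [exact: openT|exact: Ck_cst].
  exact: Ck_flat.
have c2 : Ck n setT (fun t : R^o => flat 0 (2 / 3 - t)).
  apply: (@Ck_comp R n _ _ _ _ _ _ (fun t : R^o => 2 / 3 - t : R^o) (flat 0) setT setT) => //; try exact: openT.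
    by apply: Ck_sub => //; [exact: openT|exact: Ck_cst].
  exact: Ck_flat.
apply: Ck_mul => //; first exact: openT.
apply: (@Ck_comp R n _ _ _ _ _ _ (fun t : R^o => flat 0 (t - 3^-1) + flat 0 (2 / 3 - t) : R^o) _ setT [set x : R^o | x != 0]) => //.
- exact: openT.
- by move=> t _ /=; rewrite gt_eqF.
- by apply: Ck_add => //; exact: openT.
exact: Ck_inv.
Qed.

Lemma lam0 t : t <= 3^-1 -> lam t = 0.
Proof. by move=> t3; rewrite /lam (@flat_eq0 0 (t - 3^-1)) ?mul0r//; lra. Qed.

Lemma lam1 t : 2 / 3 <= t -> lam t = 1.
Proof.
move=> t3; rewrite /lam (@flat_eq0 0 (2 / 3 - t)) ?addr0 ?divff ?gt_eqF//; last by lra.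
by apply: flat_gt0; lra.
Qed.

Lemma lam_ge0 t : 0 <= lam t.
Proof. by rewrite divr_ge0// ?flat_ge0 ?ltW. Qed.

Lemma lam_le1 t : lam t <= 1.
Proof. by rewrite ler_pdivrMr// mul1r lerDl flat_ge0. Qed.

End Arith.

(** * Smooth maps between manifolds *)

Section SmoothAt.
Context {R : realType}.
Implicit Types E F H : tvsType R.

Definition covers (M : topologicalType) E (A : set (chart M E)) :=
  forall x, exists2 c, A c & chart_dom c x.

Lemma covers_atlas E (M : manifold E) : covers (@atlas R E M).
Proof. by move=> x; exists (chart_at x); [exact: chart_at_atlas|exact: chart_at_dom]. Qed.

Lemma covers_vec E : covers (@vec_atlas R E).
Proof. by move=> x; exists (id_chart E). Qed.

Lemma covers_prod (M N : topologicalType) E F (A : set (chart M E)) (B : set (chart N F)) :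
  covers A -> covers B -> covers (prod_atlas A B).
Proof.
move=> cA cB [x y]; have [c Ac cx] := cA x; have [d Bd dy] := cB y.
by exists (prod_chart c d) => //; exists c, d.
Qed.

Definition smooth_at (M N : topologicalType) E F (A : set (chart M E)) (B : set (chart N F))
    (f : M -> N) (x : M) := exists2 U, U x & smooth_on_open A B U f.

Lemma smooth_at_continuous (M N : topologicalType) E F (A : set (chart M E)) (B : set (chart N F)) f x :
  smooth_at A B f x -> {for x, continuous f}.
Proof. by move=> [U Ux [_ cf _]]; exact: cf. Qed.

Lemma open_chart_pre (M : topologicalType) E (c : chart M E) (U : set M) : open U ->
  open (chart_cod c `&` chart_from c @^-1` U).
Proof.
rewrite !openE => oU y [cy Uy]; apply: filterI.
  by apply: open_nbhs_nbhs; split => //; exact: chart_cod_open.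
by apply: (chart_from_continuous cy); exact: oU.
Qed.

Lemma smooth_at_chart (M N : topologicalType) E F (A : set (chart M E)) (B : set (chart N F)) f x c d :
  smooth_at A B f x -> A c -> chart_dom c x -> B d -> chart_dom d (f x) ->
  exists O, [/\ open O, O (chart_to c x), O `<=` chart_cod c,
    forall y, O y -> chart_dom d (f (chart_from c y)) &
    forall n, Ck n O (chart_to d \o f \o chart_from c)].
Proof.
move=> [U Ux [ oU cf sf]] Ac cx Bd dfx; have [ oO kO] := sf c d Ac Bd.
exists (chart_cod c `&` chart_from c @^-1` (U `&` f @^-1` chart_dom d)); split => //.
- by split; [exact: chart_to_cod|rewrite /= chart_toK].
- by move=> y [_ [_ +]].
Qed.

Lemma smooth_on_open_loc (M N : topologicalType) E F (A : set (chart M E)) (B : set (chart N F)) f U :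
  open U -> (forall x, U x -> smooth_at A B f x) -> smooth_on_open A B U f.
Proof.
move=> oU sf; split => //; first by move=> x /sf /smooth_at_continuous.
move=> c d Ac Bd; split.
  rewrite openE => y [cy [Uy dy]].
  have [ O [ oO Oy Oc Od _]] := smooth_at_chart (sf _ Uy) Ac (chart_from_dom cy) Bd dy.
  rewrite chart_fromK// in Oy.
  have := open_nbhs_nbhs (conj oO Oy); apply: filterS2; last first.
    exact: (open_nbhs_nbhs (conj (open_chart_pre c oU) (conj cy Uy))).
  by move=> z [cz Uz] Oz; split => //; split => //; exact: Od.
move=> n; apply: Ck_pointwise => y [cy [Uy dy]].
have [ O [ oO Oy Oc Od kO]] := smooth_at_chart (sf _ Uy) Ac (chart_from_dom cy) Bd dy.
by exists O; rewrite // -(chart_fromK cy).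
Qed.

Lemma smooth_atT (M N : topologicalType) E F (A : set (chart M E)) (B : set (chart N F)) f :
  smooth A B f <-> forall x, smooth_at A B f x.
Proof.
split=> [sf x|sf]; first by exists setT.
by apply: smooth_on_open_loc => // ; exact: openT.
Qed.

Lemma smooth_on_open_sub (M N : topologicalType) E F (A : set (chart M E)) (B : set (chart N F)) f U V :
  smooth_on_open A B U f -> open V -> V `<=` U -> smooth_on_open A B V f.
Proof. by move=> sf oV VU; apply: smooth_on_open_loc => // x /VU Ux; exists U. Qed.

Lemma smooth_at_open (M N : topologicalType) E F (A : set (chart M E)) (B : set (chart N F)) f x :
  smooth_at A B f x -> \forall y \near x, smooth_at A B f y.
Proof.
move=> [U Ux sf]; have [ oU _ _] := sf.
by apply: filterS (open_nbhs_nbhs (conj oU Ux)) => y Uy; exists U.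
Qed.

Lemma near_smooth_at (M N : topologicalType) E F {hF : hausT F} (A : set (chart M E)) (B : set (chart N F)) f g x :
  (\forall y \near x, f y = g y) -> smooth_at A B f x -> smooth_at A B g x.
Proof.
rewrite /prop_near1 nbhsE /= => -[W [ oW Wx] Wfg] [U Ux sf].
have [ oU _ _] := sf.
exists (U `&` W) => //; have oUW : open (U `&` W) by exact: openI.
have [_ cf kf] : smooth_on_open A B (U `&` W) f by apply: (smooth_on_open_sub sf) => // y [].
split => //.
  move=> y UWy; rewrite /prop_for /continuous_at -(Wfg y UWy.2); apply: near_cvg (cf y UWy).
  by apply: filterS (open_nbhs_nbhs (conj oUW UWy)) => z [_ /Wfg].
move=> c d Ac Bd; have [ oO kO] := kf c d Ac Bd.
have E1 : chart_cod c `&` chart_from c @^-1` (U `&` W `&` f @^-1` chart_dom d) =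
    chart_cod c `&` chart_from c @^-1` (U `&` W `&` g @^-1` chart_dom d).
  apply/seteqP; split => y [cy [[Uy Wy] dy]]; split => //; split => //.
    by rewrite /= -Wfg.
  by rewrite /= Wfg.
rewrite E1 in oO kO; split => // n.
by apply: Ck_eq (kO n) => // y [cy [[Uy Wy] dy]] /=; rewrite Wfg.
Qed.

(** Near each point the composite is read through a chart of the middle manifold, supplied by
    [covers B]; the local [Ck] statements are then reassembled pointwise. *)
Lemma smooth_on_open_comp (M N P : topologicalType) E F H {hE : hausT E} {hF : hausT F} {hH : hausT H}
    (A : set (chart M E)) (B : set (chart N F)) (C : set (chart P H)) f g U V :
  covers B -> smooth_on_open A B U f -> smooth_on_open B C V g ->
  smooth_on_open A C (U `&` f @^-1` V) (g \o f).
Proof.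
move=> covB sf sg; have [ oU cf _] := sf; have [ oV cg _] := sg.
have oUV : open (U `&` f @^-1` V).
  rewrite openE => y [Uy Vy]; apply: filterI; first exact: open_nbhs_nbhs.
  by apply: (cf y Uy); exact: open_nbhs_nbhs.
split => //.
  by move=> y [Uy Vy]; apply: continuous_comp; [exact: cf|exact: cg].
move=> c d Ac Cd.
have loc y : (chart_cod c `&` chart_from c @^-1` ((U `&` f @^-1` V) `&` (g \o f) @^-1` chart_dom d)) y ->
    exists O, [/\ open O, O y, O `<=` (chart_cod c `&` chart_from c @^-1` ((U `&` f @^-1` V) `&` (g \o f) @^-1` chart_dom d)) &
     forall n, Ck n O (chart_to d \o (g \o f) \o chart_from c)].
  move=> [cy [[Uy Vy] dy]]; have [b Bb by_] := covB (f (chart_from c y)).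
  have [ O1 [ oO1 O1y O1c O1b kO1]] := smooth_at_chart (ex_intro2 _ _ U Uy sf) Ac (chart_from_dom cy) Bb by_.
  have [ O2 [ oO2 O2y O2b O2d kO2]] := smooth_at_chart (ex_intro2 _ _ V Vy sg) Bb by_ Cd dy.
  rewrite chart_fromK// in O1y.
  pose h := chart_to b \o f \o chart_from c.
  pose O := O1 `&` h @^-1` O2 `&` (chart_cod c `&` chart_from c @^-1` (U `&` f @^-1` V)).
  have oO : open O.
    apply: openI; last exact: open_chart_pre.
    rewrite openE => z [ Oz hz]; apply: filterI; first exact: open_nbhs_nbhs.
    by apply: (Ck_continuous (kO1 0%N) Oz); exact: open_nbhs_nbhs.
  have E1 z : O z -> chart_from b (h z) = f (chart_from c z).
    by move=> [[ O1z _] _]; rewrite /h /= chart_toK//; exact: O1b.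
  exists O; split => //.
    move=> z Oz; have [[ O1z O2z] [cz UVz]] := Oz; split => //; split => //=.
    by rewrite -E1//; exact: O2d.
  move=> n; apply: (@Ck_eq R n _ _ _ _ ((chart_to d \o g \o chart_from b) \o h)) => //.
    by move=> z /E1 /=; rewrite /h /= => ->.
  apply: (@Ck_comp R n _ _ _ _ _ _ h _ O O2) => //.
    by move=> z [[]].
  by apply: Ck_subset (kO1 n) => z [[]].
split.
  rewrite openE => y /loc [ O [ oO Oy Os _]].
  by apply: filterS Os _; exact: open_nbhs_nbhs.
by move=> n; apply: Ck_pointwise => y /loc [ O [ oO Oy Os kO]]; exists O.
Qed.

Lemma smooth_at_comp (M N P : topologicalType) E F H {hE : hausT E} {hF : hausT F} {hH : hausT H}
    (A : set (chart M E)) (B : set (chart N F)) (C : set (chart P H)) f g x :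
  covers B -> smooth_at A B f x -> smooth_at B C g (f x) -> smooth_at A C (g \o f) x.
Proof.
move=> covB [U Ux sf] [V Vx sg]; exists (U `&` f @^-1` V) => //.
exact: (smooth_on_open_comp covB sf sg).
Qed.

Lemma smooth_at_vec E F (f : E -> F) (U : set E) x (oU : open U) (Ux : U x) (kf : forall n, Ck n U f) :
  smooth_at (@vec_atlas R E) (@vec_atlas R F) f x.
Proof.
exists U => //; split => //.
  by move=> y Uy; exact: Ck_continuous (kf 0%N) Uy.
move=> c d -> ->.
have -> : U `&` f @^-1` chart_dom (id_chart F) = U by apply/seteqP; split => y //= [].
have -> : chart_cod (id_chart E) `&` chart_from (id_chart E) @^-1` U = U by apply/seteqP; split => y //= [].
by split.
Qed.

Lemma smooth_at_vecE (M : topologicalType) E F (A : set (chart M E)) (f : F -> M) x d :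
  smooth_at (@vec_atlas R F) A f x -> A d -> chart_dom d (f x) ->
  exists O, [/\ open O, O x, forall y, O y -> chart_dom d (f y) & forall n, Ck n O (chart_to d \o f)].
Proof.
move=> sf Ad dfx.
by have [ O [? ? _ ? ?]] := smooth_at_chart sf (erefl : vec_atlas (id_chart F)) I Ad dfx; exists O.
Qed.

Lemma smooth_at_vecP E F (f : E -> F) x : smooth_at (@vec_atlas R E) (@vec_atlas R F) f x ->
  exists O, [/\ open O, O x & forall n, Ck n O f].
Proof.
move=> sf; have [ O [? ? _ ?]] := smooth_at_vecE sf (erefl : vec_atlas (id_chart F)) I; by exists O.
Qed.

Lemma smooth_at_chart_from E (M : manifold E) (c : chart M E) y : atlas c -> chart_cod c y ->
  smooth_at (@vec_atlas R E) (@atlas R E M) (chart_from c) y.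
Proof.
move=> Ac cy; exists (chart_cod c) => //; split; first exact: chart_cod_open.
  by move=> z; exact: chart_from_continuous.
move=> k d -> Ad; rewrite (_ : _ `&` _ = chart_cod c `&` chart_from c @^-1` chart_dom d).
  exact: atlas_compatible.
by apply/seteqP; split => z /=; tauto.
Qed.

Lemma smooth_at_chart_to E (M : manifold E) (c : chart M E) x : atlas c -> chart_dom c x ->
  smooth_at (@atlas R E M) (@vec_atlas R E) (chart_to c) x.
Proof.
move=> Ac cy; exists (chart_dom c) => //; split; first exact: chart_dom_open.
  by move=> z; exact: chart_to_continuous.
move=> k d Ak ->; rewrite (_ : _ `&` _ = chart_cod k `&` chart_from k @^-1` chart_dom c).
  exact: atlas_compatible.
by apply/seteqP; split => z /=; tauto.
Qed.

Lemma smooth_at_id E (M : manifold E) x : smooth_at (@atlas R E M) (@atlas R E M) id x.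
Proof.
exists setT => //; split; [exact: openT|by move=> y _; exact: cvg_id|].
move=> c d Ac Ad; rewrite (_ : _ `&` _ = chart_cod c `&` chart_from c @^-1` chart_dom d).
  exact: atlas_compatible.
by apply/seteqP; split => z /=; tauto.
Qed.

Lemma smooth_at_cst (M N : topologicalType) E F {hF : hausT F} (A : set (chart M E)) (B : set (chart N F)) (p : N) x :
  smooth_at A B (fun=> p) x.
Proof.
exists setT => //; split; [exact: openT|by move=> y _; exact: cvg_cst|].
move=> c d Ac Bd; split; last by move=> n; exact: Ck_cst.
have [dp|ndp] := pselect (chart_dom d p).
  by apply: open_chart_pre; rewrite (_ : _ `&` _ = setT); [exact: openT|apply/seteqP; split].
rewrite (_ : _ `&` _ = set0); first exact: open0.
by apply/seteqP; split => y // [_ []].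
Qed.

Lemma smooth_at_pair (M N1 N2 : topologicalType) E F1 F2 {h1 : hausT F1} {h2 : hausT F2}
    (A : set (chart M E)) (B1 : set (chart N1 F1)) (B2 : set (chart N2 F2)) f1 f2 x :
  smooth_at A B1 f1 x -> smooth_at A B2 f2 x ->
  smooth_at A (prod_atlas B1 B2) (fun y => (f1 y, f2 y)) x.
Proof.
move=> [U1 Ux1 s1] [U2 Ux2 s2]; have [ oU1 _ _] := s1; have [ oU2 _ _] := s2.
have oU : open (U1 `&` U2) by exact: openI.
have [_ cf1 k1] : smooth_on_open A B1 (U1 `&` U2) f1 by apply: (smooth_on_open_sub s1) => // ? [].
have [_ cf2 k2] : smooth_on_open A B2 (U1 `&` U2) f2 by apply: (smooth_on_open_sub s2) => // ? [].
exists (U1 `&` U2) => //; split => //.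
  by move=> y Uy; apply: cvg_pairT; [exact: cf1|exact: cf2].
move=> c k Ac [d1 [d2 [Bd1 Bd2 ->]]].
have [ o1 kk1] := k1 c d1 Ac Bd1; have [ o2 kk2] := k2 c d2 Ac Bd2.
set S1 := (X in open X) in o1 kk1; set S2 := (X in open X) in o2 kk2.
rewrite (_ : _ `&` _ = S1 `&` S2); last first.
  by apply/seteqP; split => y; rewrite /S1 /S2 /=; tauto.
have oS : open (S1 `&` S2) by exact: openI.
split => // n.
apply: Ck_pair => //.
  by apply: Ck_subset (kk1 n) => ? [].
by apply: Ck_subset (kk2 n) => ? [].
Qed.

(** Distinct from [smooth_at_pair]: the atlas [vec_atlas] of a product consists of its identity
    chart, whereas [prod_atlas] contains products of charts. *)
Lemma smooth_at_pair_vec (M : topologicalType) E F1 F2 {h1 : hausT F1} {h2 : hausT F2}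
    (A : set (chart M E)) (f1 : M -> F1) (f2 : M -> F2) x :
  smooth_at A (@vec_atlas R F1) f1 x -> smooth_at A (@vec_atlas R F2) f2 x ->
  smooth_at A (@vec_atlas R (F1 * F2)%type) (fun y => (f1 y, f2 y)) x.
Proof.
move=> [U1 Ux1 s1] [U2 Ux2 s2]; have [ oU1 _ _] := s1; have [ oU2 _ _] := s2.
have oU : open (U1 `&` U2) by exact: openI.
have [_ cf1 k1] : smooth_on_open A (@vec_atlas R F1) (U1 `&` U2) f1 by apply: (smooth_on_open_sub s1) => // ? [].
have [_ cf2 k2] : smooth_on_open A (@vec_atlas R F2) (U1 `&` U2) f2 by apply: (smooth_on_open_sub s2) => // ? [].
exists (U1 `&` U2) => //; split => //.
  by move=> y Uy; apply: cvg_pairT; [exact: cf1|exact: cf2].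
move=> c k Ac ->.
have [ o1 kk1] := k1 c _ Ac erefl; have [ o2 kk2] := k2 c _ Ac erefl.
set S1 := (X in open X) in o1 kk1; set S2 := (X in open X) in o2 kk2.
rewrite (_ : _ `&` _ = S1 `&` S2); last first.
  by apply/seteqP; split => y; rewrite /S1 /S2 /=; tauto.
have oS : open (S1 `&` S2) by exact: openI.
split => // n.
apply: Ck_pair => //.
  by apply: Ck_subset (kk1 n) => ? [].
by apply: Ck_subset (kk2 n) => ? [].
Qed.

End SmoothAt.

(** * Derivatives of maps into manifolds and their chain rules *)

Section Mderiv.
Context {R : realType}.
Context (E F : tvsType R) {hE : hausT E} {hF : hausT F}.
Variables (M : manifold E) (N : manifold F).
Implicit Types V W : tvsType R.

Notation sm V M := (smooth_at (@vec_atlas R V) (@atlas R _ M)).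

Lemma near_mderiv V (f g : V -> M) z v : (\forall y \near z, f y = g y) ->
  mderiv f z v = mderiv g z v.
Proof.
move=> fg; rewrite /mderiv (nbhs_singleton fg); apply: near_ddiff.
by apply: filterS fg => y /= ->.
Qed.

Lemma mderivD V {hV : hausT V} (f : V -> M) z u v : sm V M f z ->
  mderiv f z (u + v) = mderiv f z u + mderiv f z v.
Proof.
move=> sf; have [ O [ oO Oz Od kO]] := smooth_at_vecE sf (chart_at_atlas (f z)) (chart_at_dom (f z)).
exact: (ddiffD _ _ oO (kO 1%N) Oz).
Qed.

Lemma mderivZ V {hV : hausT V} (f : V -> M) z a v : sm V M f z ->
  mderiv f z (a *: v) = a *: mderiv f z v.
Proof.
move=> sf; have [ O [ oO Oz Od kO]] := smooth_at_vecE sf (chart_at_atlas (f z)) (chart_at_dom (f z)).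
by apply: ddiffZ; have [_ df _] := kO 1%N; exact: df.
Qed.

Lemma mderiv_cst V (p : M) (z v : V) : mderiv (fun=> p) z v = 0.
Proof.
rewrite /mderiv; apply: ddiffE; apply: near_cst_cvg; near=> h.
by rewrite /diff_quot/= subrr scaler0.
Unshelve. all: by end_near. Qed.

Lemma mderiv0 V (f : V -> M) (z : V) : mderiv f z 0 = 0.
Proof. exact: ddiff0. Qed.

Lemma mderiv_comp V W {hV : hausT V} {hW : hausT W} (g : W -> V) (f : V -> M) z v :
  sm V M f (g z) -> ddifferentiable g z v ->
  mderiv (f \o g) z v = mderiv f (g z) (ddiff g z v).
Proof.
move=> sf dg.
have [ O [ oO Oz Od kO]] := smooth_at_vecE sf (chart_at_atlas (f (g z))) (chart_at_dom (f (g z))).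
exact: (ddiff_comp dg oO (kO 1%N) Oz).
Qed.

Lemma near_chart_factor V (f : V -> M) z (c : chart M E) : {for z, continuous f} ->
  chart_dom c (f z) -> \forall y \near z, chart_from c (chart_to c (f y)) = f y.
Proof.
move=> cf cfz.
have : \forall y \near z, chart_dom c (f y).
  by apply: cf; apply: open_nbhs_nbhs; split => //; exact: chart_dom_open.
by apply: filterS => y ?; rewrite chart_toK.
Qed.

Lemma ddifferentiable_chart V (f : V -> M) z v (c : chart M E) : sm V M f z -> atlas c ->
  chart_dom c (f z) -> ddifferentiable (chart_to c \o f) z v.
Proof.
move=> sf Ac cfz; have [ O [ oO Oz Od kO]] := smooth_at_vecE sf Ac cfz.
by have [_ df _] := kO 1%N; exact: df.
Qed.

(** Change of chart for tangent vectors. Preferred charts may jump from point to point, so local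
    computations fix one chart [c] and convert at the end. *)
Lemma mderiv_chart V {hV : hausT V} (f : V -> M) z v (c : chart M E) : sm V M f z -> atlas c ->
  chart_dom c (f z) ->
  mderiv f z v = mderiv (chart_from c) (chart_to c (f z)) (ddiff (chart_to c \o f) z v).
Proof.
move=> sf Ac cfz.
rewrite -(@mderiv_comp _ _ _ _ (chart_to c \o f) (chart_from c)).
- apply: near_mderiv; have := near_chart_factor (smooth_at_continuous sf) cfz.
  by apply: filterS => y /= ->.
- by apply: smooth_at_chart_from => //; exact: chart_to_cod.
- exact: ddifferentiable_chart.
Qed.

Lemma tangent_map_comp V {hV : hausT V} (f : V -> M) (h : M -> N) z v :
  sm V M f z -> smooth_at (@atlas R E M) (@atlas R F N) h (f z) ->
  mderiv (h \o f) z v = tangent_map h (f z) (mderiv f z v).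
Proof.
move=> sf sh; rewrite /tangent_map.
set c := chart_at (f z); have cz : chart_dom c (f z) := chart_at_dom _.
have Ac : atlas c := chart_at_atlas _.
have sc : smooth_at (@vec_atlas R E) (@atlas R F N) (h \o chart_from c) (chart_to c (f z)).
  apply: (@smooth_at_comp _ _ _ _ _ _ _ _ _ _ _ (@atlas R E M)); first exact: covers_atlas.
    by apply: smooth_at_chart_from => //; exact: chart_to_cod.
  by rewrite chart_toK.
have H : \forall y \near z, (h \o f) y = ((h \o chart_from c) \o (chart_to c \o f)) y.
  have := near_chart_factor (smooth_at_continuous sf) cz.
  by apply: filterS => y /= ->.
rewrite /mderiv (near_ddiff (g := chart_to (chart_at (h (f z))) \o ((h \o chart_from c) \o (chart_to c \o f)))); last first.
  by apply: filterS H => y /= ->.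
have [ O [ oO Oz Od kO]] := smooth_at_vecE sc (chart_at_atlas _) (chart_at_dom _).
rewrite /= chart_toK// in kO *.
exact: (ddiff_comp (ddifferentiable_chart v sf Ac cz) oO (kO 1%N) Oz).
Qed.

Lemma differential_comp V {hV : hausT V} (f : V -> M) (m : M -> R^o) z v :
  sm V M f z -> smooth_at (@atlas R E M) (@vec_atlas R R^o) m (f z) ->
  ddifferentiable (m \o f) z v /\ ddiff (m \o f) z v = differential m (f z) (mderiv f z v).
Proof.
move=> sf sm_.
set c := chart_at (f z); have cz : chart_dom c (f z) := chart_at_dom _.
have Ac : atlas c := chart_at_atlas _.
have sc : smooth_at (@vec_atlas R E) (@vec_atlas R R^o) (m \o chart_from c) (chart_to c (f z)).
  apply: (@smooth_at_comp _ _ _ _ _ _ _ _ _ _ _ (@atlas R E M)); first exact: covers_atlas.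
    by apply: smooth_at_chart_from => //; exact: chart_to_cod.
  by rewrite chart_toK.
have H : \forall y \near z, ((m \o chart_from c) \o (chart_to c \o f)) y = (m \o f) y.
  have := near_chart_factor (smooth_at_continuous sf) cz.
  by apply: filterS => y /= ->.
have [ O [ oO Oz kO]] := smooth_at_vecP sc.
have dc := ddifferentiable_chart v sf Ac cz.
split.
  apply: near_ddifferentiable H _; eexists; exact: (ddiff_comp_cvg dc oO (kO 1%N) Oz).
by rewrite -(near_ddiff v H) (ddiff_comp dc oO (kO 1%N) Oz).
Qed.

End Mderiv.

(** * Integrals and pull-backs *)

Section Integrals.
Context {R : realType}.
Notation mu := (@lebesgue_measure R).
Notation R2 := (measurableTypeR R * measurableTypeR R)%type.

Definition rint (a b : R) (f : R -> R) : R := (\int[mu]_(x in `[a, b]) f x)%R.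

Lemma int_integrable (f : R -> R) a b : continuous f -> mu.-integrable `[a, b] (EFin \o f).
Proof.
move=> cf; apply: continuous_compact_integrable; first exact: segment_compact.
exact: continuous_subspaceT.
Qed.

Lemma eq_int (f g : R -> R) a b : (forall x, a <= x <= b -> f x = g x) -> rint a b f = rint a b g.
Proof. by move=> fg; apply: eq_Rintegral => x; rewrite inE/= in_itv/=; exact: fg. Qed.

Lemma intD (f g : R -> R) a b : continuous f -> continuous g ->
  rint a b (fun x => f x + g x) = rint a b f + rint a b g.
Proof. by move=> cf cg; apply: RintegralD => //; exact: int_integrable. Qed.

Lemma intB (f g : R -> R) a b : continuous f -> continuous g ->
  rint a b (fun x => f x - g x) = rint a b f - rint a b g.
Proof. by move=> cf cg; apply: RintegralB => //; exact: int_integrable. Qed.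

Lemma intZ (f : R -> R) a b k : continuous f ->
  rint a b (fun x => k * f x) = k * rint a b f.
Proof. by move=> cf; apply: RintegralZl => //; exact: int_integrable. Qed.

Lemma intN (f : R -> R) a b : continuous f -> rint a b (fun x => - f x) = - rint a b f.
Proof.
move=> cf; rewrite -mulN1r -intZ//; apply: eq_int => x _; by rewrite mulN1r.
Qed.

Lemma rint0 a b : rint a b (fun=> 0) = 0.
Proof.
transitivity (rint a b (fun x => 0 * (fun=> 0) x)); first by apply: eq_int => x _; rewrite mul0r.
by rewrite intZ ?mul0r// => x; exact: cvg_cst.
Qed.

Lemma int_aa (f : R -> R) a : rint a a f = 0.
Proof. by rewrite /rint set_itv1 Rintegral_set1. Qed.

Lemma int_FTC (f F : R -> R) a b : a <= b -> continuous f ->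
  (forall x : R, a <= x <= b -> is_derive x (1 : R) F (f x)) -> rint a b f = F b - F a.
Proof.
rewrite le_eqVlt => /orP[/eqP <- _ _|ab cf dF]; first by rewrite int_aa subrr.
have cF x : a <= x <= b -> {for x, continuous F}.
  move=> /dF[dFx _]; apply: differentiable_continuous; exact/derivable1_diffP.
rewrite /rint /Rintegral (@continuous_FTC2 R f F a b) //.
- exact: continuous_subspaceT.
- split.
  + move=> x; rewrite in_itv/= => /andP[ax xb].
    by have [|//] := dF x; rewrite !ltW.
  + by apply: cvg_at_right_filter; apply: cF; rewrite lexx ltW.
  + by apply: cvg_at_left_filter; apply: cF; rewrite lexx ltW.
- move=> x; rewrite in_itv/= => /andP[ax xb]; rewrite derive1E.
  have axb : a <= x <= b by rewrite !ltW.
  by have dFx := dF x axb; rewrite derive_val.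
Qed.

Lemma antiderivative (f : R -> R) a : continuous f ->
  forall x : R, a < x -> is_derive x (1 : R) (fun y => rint a y f) (f x).
Proof.
move=> cf x ax.
have [|dF F'] := @continuous_FTC1_closed R f a x (x + 1) _ (int_integrable a (x + 1) cf) ax (cf x).
  by rewrite ltrDl.
by apply: DeriveDef; [exact: dF|rewrite -derive1E F'].
Qed.

Lemma is_derive_continuous (F : R -> R) (x l : R) : is_derive x (1 : R) F l -> {for x, continuous F}.
Proof. by move=> [dF _]; apply: differentiable_continuous; exact/derivable1_diffP. Qed.

Lemma int_cat (f : R -> R) a b c : a <= b -> b <= c -> continuous f ->
  rint a c f = rint a b f + rint b c f.
Proof.
(* Based at [a - 1], the integral has a two-sided derivative at [a] as well. *)
move=> ab bc cf; have a1 : a - 1 < a by rewrite ltrBlDr ltrDl.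
have A x : a <= x -> is_derive x (1 : R) (fun y => rint (a - 1) y f) (f x).
  by move=> ax; apply: antiderivative => //; exact: lt_le_trans ax.
rewrite (int_FTC (le_trans ab bc) cf (fun x h => A x (andP h).1)).
rewrite (int_FTC ab cf (fun x h => A x (andP h).1)).
rewrite (int_FTC bc cf (fun x h => A x (le_trans ab (andP h).1))); lra.
Qed.

(** The map [a] may overshoot its end values or turn back: both sides are differences of one
    antiderivative of [f]. *)
Lemma int_subst (f a a' : R -> R) u v : u <= v -> continuous f -> continuous a' ->
  (forall x : R, is_derive x (1 : R) a (a' x)) ->
  rint u v (fun x => f (a x) * a' x) =
  if a u <= a v then rint (a u) (a v) f else - rint (a v) (a u) f.
Proof.
move=> uv cf ca' da.
have ca : continuous a by move=> x; exact: is_derive_continuous (da x).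
have [c cuv cmin] := EVT_min uv (continuous_subspaceT ca).
(* The base point lies below the minimum of [a] on [[u, v]], so the antiderivative is differentiable
   at every value taken. *)
pose A := a c - 1.
have Aa x : u <= x <= v -> A < a x.
  by move=> xuv; apply: (@lt_le_trans _ _ (a c)); [rewrite ltrBlDr ltrDl|apply: cmin; rewrite in_itv].
have D x : A < x -> is_derive x (1 : R) (fun y => rint A y f) (f x) by exact: antiderivative.
have auA : A < a u by apply: Aa; rewrite lexx.
have avA : A < a v by apply: Aa; rewrite lexx uv.
transitivity (rint A (a v) f - rint A (a u) f).
  have cfa : continuous (fun x => f (a x) * a' x).
    move=> x; apply: (@continuousM _ _ (f \o a) a'); last exact: ca'.
    by apply: continuous_comp; [exact: ca|exact: cf].
  have dfa x : u <= x <= v -> is_derive x (1 : R) (fun x => rint A (a x) f) (f (a x) * a' x).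
    by move=> /Aa ax; exact: (@is_derive1_comp _ (fun y => rint A y f) a x _ _ (D _ ax) (da x)).
  exact: (int_FTC uv cfa dfa).
case: ifPn => [auv|]; last rewrite -ltNge => /ltW auv.
  by rewrite (int_FTC auv cf (fun x h => D x (lt_le_trans auA (andP h).1))).
by rewrite (int_FTC auv cf (fun x h => D x (lt_le_trans avA (andP h).1))) opprB.
Qed.

Lemma int_ge (f : R -> R) (C : R) a b : a <= b -> continuous f ->
  (forall x, a <= x <= b -> C <= f x) -> C * (b - a) <= rint a b f.
Proof.
move=> ab cf fC.
have -> : C * (b - a) = rint a b (fun=> C).
  rewrite mulrBr; apply/esym/(@int_FTC _ (fun x => C * x)) => //; first by move=> x; exact: cvg_cst.
  move=> x _; have := is_deriveZ C (is_derive_id x (1 : R)).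
  by rewrite /GRing.scale/= mulr1.
apply: le_Rintegral => //.
- by apply: int_integrable => x; exact: cvg_cst.
- exact: int_integrable.
Qed.

Lemma int_norm (f : R -> R) (C : R) a b : a <= b -> continuous f ->
  (forall x, a <= x <= b -> `|f x| <= C) -> `|rint a b f| <= C * (b - a).
Proof.
move=> ab cf fC; rewrite ler_norml; apply/andP; split.
  rewrite -mulNr; apply: int_ge => // x /fC; rewrite ler_norml => /andP[].
  by [].
rewrite -lerN2 -intN// -mulNr; apply: int_ge => //.
  by move=> x; apply: continuousN; exact: cf.
by move=> x /fC; rewrite ler_norml lerN2 => /andP[].
Qed.

Implicit Types F : R * R -> R.

Lemma section_r F t : continuous F -> continuous (fun r => F (r, t)).
Proof.
move=> cF r; apply: (@cvg_comp_at _ _ _ _ (fun r => (r, t)) F (r, t)); last exact: cF.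
by apply: cvg_pairT; [exact: cvg_id|exact: cvg_cst].
Qed.

Lemma section_t F r : continuous F -> continuous (fun t => F (r, t)).
Proof.
move=> cF t; apply: (@cvg_comp_at _ _ _ _ (fun t => (r, t)) F (r, t)); last exact: cF.
by apply: cvg_pairT; [exact: cvg_cst|exact: cvg_id].
Qed.

(** Tube lemma: compactness of [[a, b]] makes the continuity in [t] uniform in [r]. *)
Lemma near_segment F a b t0 e : continuous F -> 0 < e ->
  \forall t \near t0, forall r, a <= r <= b -> `|F (r, t) - F (r, t0)| < e.
Proof.
move=> cF e0.
have K := @segment_compact R a b; rewrite compact_near_coveringP in K.
have /(_ _) H := K _ (nbhs t0) (fun t r => `|F (r, t) - F (r, t0)| < e) _.
suff H' : forall x, `[a, b]%classic x -> \forall x' \near x & i \near nbhs t0, `|F (x', i) - F (x', t0)| < e.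
  by apply: filterS (H H') => t Ht r rab; apply: Ht; rewrite /= in_itv.
move=> r _.
  have e20 : 0 < e / 2 by rewrite divr_gt0.
  have [[A B] /= [Ar Bt] AB] : nbhs (r, t0) [set z | `|F (r, t0) - F z| < e / 2].
    by have /cvgrPdist_lt := cF (r, t0); apply.
  exists (A, B) => // -[r' t] /= [Ar' Bt'].
  have h1 := AB (r', t) (conj Ar' Bt').
  have h2 := AB (r', t0) (conj Ar' (nbhs_singleton Bt)).
  rewrite /= in h1 h2; have -> : F (r', t) - F (r', t0) = (F (r, t0) - F (r', t0)) - (F (r, t0) - F (r', t)) by lra.
  by rewrite (le_lt_trans (ler_normB _ _))// (splitr e) ltrD.
Qed.

Lemma int_param_continuous F a b : a <= b -> continuous F ->
  continuous (fun t => rint a b (fun r => F (r, t))).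
Proof.
move=> ab cF t0; apply/cvgrPdist_le => e e0.
(* The added 1 keeps the divisor positive when [a = b]. *)
have e1 : 0 < e / (b - a + 1) by rewrite divr_gt0// ltr_wpDl// subr_ge0.
apply: filterS (near_segment a b t0 cF e1) => t Ht.
rewrite distrC -intB; [|exact: section_r|exact: section_r].
apply: le_trans (@int_norm _ (e / (b - a + 1)) _ _ ab _ _) _.
- by move=> x; apply: continuousB; exact: section_r.
- by move=> x /Ht /ltW.
- rewrite mulrAC ler_pdivrMr; last by rewrite ltr_wpDl// subr_ge0.
  by rewrite ler_pM2l// lerDl.
Qed.

(** Measurability refers to the product sigma-algebra: an open set is the countable union of the
    rational squares that it contains. *)
Lemma open_measurable_prod (A : set (R * R)) : open A -> measurable (A : set R2).
Proof.
move=> oA.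
pose B (q : rat * rat * rat) : set (R * R) :=
  if `[< ball (ratr q.1.1 : R) (ratr q.2) `*` ball (ratr q.1.2 : R) (ratr q.2) `<=` A >]
  then ball (ratr q.1.1 : R) (ratr q.2) `*` ball (ratr q.1.2 : R) (ratr q.2) else set0.
have -> : A = \bigcup_q B q.
  apply/seteqP; split => [[x y] Axy|z [q _]]; last by rewrite /B; case: asboolP => // H /H.
  have := open_nbhs_nbhs (conj oA Axy) => -[[A1 A2] /= [/nbhs_ballP[e1 /= e10 H1] /nbhs_ballP[e2 /= e20 H2]] H].
  have m0 : 0 < Num.min e1 e2 / 2 by rewrite divr_gt0// lt_min e10 e20.
  have [e] := rat_in_itvoo m0; rewrite in_itv/= => /andP[e0 em].
  have [q1] : exists q, ratr q \in `]x - ratr e, x + ratr e[ by apply: rat_in_itvoo; lra.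
  rewrite in_itv/= => /andP[q1l q1r].
  have [q2] : exists q, ratr q \in `]y - ratr e, y + ratr e[ by apply: rat_in_itvoo; lra.
  rewrite in_itv/= => /andP[q2l q2r].
  have [me1 me2] : Num.min e1 e2 <= e1 /\ Num.min e1 e2 <= e2 by rewrite !ge_min !lexx orbT.
  exists ((q1, q2), e) => //; rewrite /B; case: asboolP => /= [_|[]].
    by split; rewrite /ball/= ltr_norml; apply/andP; split; lra.
  move=> [u v] [/=]; rewrite /ball/= !ltr_norml => /andP[? ?] /andP[? ?]; apply: H; split => /=.
    by apply: H1; rewrite /ball/= ltr_norml; apply/andP; split; lra.
  by apply: H2; rewrite /ball/= ltr_norml; apply/andP; split; lra.
apply: countable_bigcupT_measurable; first exact: countableP.
move=> q; rewrite /B; case: asboolP => // _.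
by apply: measurableX; apply: open_measurable; exact: ball_open.
Qed.

Lemma open_continuous_measurable_prod (D : set (R * R)) F : open D ->
  (forall z, D z -> {for z, continuous F}) -> measurable_fun (D : set R2) (F : R2 -> R).
Proof.
move=> oD cF mD; apply: (measurability _ (RGenOpens.measurableE R)) => // _ [_ [a [b ->] <-]].
apply: open_measurable_prod; rewrite openE => z [Dz Fz]; apply: filterI.
  exact: open_nbhs_nbhs.
by apply: (cF z Dz); apply: open_nbhs_nbhs; split => //; exact: interval_open.
Qed.

Lemma rect_bounded F a b c d : continuous F ->
  exists C, forall r t, a <= r <= b -> c <= t <= d -> `|F (r, t)| <= C.
Proof.
move=> cF; have K : compact (`[a, b] `*` `[c, d] : set (R * R)) by apply: compact_setX; exact: segment_compact.
have /compact_bounded [M [_ HM]] : compact (F @` (`[a, b] `*` `[c, d])).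
  apply: continuous_compact => //; exact: continuous_subspaceT.
exists (M + 1) => r t rab tcd; apply: (HM (M + 1)); first by rewrite ltrDl.
by exists (r, t) => //; split => /=; rewrite in_itv.
Qed.

Lemma rect_integrable F a b c d : continuous F ->
  (mu \x mu)%E.-integrable (`[a, b] `*` `[c, d] : set R2) (EFin \o F).
Proof.
move=> cF; apply: measurable_bounded_integrable.
- by apply: measurableX.
- apply: (@le_lt_trans _ _ (mu `[a, b]%classic * mu `[c, d]%classic)%E).
    by rewrite le_eqVlt; apply/orP; left; apply/eqP; exact: product_measure1E.
  rewrite !lebesgue_measure_itv/=; case: ifP => _; case: ifP => _;
    by rewrite ?mule0 ?mul0e -?EFinD -?EFinM ?ltry.
- apply: (measurable_funS measurableT) => //.
  by apply: open_continuous_measurable_prod; [exact: openT|move=> z _; exact: cF].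
- have [C HC] := rect_bounded a b c d cF.
  exists C; split; first by rewrite num_real.
  move=> y Cy [r t] [/=]; rewrite !in_itv/= => rab tcd.
  by apply: le_trans (HC _ _ rab tcd) (ltW Cy).
Qed.

Let restrict_rect F a b c d (r t : R) :
  ((EFin \o F) \_ (`[a, b] `*` `[c, d])) (r, t) =
  ((fun r => ((fun t => (F (r, t))%:E) \_ `[c, d]) t) \_ `[a, b]) r.
Proof.
rewrite /patch /= in_setX/=; case: ifPn => [/andP[-> ->]//|].
by rewrite negb_and => /orP[/negbTE->//|/negbTE->]; case: ifP.
Qed.

(** The integrand is extended by 0 to the plane, where Fubini applies; [restrict_rect] splits this
    extension into one restriction per variable. *)
Lemma rect_int_rt F a b c d : continuous F ->
  (\int[(mu \x mu)%E]_(z in (`[a, b] `*` `[c, d] : set (R * R))) F z)%R =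
  rint a b (fun r => rint c d (fun t => F (r, t))).
Proof.
move=> cF; have mD : measurable (`[a, b] `*` `[c, d] : set R2) by exact: measurableX.
have := (@integrable_mkcond _ R2 R (mu \x mu)%E _ (EFin \o F) mD).1 (rect_integrable a b c d cF).
set G := _ \_ _ => iG.
rewrite /rint /Rintegral integral_mkcond -integral12_prod_meas1//; congr fine.
rewrite [RHS]integral_mkcond; apply: eq_integral => r _.
rewrite /fubini_F /G; under eq_integral do rewrite restrict_rect.
have [rab|rab] := boolP (r \in `[a, b]%classic); last first.
  by rewrite [in RHS]/patch (negbTE rab) integral0_eq// => y _; rewrite /patch (negbTE rab).
transitivity (\int[mu]_x ((fun t => (F (r, t))%:E) \_ `[c, d]) x)%E.
  by apply: eq_integral => y _; rewrite /patch rab.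
rewrite -integral_mkcond [in RHS]/patch rab fineK//.
apply: (@integrable_fin_num _ _ R mu `[c, d]%classic _ (fun x => (F (r, x))%:E)); first exact: measurable_itv.
exact: (int_integrable c d (section_t (r := r) cF)).
Qed.

Lemma rect_int_tr F a b c d : continuous F ->
  (\int[(mu \x mu)%E]_(z in (`[a, b] `*` `[c, d] : set (R * R))) F z)%R =
  rint c d (fun t => rint a b (fun r => F (r, t))).
Proof.
move=> cF; have mD : measurable (`[a, b] `*` `[c, d] : set R2) by exact: measurableX.
have := (@integrable_mkcond _ R2 R (mu \x mu)%E _ (EFin \o F) mD).1 (rect_integrable a b c d cF).
set G := _ \_ _ => iG.
rewrite /rint /Rintegral integral_mkcond -integral21_prod_meas1//; congr fine.
rewrite [RHS]integral_mkcond; apply: eq_integral => t _.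
rewrite /fubini_G /G.
have E r : ((EFin \o F) \_ (`[a, b] `*` `[c, d])) (r, t) =
  ((fun t => ((fun r => (F (r, t))%:E) \_ `[a, b]) r) \_ `[c, d]) t.
  by rewrite /patch /= in_setX/=; case: (r \in _); case: (t \in _).
under eq_integral do rewrite E.
have [tcd|tcd] := boolP (t \in `[c, d]%classic); last first.
  by rewrite [in RHS]/patch (negbTE tcd) integral0_eq// => y _; rewrite /patch (negbTE tcd).
transitivity (\int[mu]_x ((fun r => (F (r, t))%:E) \_ `[a, b]) x)%E.
  by apply: eq_integral => y _; rewrite /patch tcd.
rewrite -integral_mkcond [in RHS]/patch tcd fineK//.
apply: (@integrable_fin_num _ _ R mu `[a, b]%classic _ (fun x => (F (x, t))%:E)); first exact: measurable_itv.
exact: (int_integrable a b (section_r (t := t) cF)).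
Qed.

Lemma int_fubini F a b c d : continuous F ->
  rint c d (fun t => rint a b (fun r => F (r, t))) = rint a b (fun r => rint c d (fun t => F (r, t))).
Proof. by move=> cF; rewrite -rect_int_tr// rect_int_rt. Qed.

End Integrals.

(** * C^n maps defined on a whole vector space *)

Section GlobalCk.
Context {R : realType}.
Implicit Types E F : tvsType R.

Lemma CT_id n E {hE : hausT E} : Ck n setT (fun x : E => x).
Proof. by apply: Ck_linear; exact: tvs_linear_id. Qed.

Lemma CT_fst n E F {hE : hausT E} : Ck n setT (fun x : E * F => x.1).
Proof. by apply: Ck_linear; exact: tvs_linear_fst. Qed.

Lemma CT_snd n E F {hF : hausT F} : Ck n setT (fun x : E * F => x.2).
Proof. by apply: Ck_linear; exact: tvs_linear_snd. Qed.

Lemma CT_cst n E F {hF : hausT F} (a : F) : Ck n setT (fun _ : E => a).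
Proof. exact: Ck_cst. Qed.

Lemma CT_comp n E F {hE : hausT E} {hF : hausT F} (h : R^o -> F) (f : E -> R^o) :
  Ck n setT h -> Ck n setT f -> Ck n setT (fun x => h (f x)).
Proof.
by move=> hn fn; apply: (@Ck_comp R n _ _ _ _ _ _ f h setT setT) => //; exact: openT.
Qed.

Lemma CT_pair n E F1 F2 {h1 : hausT F1} {h2 : hausT F2} (f : E -> F1) (g : E -> F2) :
  Ck n setT f -> Ck n setT g -> Ck n setT (fun x => (f x, g x)).
Proof. by move=> ? ?; apply: Ck_pair => //; exact: openT. Qed.

Lemma CT_add n E F {hE : hausT E} {hF : hausT F} (f g : E -> F) :
  Ck n setT f -> Ck n setT g -> Ck n setT (fun x => f x + g x).
Proof. by move=> ? ?; apply: Ck_add => //; exact: openT. Qed.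

Lemma CT_sub n E F {hE : hausT E} {hF : hausT F} (f g : E -> F) :
  Ck n setT f -> Ck n setT g -> Ck n setT (fun x => f x - g x).
Proof. by move=> ? ?; apply: Ck_sub => //; exact: openT. Qed.

Lemma CT_opp n E F {hE : hausT E} {hF : hausT F} (f : E -> F) :
  Ck n setT f -> Ck n setT (fun x => - f x).
Proof. by move=> ?; apply: Ck_opp => //; exact: openT. Qed.

Lemma CT_mul n E {hE : hausT E} (f g : E -> R^o) :
  Ck n setT f -> Ck n setT g -> Ck n setT ((fun x => f x * g x) : E -> R^o).
Proof. by move=> ? ?; apply: Ck_mul => //; exact: openT. Qed.

Lemma CT_scale n E F {hE : hausT E} {hF : hausT F} (f : E -> R^o) (g : E -> F) :
  Ck n setT f -> Ck n setT g -> Ck n setT (fun x => f x *: g x).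
Proof. by move=> ? ?; apply: Ck_scale => //; exact: openT. Qed.

Lemma CT_lam n E {hE : hausT E} (f : E -> R^o) :
  Ck n setT f -> Ck n setT ((fun x => lam (f x)) : E -> R^o).
Proof. by move=> fn; apply: CT_comp => //; exact: Ck_lam. Qed.

Lemma CT_sin n E {hE : hausT E} (f : E -> R^o) :
  Ck n setT f -> Ck n setT ((fun x => sin (f x)) : E -> R^o).
Proof. by move=> fn; apply: (@CT_comp n _ _ _ _ sin) => //; exact: (Ck_sincos n).1. Qed.

Lemma CT_cos n E {hE : hausT E} (f : E -> R^o) :
  Ck n setT f -> Ck n setT ((fun x => cos (f x)) : E -> R^o).
Proof. by move=> fn; apply: (@CT_comp n _ _ _ _ cos) => //; exact: (Ck_sincos n).2. Qed.

Lemma sm_of_CT E F (f : E -> F) : (forall n, Ck n setT f) ->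
  forall x, smooth_at (@vec_atlas R E) (@vec_atlas R F) f x.
Proof. by move=> fn x; apply: (@smooth_at_vec _ _ _ _ setT) => //; exact: openT. Qed.

Lemma CT_derive (a : R^o -> R^o) : (forall n, Ck n setT a) ->
  (forall x : R^o, is_derive x (1 : R^o) a (ddiff a x 1)) /\
  continuous (fun x : R^o => ddiff a x 1 : R^o).
Proof.
move=> an; split => [x|x].
  by apply: diff_quot_is_derive; apply: ddiffP; have [_ da _] := an 1%N; exact: da.
have [_ _ cd] := an 1%N.
apply: (@cvg_comp_at _ _ _ _ (fun x : R^o => (x, 1 : R^o)) (fun p => ddiff a p.1 p.2) (x, 1 : R^o)).
  by apply: cvg_pairT; [exact: cvg_id|exact: cvg_cst].
exact: cd.
Qed.

Lemma Ck_ddiff_dir E F {hE : hausT E} {hF : hausT F} (U : set E) (f : E -> F) (v : E) : open U ->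
  (forall n, Ck n U f) -> forall n, Ck n U (fun x => ddiff f x v).
Proof.
move=> oU fn n; have [_ _ df] := fn n.+1.
apply: (@Ck_comp R n _ _ _ _ _ _ (fun x => (x, v)) (fun p => ddiff f p.1 p.2) U (U `*` setT)) => //.
  exact: open_setXT.
apply: Ck_pair => //; last exact: Ck_cst.
by apply: Ck_linear; exact: tvs_linear_id.
Qed.

End GlobalCk.

Ltac ckt := repeat first
  [ apply: CT_id | apply: CT_fst | apply: CT_snd | apply: CT_cst | apply: CT_pair
  | apply: CT_lam | apply: CT_sin | apply: CT_cos
  | apply: CT_sub | apply: CT_opp | apply: CT_add | apply: CT_mul | apply: CT_scale ].

Section IntOpen.
Context {R : realType}.
Notation mu := (@lebesgue_measure R).

(** For parametrisations that agree only away from the ends: at the poles of a sphere, or at the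
    seams between two pieces of a tube. *)
Lemma eq_int_oo (f g : R -> R) a b : continuous f -> continuous g ->
  (forall x, a < x < b -> f x = g x) -> rint a b f = rint a b g.
Proof.
move=> cf cg fg; have [ab|ba|->] := ltgtP a b; last by rewrite !int_aa.
  have E (h : R -> R) : continuous h -> rint a b h = (\int[mu]_(x in `]a, b[) h x)%R.
    move=> ch; have ih := int_integrable a b ch.
    rewrite Rintegral_itv_bndo_bndc ?Rintegral_itv_obnd_cbnd//;
      apply: integrableS ih => // x /=; rewrite !in_itv/= => /andP[ax xb];
      apply/andP; split; lra.
  by rewrite !E//; apply: eq_Rintegral => x; rewrite inE/= in_itv/=; exact: fg.
by apply: eq_int => x /andP[ax xb]; move: (le_lt_trans (le_trans ax xb) ba); rewrite ltxx.
Qed.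
End IntOpen.

(** * Pull-backs of the form, tubes and their areas *)

Section Pullback.
Context {R : realType}.
Context (F : tvsType R) {hF : hausT F} (X : manifold F) (om : form2 X).
Hypothesis som : smooth_form2 om.
Notation sm f := (forall z, smooth_at (@vec_atlas R (R^o * R^o)%type) (@atlas R F X) f z).

Lemma omDr x u v w : om x u (v + w) = om x u v + om x u w.
Proof. by case: som => /(_ x u) lo _ _; have := lo 1 v w; rewrite !scale1r. Qed.
Lemma om0r x u : om x u 0 = 0.
Proof. by apply: (addrI (om x u 0)); rewrite -omDr !addr0. Qed.
Lemma omZr x u a v : om x u (a *: v) = a * om x u v.
Proof. by case: som => /(_ x u) lo _ _; have := lo a v 0; rewrite !addr0 om0r addr0. Qed.
Lemma omC x u v : om x u v = - om x v u.
Proof. by case: som. Qed.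
Lemma omDl x u v w : om x (v + w) u = om x v u + om x w u.
Proof. by rewrite omC omDr opprD -!omC. Qed.
Lemma omZl x u a v : om x (a *: v) u = a * om x v u.
Proof. by rewrite omC omZr -mulrN -omC. Qed.
Lemma om0l x u : om x 0 u = 0.
Proof. by rewrite omC om0r oppr0. Qed.
Lemma omxx x u : om x u u = 0.
Proof. by have := omC x u u => /eqP; rewrite -addr_eq0 -mulr2n mulrn_eq0/= => /eqP. Qed.

Lemma pullback2_in_chart (f : R^o * R^o -> X) z c :
  smooth_at (@vec_atlas R (R^o * R^o)%type) (@atlas R F X) f z -> atlas c -> chart_dom c (f z) ->
  pullback2 om f z = form2_in_chart om c
    (chart_to c (f z), ddiff (chart_to c \o f) z (1, 0), ddiff (chart_to c \o f) z (0, 1)).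
Proof.
move=> sf Ac cz; rewrite /pullback2 /form2_in_chart/= chart_toK//.
by rewrite -!(mderiv_chart _ sf Ac cz).
Qed.

(** The preferred chart used by [pullback2] at [w] varies with [w]; one chart fixed around [f z]
    shows the pull-back to be a smooth expression in [f] and its derivatives. *)
Lemma pullback2_smooth (f : R^o * R^o -> X) z :
  smooth_at (@vec_atlas R (R^o * R^o)%type) (@atlas R F X) f z ->
  smooth_at (@vec_atlas R (R^o * R^o)%type) (@vec_atlas R R^o) (pullback2 om f) z.
Proof.
move=> sf; set c := chart_at (f z); have Ac : atlas c := chart_at_atlas _.
have [ O [ oO Oz Od kO]] := smooth_at_vecE sf Ac (chart_at_dom _).
pose g w := (chart_to c (f w), ddiff (chart_to c \o f) w (1, 0), ddiff (chart_to c \o f) w (0, 1)).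
have E : \forall w \near z, (form2_in_chart om c \o g) w = pullback2 om f w.
  apply: filterS2 (smooth_at_open sf) (open_nbhs_nbhs (conj oO Oz)) => w sfw /Od dw.
  by rewrite (pullback2_in_chart sfw Ac dw).
apply: near_smooth_at E _.
have [_ _ /(_ c Ac)[oc kc]] := som.
apply: (@smooth_at_vec _ _ _ _ O) => // n.
apply: (Ck_comp oO oc) => //.
  move=> w Ow; do 2?split => //=; exact: chart_to_cod (Od w Ow).
by apply: Ck_pair => //; [apply: Ck_pair => //|]; apply: Ck_ddiff_dir.
Qed.

Lemma pullback2_continuous f : sm f -> continuous (pullback2 om f : R * R -> R).
Proof. by move=> sf z; exact: (smooth_at_continuous (pullback2_smooth (sf z))). Qed.

Lemma near_pullback2 (f g : R^o * R^o -> X) z : (\forall w \near z, f w = g w) ->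
  pullback2 om f z = pullback2 om g z.
Proof. by move=> fg; rewrite /pullback2 !(near_mderiv _ fg) (nbhs_singleton fg). Qed.

(** Bilinearity expands the form on the images of the two basis vectors, and antisymmetry leaves the
    determinant. *)
Lemma pullback2_jacobian (f : R^o * R^o -> X) (g : R^o * R^o -> R^o * R^o) z (p q s u : R^o) :
  smooth_at (@vec_atlas R (R^o * R^o)%type) (@atlas R F X) f (g z) ->
  diff_quot g z (1, 0) h @[h --> (0 : R)^'] --> ((p, q) : (R^o * R^o)%type) ->
  diff_quot g z (0, 1) h @[h --> (0 : R)^'] --> ((s, u) : (R^o * R^o)%type) ->
  pullback2 om (f \o g) z = pullback2 om f (g z) * (p * u - q * s).
Proof.
move=> sf d1 d2; rewrite /pullback2 /=.
rewrite !(mderiv_comp sf); [|by eexists; exact: d2|by eexists; exact: d1].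
rewrite (ddiffE d1) (ddiffE d2).
have E (a b : R^o) : (a, b) = a *: ((1, 0) : R^o * R^o) + b *: ((0, 1) : R^o * R^o).
  by congr pair; rewrite /= /GRing.scale/= !(mulr0, mulr1, addr0, add0r).
rewrite (E p q) (E s u) !mderivD// !mderivZ// !omDl !omDr !omZl !omZr !omxx.
set A := om _ _ _; rewrite [om _ (mderiv f (g z) (0, 1)) _]omC -/A.
by rewrite !mulr0 add0r addr0; lra.
Qed.

Lemma pullback2_rescale f (a b : R^o -> R^o) z : sm f ->
  (forall n, Ck n setT a) -> (forall n, Ck n setT b) ->
  pullback2 om (fun z => f (a z.1, b z.2)) z = pullback2 om f (a z.1, b z.2) * (ddiff a z.1 1 * ddiff b z.2 1).
Proof.
move=> sf an bn; case: z => r t.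
have [_ da _] := an 1%N; have [_ db _] := bn 1%N.
have C0 (g : R^o -> R^o) x : diff_quot g x 0 h @[h --> (0 : R)^'] --> (0 : R^o).
  by apply: near_cst_cvg; near=> h; rewrite /diff_quot scaler0 addr0 subrr scaler0.
rewrite (@pullback2_jacobian f (fun z => (a z.1, b z.2)) (r, t) (ddiff a r 1) 0 0 (ddiff b t 1))//=.
- by rewrite mul0r subr0.
- apply: (@cvg_pairT _ _ _ _ _ (diff_quot a r 1) (diff_quot b t 0)) => //.
  by apply: ddiffP; exact: da.
- apply: (@cvg_pairT _ _ _ _ _ (diff_quot a r 0) (diff_quot b t 1)) => //.
  by apply: ddiffP; exact: db.
Unshelve. all: by end_near. Qed.

Lemma sm_rescale f (a b : R^o -> R^o) : sm f -> (forall n, Ck n setT a) -> (forall n, Ck n setT b) ->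
  sm (fun z : R^o * R^o => f (a z.1, b z.2)).
Proof.
move=> sf an bn z; apply: (@smooth_at_comp _ _ _ _ _ _ _ _ _ _ _ (@vec_atlas R (R^o * R^o)%type) _ (fun z => (a z.1, b z.2)) f).
- exact: covers_vec.
- apply: sm_of_CT => n; apply: CT_pair; apply: CT_comp => //; [exact: CT_fst|exact: CT_snd].
- exact: sf.
Qed.

Definition J (f : R^o * R^o -> X) : R := rint 0 1 (fun t => rint 0 1 (fun r => pullback2 om f (r, t))).

(** The branch with the minus sign is what makes the area of a reversed tube the opposite one in
    [J_rev]. *)
Lemma int_pullback_r f (a : R^o -> R^o) u v t : sm f -> (forall n, Ck n setT a) -> u <= v ->
  rint u v (fun r => pullback2 om (fun z => f (a z.1, z.2)) (r, t)) =
  if a u <= a v then rint (a u) (a v) (fun r => pullback2 om f (r, t))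
  else - rint (a v) (a u) (fun r => pullback2 om f (r, t)).
Proof.
move=> sf an uv; have [da ca] := CT_derive an.
rewrite -(int_subst uv (section_r (t := t) (pullback2_continuous sf)) ca da).
have id1 : ddiff (fun t : R^o => t) t 1 = 1 by rewrite ddiff_linear//; exact: tvs_linear_id.
apply: eq_int => r _.
rewrite (@pullback2_rescale f a (fun t : R^o => t))//= ?id1 ?mulr1//.
by move=> n; exact: CT_id.
Qed.

Lemma int_pullback_t f (b : R^o -> R^o) u v c d : sm f -> (forall n, Ck n setT b) -> u <= v -> b u <= b v -> c <= d ->
  rint u v (fun t => rint c d (fun r => pullback2 om (fun z => f (z.1, b z.2)) (r, t))) =
  rint (b u) (b v) (fun t => rint c d (fun r => pullback2 om f (r, t))).
Proof.
move=> sf bn uv buv cd; have [db cb] := CT_derive bn.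
have cf := pullback2_continuous sf.
have := int_subst uv (int_param_continuous cd cf) cb db; rewrite buv => <-.
apply: eq_int => t _; rewrite mulrC -intZ; last exact: section_r.
apply: eq_int => r _.
have id1 : ddiff (fun t : R^o => t) r 1 = 1 by rewrite ddiff_linear//; exact: tvs_linear_id.
rewrite (@pullback2_rescale f (fun t : R^o => t) b)//= ?id1 ?mul1r 1?mulrC//.
by move=> n; exact: CT_id.
Qed.

Lemma J_reparam f (a : R^o -> R^o) : sm f -> (forall n, Ck n setT a) -> a 0 = 0 -> a 1 = 1 ->
  J (fun z => f (a z.1, z.2)) = J f.
Proof.
by move=> sf an a0 a1; apply: eq_int => t _; rewrite (@int_pullback_r f a)// a0 a1 ler01.
Qed.

Definition tube (f : R^o * R^o -> X) (p q : R -> X) :=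
  [/\ sm f, forall r t, f (r, t + 1) = f (r, t), forall t, f (0, t) = p t & forall t, f (1, t) = q t].

(** Both pieces pass through [lam] and are therefore equal to the common loop near the seam: for
    [1/3 < r < 2/3] either formula is valid, and smoothness at the seam follows. *)
Definition tube_cat (f g : R^o * R^o -> X) (z : R^o * R^o) : X :=
  if z.1 <= 2^-1 then f (lam (2 * z.1), z.2) else g (lam (2 * z.1 - 1), z.2).

Lemma tube_cat_l f g p q s : tube f p q -> tube g q s -> forall z, z.1 < 2 / 3 ->
  tube_cat f g z = f (lam (2 * z.1), z.2).
Proof.
move=> [_ _ f0 f1] [_ _ g0 g1] [r t] /= r3; rewrite /tube_cat/=; case: ifPn => //; rewrite -ltNge => r2.
by rewrite (@lam0 _ (2 * r - 1)) ?g0 ?lam1 ?f1//; lra.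
Qed.

Lemma tube_cat_r f g p q s : tube f p q -> tube g q s -> forall z, 3^-1 < z.1 ->
  tube_cat f g z = g (lam (2 * z.1 - 1), z.2).
Proof.
move=> [_ _ f0 f1] [_ _ g0 g1] [r t] /= r3; rewrite /tube_cat/=; case: ifPn => // r2.
by rewrite (@lam0 _ (2 * r - 1)) ?g0 ?lam1 ?f1//; lra.
Qed.

Lemma near_lt1 (z : R^o * R^o) (a : R) : z.1 < a -> \forall w \near z, w.1 < a.
Proof. by move=> za; exists ([set x | x < a], setT) => [|[? ?] []//]; split; [exact: lt_nbhsl|exact: filterT]. Qed.

Lemma near_gt1 (z : R^o * R^o) (a : R) : a < z.1 -> \forall w \near z, a < w.1.
Proof. by move=> za; exists ([set x | a < x], setT) => [|[? ?] []//]; split; [exact: lt_nbhsr|exact: filterT]. Qed.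

Lemma tube_catP f g p q s : tube f p q -> tube g q s -> tube (tube_cat f g) p s.
Proof.
move=> Tf Tg; have [sf pf f0 f1] := Tf; have [sg pg g0 g1] := Tg; split.
- move=> z; have [z3|z3] := ltP z.1 (2 / 3).
    have : \forall w \near z, f (lam (2 * w.1), w.2) = tube_cat f g w.
      by apply: filterS (near_lt1 z3) => w w3; rewrite (tube_cat_l Tf Tg).
    move=> H; apply: near_smooth_at H _.
    by apply: (@sm_rescale f (fun r => lam (2 * r)) (fun t => t)) => // n; ckt.
  have z3' : 3^-1 < z.1 by lra.
  have : \forall w \near z, g (lam (2 * w.1 - 1), w.2) = tube_cat f g w.
    by apply: filterS (near_gt1 z3') => w w3; rewrite (tube_cat_r Tf Tg).
  move=> H; apply: near_smooth_at H _.
  by apply: (@sm_rescale g (fun r => lam (2 * r - 1)) (fun t => t)) => // n; ckt.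
- by move=> r t; rewrite /tube_cat/= pf pg.
- by move=> t; rewrite (tube_cat_l Tf Tg)/= ?mulr0 ?lam0//; lra.
- by move=> t; rewrite (tube_cat_r Tf Tg)/= ?lam1 ?g1//; lra.
Qed.

(** After the cut at 1/2, the substitutions [lam (2 r)] and [lam (2 r - 1)] restore each inner
    integral over the full interval. *)
Lemma J_cat f g p q s : tube f p q -> tube g q s -> J (tube_cat f g) = J f + J g.
Proof.
move=> Tf Tg; have [sf pf f0 f1] := Tf; have [sg pg g0 g1] := Tg.
have [sfg _ _ _] := tube_catP Tf Tg.
have i01 : (0 : R) <= 1 by [].
rewrite /J -intD; [|exact: (int_param_continuous i01 (pullback2_continuous sf))|exact: (int_param_continuous i01 (pullback2_continuous sg))].
apply: eq_int => t _.
rewrite (@int_cat _ _ 0 2^-1 1); [|lra|lra|exact: (section_r (t := t) (pullback2_continuous sfg))].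
apply: congr2.
  rewrite (eq_int (g := fun r => pullback2 om (fun z => f (lam (2 * z.1), z.2)) (r, t))); last first.
    move=> r /andP[_ r2]; apply: near_pullback2.
    have : ((r, t) : R^o * R^o).1 < 2 / 3 by rewrite /=; lra.
    by move=> /near_lt1; apply: filterS => w w3; rewrite (tube_cat_l Tf Tg).
  rewrite (@int_pullback_r f (fun r => lam (2 * r)))//; [|by move=> n; ckt].
  by rewrite mulr0 lam0 ?lam1 ?ler01//; lra.
rewrite (eq_int (g := fun r => pullback2 om (fun z => g (lam (2 * z.1 - 1), z.2)) (r, t))); last first.
  move=> r /andP[r2 _]; apply: near_pullback2.
  have : 3^-1 < ((r, t) : R^o * R^o).1 by rewrite /=; lra.
  by move=> /near_gt1; apply: filterS => w w3; rewrite (tube_cat_r Tf Tg).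
rewrite (@int_pullback_r g (fun r => lam (2 * r - 1)))//; [|by move=> n; ckt|lra].
by rewrite lam0 ?lam1 ?ler01//; lra.
Qed.

Lemma tube_rev f p q : tube f p q -> tube (fun z => f (1 - z.1, z.2)) q p.
Proof.
move=> [sf pf f0 f1]; split => //.
- by apply: (@sm_rescale f (fun r => 1 - r) (fun t => t)) => // n; ckt.
- by move=> r t /=; rewrite pf.
- by move=> t /=; rewrite subr0.
- by move=> t /=; rewrite subrr.
Qed.

Lemma J_rev f : sm f -> J (fun z => f (1 - z.1, z.2)) = - J f.
Proof.
move=> sf; have i01 : (0 : R) <= 1 by [].
rewrite /J -intN; last exact: (int_param_continuous i01 (pullback2_continuous sf)).
apply: eq_int => t _; rewrite (@int_pullback_r f (fun r => 1 - r))//; last by move=> n; ckt.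
by rewrite subr0 subrr ler10.
Qed.

Lemma tube_path (c : R^o -> X) : (forall t, smooth_at (@vec_atlas R R^o) (@atlas R F X) c t) ->
  tube (fun z => c z.1) (fun=> c 0) (fun=> c 1).
Proof.
move=> sc; split => // z.
apply: (@smooth_at_comp _ _ _ _ _ _ _ _ _ _ _ (@vec_atlas R R^o) _ (fun z : R^o * R^o => z.1) c) => //.
- exact: covers_vec.
- by apply: sm_of_CT => n; ckt.
Qed.

Lemma J_path (c : R^o -> X) : (forall t, smooth_at (@vec_atlas R R^o) (@atlas R F X) c t) ->
  J (fun z => c z.1) = 0.
Proof.
move=> sc; rewrite /J -[RHS](rint0 0 1); apply: eq_int => t _.
rewrite (eq_int (g := fun=> 0)) ?rint0//.
move=> r _; rewrite /pullback2 (mderiv_comp (g := fun z : R^o * R^o => z.1) (f := c) (v := (0, 1)))//.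
  by rewrite ddiff_linear ?mderiv0 ?om0r//; exact: tvs_linear_fst.
by have [_ df _] := @CT_fst R 1%N R^o R^o _; exact: df.
Qed.

End Pullback.

(** * Right velocities and moment maps *)

Section Schwarz.
Context {R : realType}.
Implicit Types E F : tvsType R.

(** The mean value principle is applied to [c t = h^-1 (f (x + h u + t v) - f (x + t v))], whose
    derivative in [t] is a difference quotient of [ddiff f _ v] in the direction [u], close to the
    limit by strict differentiability. The left side is symmetric in [u] and [v], whence
    [Schwarz]. *)
Lemma second_difference E F {hE : hausT E} {hF : hausT F} (U : set E) (f : E -> F) x u v :
  open U -> Ck 2 U f -> U x ->
  (fun h : R => (h ^- 2) *: (f (x + h *: u + h *: v) - f (x + h *: u) - (f (x + h *: v) - f x)))
    @ (0 : R)^'+ --> ddiff (fun y => ddiff f y v) x u.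
Proof.
move=> oU f2 Ux; pose g y := ddiff f y v.
have g1 : Ck 1 U g.
  have [_ _ df] := f2.
  apply: (@Ck_comp R 1 _ _ _ _ _ _ (fun x => (x, v)) (fun p => ddiff f p.1 p.2) U (U `*` setT)) => //.
    exact: open_setXT.
  by apply: Ck_pair => //; [apply: Ck_linear; exact: tvs_linear_id|exact: Ck_cst].
move=> K /locally_convexs[K0 [oK0 cK0 K0d K0K]].
have HK := @C1_strict R E F hF U g x u K0 oU g1 Ux (open_nbhs_nbhs (conj oK0 K0d)).
have mc : (fun p : R * R => (x + p.1 *: u + p.2 *: v, x + p.2 *: v, u, p.1 : R^o)) @ nbhs (0 : R, 0 : R) -->
    ((x, x, u, 0 : R^o) : (E * E * E * R^o)%type).
  have c1 : (fun p : R * R => p.1 : R^o) @ nbhs (0 : R, 0 : R) --> (0 : R^o) by exact: cvg_fst.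
  have c2 : (fun p : R * R => p.2 : R^o) @ nbhs (0 : R, 0 : R) --> (0 : R^o) by exact: cvg_snd.
  have l1 w (k : R * R -> R^o) : k @ nbhs (0 : R, 0 : R) --> (0 : R^o) ->
      (fun p => k p *: w) @ nbhs (0 : R, 0 : R) --> (0 : E).
    by move=> kc; rewrite -[X in _ --> X](scale0r w); apply: tvs_cvgZ => //; exact: cvg_cst.
  have l2 : (fun p : R * R => x + p.2 *: v) @ nbhs (0 : R, 0 : R) --> x.
    by rewrite -[X in _ --> X]addr0; apply: tvs_cvgD; [exact: cvg_cst|exact: l1].
  have l3 : (fun p : R * R => x + p.1 *: u + p.2 *: v) @ nbhs (0 : R, 0 : R) --> x.
    rewrite -[X in _ --> X]addr0; apply: tvs_cvgD; last exact: l1.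
    by rewrite -[X in _ --> X]addr0; apply: tvs_cvgD; [exact: cvg_cst|exact: l1].
  do 3?[apply: cvg_pairT => //]; exact: cvg_cst.
have [[A B] /= [/nbhs_ballP[d1 /= d10 H1] /nbhs_ballP[d2 /= d20 H2]] AB] :
    nbhs (0 : R, 0 : R) [set p : R * R | U (x + p.1 *: u + p.2 *: v) /\ U (x + p.2 *: v) /\
      (p.1 != 0 -> K0 (diff_quot g (x + p.2 *: v) u p.1))].
  apply: (mc [set q : E * E * E * R^o | U q.1.1.1 /\ U q.1.1.2 /\ (q.2 != 0 -> K0 (diff_quot g q.1.1.2 q.1.2 q.2))]).
  have NU : nbhs x U by exact: open_nbhs_nbhs.
  have c1 : (fun q : E * E * E * R^o => q.1.1.1) @ nbhs (x, x, u, 0 : R^o) --> x.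
    exact: ((tvs_linear_comp (@tvs_linear_fst R _ _) (tvs_linear_comp (@tvs_linear_fst R _ _) (@tvs_linear_fst R E E))).1 (x, x, u, 0)).
  have c2 : (fun q : E * E * E * R^o => q.1.1.2) @ nbhs (x, x, u, 0 : R^o) --> x.
    exact: ((tvs_linear_comp (@tvs_linear_fst R _ _) (tvs_linear_comp (@tvs_linear_fst R _ _) (@tvs_linear_snd R E E))).1 (x, x, u, 0)).
  have c3 : (fun q : E * E * E * R^o => (q.1.1.2, q.1.2, q.2)) @ nbhs (x, x, u, 0 : R^o) --> ((x, u, 0) : (E * E * R^o)%type).
    apply: cvg_pairT; last exact: cvg_snd.
    apply: cvg_pairT => //; exact: ((tvs_linear_comp (@tvs_linear_fst R _ _) (@tvs_linear_snd R (E * E)%type E)).1 (x, x, u, 0)).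
  have N1 := c1 _ NU; have N2 := c2 _ NU; have N3 := c3 _ HK; rewrite !nbhs_simpl/= in N1 N2 N3.
  by apply: filterS3 N1 N2 N3.
exists (Num.min d1 d2) => /=; first by rewrite lt_min d10 d20.
move=> h /=; rewrite sub0r normrN lt_min => /andP[hd1 hd2] h0; apply: K0K.
have hn : `|h| = h by rewrite gtr0_norm.
have Hh t : 0 <= t <= h -> U (x + h *: u + t *: v) /\ U (x + t *: v) /\ K0 (diff_quot g (x + t *: v) u h).
  move=> /andP[t0 th]; have [? [? Kh]] : [set p : R * R | U (x + p.1 *: u + p.2 *: v) /\ U (x + p.2 *: v) /\
      (p.1 != 0 -> K0 (diff_quot g (x + p.2 *: v) u p.1))] (h, t).
    apply: AB; split => /=; [apply: H1|apply: H2]; rewrite /ball/= sub0r normrN//.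
    by rewrite (le_lt_trans _ hd2)// hn ger0_norm.
  by split => //; split => //; apply: Kh; rewrite /= gt_eqF.
have [_ df _] := f2.
pose c (t : R) := h^-1 *: (f (x + h *: u + t *: v) - f (x + t *: v)).
have dc t : 0 <= t <= h -> @diff_quot R R^o F c t 1 k @[k --> (0 : R)^'] --> diff_quot g (x + t *: v) u h.
  move=> /Hh[Ut1 [Ut2 _]].
  have D1 := ddiffP (df _ v Ut1); have D2 := ddiffP (df _ v Ut2).
  have -> : diff_quot g (x + t *: v) u h = h^-1 *: (ddiff f (x + h *: u + t *: v) v + -1 *: ddiff f (x + t *: v) v).
    by rewrite /diff_quot /g scaleN1r addrAC.
  have : (fun k => h^-1 *: (diff_quot f (x + h *: u + t *: v) v k + -1 *: diff_quot f (x + t *: v) v k)) @ (0 : R)^' -->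
      h^-1 *: (ddiff f (x + h *: u + t *: v) v + -1 *: ddiff f (x + t *: v) v).
    apply: tvs_cvgZ; first exact: cvg_cst.
    by apply: tvs_cvgD => //; apply: tvs_cvgZ => //; exact: cvg_cst.
  apply: near_cvg; near=> k.
  rewrite /diff_quot /c [k *: (1 : R^o)]mulr1 !scalerDl !addrA scaleN1r.
  rewrite -!scalerBr [RHS]scalerA mulrC -scalerA; congr (_ *: (_ *: _)).
  by rewrite !opprD !opprK addrACA.
have := @convex_mean_value _ F K0 c (fun t => diff_quot g (x + t *: v) u h) 0 h oK0 cK0 h0 dc.
move=> /(_ (fun t th => (Hh t th).2.2)).
rewrite subr0 /c scale0r !addr0 -scalerBr scalerA -invfM -expr2.
suff -> : f (x + h *: u + h *: v) - f (x + h *: v) - (f (x + h *: u) - f x) =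
  f (x + h *: u + h *: v) - f (x + h *: u) - (f (x + h *: v) - f x) by [].
by rewrite !opprB addrACA [RHS]addrACA; congr (_ + _); rewrite addrC.
Unshelve. all: by end_near. Qed.

Lemma Schwarz E F {hE : hausT E} {hF : hausT F} (U : set E) (f : E -> F) x u v :
  open U -> Ck 2 U f -> U x ->
  ddiff (fun y => ddiff f y v) x u = ddiff (fun y => ddiff f y u) x v.
Proof.
move=> oU f2 Ux.
have H1 := @second_difference E F hE hF U f x u v oU f2 Ux.
have H2 := @second_difference E F hE hF U f x v u oU f2 Ux.
apply: (cvg_unique hF H1); apply: near_cvg H2; near=> h.
rewrite (addrAC x); congr (_ *: _); rewrite !opprB addrACA [RHS]addrACA; congr (_ + _).
by rewrite addrC.
Unshelve. all: by end_near. Qed.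

End Schwarz.

(** * Partial derivatives of maps on a product *)

Section Partial.
Context {R : realType} (F : tvsType R) {hF : hausT F} (M : manifold F).
Implicit Types V W : tvsType R.
Notation sm f z := (smooth_at (@vec_atlas R _) (@atlas R F M) f z).

Lemma sm_precomp V W {hV : hausT V} {hW : hausT W} (N : topologicalType) (B : set (chart N F))
    (f : V -> N) (g : W -> V) z :
  (forall n, Ck n setT g) -> smooth_at (@vec_atlas R V) B f (g z) ->
  smooth_at (@vec_atlas R W) B (fun w => f (g w)) z.
Proof.
move=> gn sf; apply: (@smooth_at_comp _ _ _ _ _ _ _ _ _ _ _ (@vec_atlas R V) _ g f) => //.
- exact: covers_vec.
- exact: sm_of_CT.
Qed.

Lemma mderiv_precomp V W {hV : hausT V} {hW : hausT W} (f : V -> M) (g : W -> V) z v w :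
  sm f (g z) -> diff_quot g z v h @[h --> (0 : R)^'] --> w ->
  mderiv (fun y => f (g y)) z v = mderiv f (g z) w.
Proof.
move=> sf dg; rewrite (mderiv_comp (g := g) (f := f)) ?(ddiffE dg)//.
by exists w.
Qed.

Lemma diff_quot_cst V W (a : W) (z v : V) : diff_quot (fun=> a) z v h @[h --> (0 : R)^'] --> (0 : W).
Proof.
by apply: near_cst_cvg; near=> h; rewrite /diff_quot subrr scaler0.
Unshelve. all: by end_near. Qed.

Lemma diff_quot_id V (z v : V) : diff_quot (fun x => x) z v h @[h --> (0 : R)^'] --> v.
Proof. by apply: (@linear_diff_quot R V V id); exact: tvs_linear_id. Qed.

(** Linearity of the derivative on [(v, v) = (v, 0) + (0, v)]. This is the Leibniz rule, used for
    products in [G] and for a moving group element acting on a moving point. *)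
Lemma mderiv_diag V {hV : hausT V} (P : V * V -> M) z v : sm P (z, z) ->
  mderiv (fun w => P (w, w)) z v = mderiv (fun a => P (a, z)) z v + mderiv (fun b => P (z, b)) z v.
Proof.
move=> sP.
rewrite (@mderiv_precomp _ _ _ _ P (fun w => (w, w)) z v (v, v))//; last first.
  by apply: diff_quot_pair; exact: diff_quot_id.
rewrite (@mderiv_precomp _ _ _ _ P (fun w => (w, z)) z v (v, 0))//; last first.
  by apply: diff_quot_pair; [exact: diff_quot_id|exact: diff_quot_cst].
rewrite (@mderiv_precomp _ _ _ _ P (fun w => (z, w)) z v (0, v))//; last first.
  by apply: diff_quot_pair; [exact: diff_quot_cst|exact: diff_quot_id].
rewrite -mderivD//; congr (mderiv _ _ _).
by rewrite (_ : (v, 0) + (0, v) = (v + 0, 0 + v))// addr0 add0r.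
Qed.

End Partial.

(** * Adjoint action and right logarithmic derivatives *)

Section Group.
Context {R : realType}.
Context (E F : tvsType R) {hE : hausT E} {hF : hausT F} (G : lieGroup E).
Implicit Types V W : tvsType R.
Notation "x ** y" := (lie_mul x y) (at level 40, left associativity).
Notation "x ^I" := (lie_inv x) (at level 3).
Notation one := (lie_one G).
Notation aG := (@atlas R E G).

Lemma mulgV (g : G) : g ** g^I = one.
Proof.
rewrite -[LHS]lie_mul1g -{1}(lie_mulVg (g^I)) -lie_mulA (lie_mulA g^I g).
by rewrite lie_mulVg lie_mul1g lie_mulVg.
Qed.

Lemma mulg1 (g : G) : g ** one = g.
Proof. by rewrite -(lie_mulVg g) lie_mulA mulgV lie_mul1g. Qed.

Lemma mulgK (g h : G) : g ** h ** h^I = g.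
Proof. by rewrite -lie_mulA mulgV mulg1. Qed.

Lemma mulgVK (g h : G) : g ** h^I ** h = g.
Proof. by rewrite -lie_mulA lie_mulVg mulg1. Qed.

Lemma mulKg (g h : G) : g^I ** (g ** h) = h.
Proof. by rewrite lie_mulA lie_mulVg lie_mul1g. Qed.

Lemma invg1 : one^I = one.
Proof. by rewrite -[LHS]mulg1 lie_mulVg. Qed.

Lemma invMg (g h : G) : (g ** h)^I = h^I ** g^I.
Proof.
by rewrite -[RHS](mulgK _ (g ** h)) -(lie_mulA h^I) mulKg lie_mulVg lie_mul1g.
Qed.

Section SmoothOps.
Context (M : topologicalType) (V : tvsType R) {hV : hausT V} (A : set (chart M V)).
Notation sm f z := (smooth_at A aG f z).

Lemma sm_mul (f g : M -> G) z : sm f z -> sm g z -> sm (fun w => f w ** g w) z.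
Proof.
move=> sf sg; apply: (@smooth_at_comp _ _ _ _ _ _ _ _ _ _ _ (prod_atlas aG aG) _ (fun w => (f w, g w)) (fun p => p.1 ** p.2)).
- by apply: covers_prod; exact: covers_atlas.
- exact: smooth_at_pair.
- exact: ((smooth_atT _ _ _).1 (lie_mul_smooth G)).
Qed.

Lemma sm_inv (f : M -> G) z : sm f z -> sm (fun w => (f w)^I) z.
Proof.
move=> sf; apply: (@smooth_at_comp _ _ _ _ _ _ _ _ _ _ _ aG _ f (fun p => p^I)) => //.
- exact: covers_atlas.
- exact: ((smooth_atT _ _ _).1 (lie_inv_smooth G)).
Qed.
End SmoothOps.

(** The right logarithmic derivative of [g] in the direction [v], an element of Lie(G); for
    [V = R^o] and [v = 1] it is [right_velocity] by conversion. *)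
Definition rvel V (g : V -> G) (z v : V) : E := mderiv (fun w => g w ** (g z)^I) z v.

Lemma sm_conj g h : smooth_at aG aG (fun h : G => g ** h ** g^I) h.
Proof. by do 2?[apply: sm_mul]; try exact: smooth_at_cst; exact: smooth_at_id. Qed.

Lemma Ad_mderiv V {hV : hausT V} g (c : V -> G) z v : smooth_at (@vec_atlas R V) aG c z -> c z = one ->
  mderiv (fun w => g ** c w ** g^I) z v = Ad g (mderiv c z v).
Proof.
by move=> sc cz; rewrite /Ad -cz; exact: (tangent_map_comp v sc (sm_conj g (c z))).
Qed.

Lemma Ad1 v : Ad one v = v.
Proof.
rewrite /Ad /tangent_map.
set c := chart_at one; have cz : chart_dom c one := chart_at_dom _.
have cy := chart_to_cod cz.
rewrite (near_mderiv (g := chart_from c)); last first.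
  by near=> y; rewrite /= lie_mul1g invg1 mulg1.
rewrite /mderiv chart_toK// -/c; apply: ddiffE.
have := @linear_diff_quot R _ _ id (chart_to c one) v (tvs_linear_id E).
have N : \forall y \near chart_to c one, chart_to c (chart_from c y) = y.
  apply: filterS (open_nbhs_nbhs (conj (chart_cod_open c) cy)) => y ?.
  by rewrite chart_fromK.
apply: near_cvg; have := @line_cvg R E (chart_to c one) v _ N.
rewrite nbhs_simpl/=; apply: filterS => h H.
by rewrite /diff_quot/= H (nbhs_singleton N).
Unshelve. all: by end_near. Qed.

Lemma AdB (g : G) (u v : E) : Ad g (u - v) = Ad g u - Ad g v.
Proof.
rewrite /Ad /tangent_map.
set c := chart_at one; have cz : chart_dom c one := chart_at_dom _.
have s : smooth_at (@vec_atlas R E) aG ((fun h : G => g ** h ** g^I) \o chart_from c) (chart_to c one).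
  apply: (@smooth_at_comp _ _ _ _ _ _ _ _ _ _ _ aG); first exact: covers_atlas.
    by apply: smooth_at_chart_from; [exact: chart_at_atlas|exact: chart_to_cod].
  exact: sm_conj.
by rewrite mderivD// -[- v]scaleN1r mderivZ// scaleN1r.
Qed.

(* Through the derivative of the smooth map (g, y) |-> g y g^-1 read in charts. *)
Lemma Ad_cvg (T : Type) (Z : set_system T) {FZ : Filter Z} (g : T -> G) (v : T -> E) g0 v0 :
  g @ Z --> g0 -> v @ Z --> v0 -> (fun t => Ad (g t) (v t)) @ Z --> Ad g0 v0.
Proof.
move=> gg vv.
set c := chart_at one; have cz : chart_dom c one := chart_at_dom _.
set k := chart_at g0; have kz : chart_dom k g0 := chart_at_dom _.
have cA : atlas c := chart_at_atlas _; have kA : atlas k := chart_at_atlas _.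
pose y0 := chart_to c one; pose u0 := chart_to k g0.
pose B (p : E * E) : G := chart_from k p.1 ** chart_from c p.2 ** (chart_from k p.1)^I.
have sk : smooth_at (@vec_atlas R (E * E)%type) aG (fun p : E * E => chart_from k p.1) (u0, y0).
  apply: (@sm_precomp _ _ _ _ _ _ _ _ _ (chart_from k) (fun p : E * E => p.1)); first by move=> n; ckt.
  by apply: smooth_at_chart_from => //=; exact: chart_to_cod.
have sc : smooth_at (@vec_atlas R (E * E)%type) aG (fun p : E * E => chart_from c p.2) (u0, y0).
  apply: (@sm_precomp _ _ _ _ _ _ _ _ _ (chart_from c) (fun p : E * E => p.2)); first by move=> n; ckt.
  by apply: smooth_at_chart_from => //=; exact: chart_to_cod.
have sB : smooth_at (@vec_atlas R (E * E)%type) aG B (u0, y0).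
  by apply: sm_mul; [exact: sm_mul|exact: sm_inv].
have B1 u : B (u, y0) = one by rewrite /B/= /y0 chart_toK// mulg1 mulgV.
have cB : chart_dom c (B (u0, y0)) by rewrite B1.
have [ O [ oO Oz Od kO]] := smooth_at_vecE sB cA cB.
have AdE g' v' : chart_dom k g' -> O (chart_to k g', y0) ->
    Ad g' v' = ddiff (chart_to c \o B) (chart_to k g', y0) (0, v').
  move=> kg' Og'; rewrite /Ad /tangent_map /mderiv -/c -/y0 /=.
  rewrite /y0 chart_toK// mulg1 mulgV -/c -/y0.
  have [_ dO _] := kO 1%N.
  have := @ddiff_comp R E (E * E)%type E _ _ O (fun y => (chart_to k g', y)) (chart_to c \o B) y0 v' _ oO (kO 1%N) Og'.
  rewrite (ddiffE (w := (0, v'))); last first.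
    by apply: diff_quot_pair; [exact: diff_quot_cst|exact: diff_quot_id].
  move=> <-; last first.
    by exists (0, v'); apply: diff_quot_pair; [exact: diff_quot_cst|exact: diff_quot_id].
  apply: near_ddiff; near=> y; rewrite /B /= (chart_toK kg')//.
rewrite (AdE g0 v0)//.
have Nk : \forall g' \near g0, chart_dom k g'.
  by apply: open_nbhs_nbhs; split => //; exact: chart_dom_open.
have cu : (fun t => (chart_to k (g t), y0)) @ Z --> ((u0, y0) : (E * E)%type).
  by apply: cvg_pairT; [exact: cvg_comp_at gg (chart_to_continuous kz)|exact: cvg_cst].
have [_ _ cd] := kO 1%N.
have : (fun t => ddiff (chart_to c \o B) (chart_to k (g t), y0) (0, v t)) @ Z --> ddiff (chart_to c \o B) (u0, y0) (0, v0).
  apply: (@cvg_comp_at _ _ _ _ (fun t => ((chart_to k (g t), y0), (0 : E, v t))) (fun p => ddiff (chart_to c \o B) p.1 p.2) ((u0, y0), (0, v0))).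
    by do 2?[apply: cvg_pairT => //]; exact: cvg_cst.
  exact: cd.
apply: near_cvg.
have N1 : Z [set t | chart_dom k (g t)] by exact: gg.
have N2 : Z [set t | O (chart_to k (g t), y0)] by apply: cu; exact: open_nbhs_nbhs.
by apply: filterS2 N1 N2 => t kt Ot; rewrite AdE.
Unshelve. all: by end_near. Qed.

(** It is the partial derivative in [b] of the smooth map [(w, b) |-> g b (g w)^-1], taken on the
    diagonal, where the value is always [one] and a single chart serves. *)
Lemma rvel_smooth V {hV : hausT V} (g : V -> G) v z :
  (forall z, smooth_at (@vec_atlas R V) aG g z) ->
  smooth_at (@vec_atlas R V) (@vec_atlas R E) (fun z => rvel g z v) z.
Proof.
move=> sg.
set c := chart_at one; have cz : chart_dom c one := chart_at_dom _.
have cA : atlas c := chart_at_atlas _.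
pose B (p : V * V) : G := g p.2 ** (g p.1)^I.
have sB p : smooth_at (@vec_atlas R (V * V)%type) aG B p.
  apply: sm_mul; [|apply: sm_inv].
    by apply: (@sm_precomp _ _ _ _ _ _ _ _ _ g (fun p : V * V => p.2)) => // n; ckt.
  by apply: (@sm_precomp _ _ _ _ _ _ _ _ _ g (fun p : V * V => p.1)) => // n; ckt.
have B1 w : B (w, w) = one by rewrite /B mulgV.
have cB : chart_dom c (B (z, z)) by rewrite B1.
have [ O [ oO Oz Od kO]] := smooth_at_vecE (sB _) cA cB.
pose D := (fun w : V => (w, w)) @^-1` O.
have cdiag : forall n, Ck n setT (fun w : V => (w, w)) by move=> n; ckt.
have oD : open D.
  rewrite openE => w Dw; apply: (Ck_continuous (cdiag 0%N) (x := w)) => //.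
  exact: open_nbhs_nbhs.
apply: (@near_smooth_at _ _ _ _ _ _ _ _ ((fun p => ddiff (chart_to c \o B) p (0, v)) \o (fun w : V => (w, w)))); last first.
  apply: (@smooth_at_vec _ _ _ _ D) => // n.
  apply: (Ck_comp oD oO) => //; first exact: Ck_subset (cdiag n).
  exact: Ck_ddiff_dir.
apply: filterS (open_nbhs_nbhs (conj oD Oz)) => w Dw /=.
rewrite /rvel /mderiv mulgV -/c.
have [_ dO _] := kO 1%N.
have H : diff_quot (fun b => (w, b)) w v h @[h --> (0 : R)^'] --> ((0, v) : (V * V)%type).
  by apply: diff_quot_pair; [exact: diff_quot_cst|exact: diff_quot_id].
have := @ddiff_comp R V (V * V)%type E _ _ O (fun b => (w, b)) (chart_to c \o B) w v _ oO (kO 1%N) Dw.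
rewrite (ddiffE H) => <-; last by eexists; exact: H.
by apply: near_ddiff; near=> b.
Unshelve. all: by end_near. Qed.

Lemma rvel_mul V {hV : hausT V} (f g : V -> G) z v :
  smooth_at (@vec_atlas R V) aG f z -> smooth_at (@vec_atlas R V) aG g z ->
  rvel (fun w => f w ** g w) z v = rvel f z v + Ad (f z) (rvel g z v).
Proof.
move=> sf sg.
(* The variable is doubled: varying the first copy gives [rvel f], varying the second one conjugates
   [g w (g z)^-1] by [f z]. *)
pose P (p : V * V) := f p.1 ** (g p.2 ** (g z)^I) ** (f z)^I.
have sP : smooth_at (@vec_atlas R (V * V)%type) aG P (z, z).
  have s1 : smooth_at (@vec_atlas R (V * V)%type) aG (fun p : V * V => f p.1) (z, z).
    by apply: (@sm_precomp _ _ _ _ _ _ _ _ _ f (fun p : V * V => p.1)) => // n; ckt.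
  have s2 : smooth_at (@vec_atlas R (V * V)%type) aG (fun p : V * V => g p.2) (z, z).
    by apply: (@sm_precomp _ _ _ _ _ _ _ _ _ g (fun p : V * V => p.2)) => // n; ckt.
  by do 3?[apply: sm_mul => //]; exact: smooth_at_cst.
transitivity (mderiv (fun w => P (w, w)) z v).
  by apply: near_mderiv; near=> w; rewrite /P/= invMg !lie_mulA.
rewrite (mderiv_diag v sP); congr (_ + _).
  by apply: near_mderiv; near=> w; rewrite /P/= mulgV mulg1.
rewrite -(@Ad_mderiv _ _ (f z) (fun w => g w ** (g z)^I) z v) ?mulgV//.
by apply: sm_mul => //; exact: smooth_at_cst.
Unshelve. all: by end_near. Qed.

End Group.

(** * Moment maps along group-valued maps *)

Section MomentMap.
Context {R : realType}.
Context (E F : tvsType R) {hE : hausT E} {hF : hausT F} (G : lieGroup E) (X : manifold F).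
Context (om : form2 X) (act : G -> X -> X) (mu : E -> X -> R).
Hypotheses (som : smooth_form2 om) (act_smooth : smooth_action act)
  (act_om : preserves_form om act) (mu_moment : equivariant_moment_map om act mu).
Implicit Types V W : tvsType R.
Notation "x ** y" := (lie_mul x y) (at level 40, left associativity).
Notation "x ^I" := (lie_inv x) (at level 3).
Notation one := (lie_one G).
Notation aG := (@atlas R E G).
Notation aX := (@atlas R F X).
Notation smG f z := (smooth_at (@vec_atlas R _) aG f z).
Notation smX f z := (smooth_at (@vec_atlas R _) aX f z).

Lemma act1 x : act one x = x. Proof. by have [a _ _] := act_smooth. Qed.

Lemma actM g h x : act (g ** h) x = act g (act h x).
Proof. by have [_ a _] := act_smooth. Qed.

Lemma actVK g x : act (g^I) (act g x) = x.
Proof. by rewrite -actM lie_mulVg act1. Qed.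

Lemma sm_act (M : topologicalType) V {hV : hausT V} (A : set (chart M V)) (f : M -> G) (p : M -> X) z :
  smooth_at A aG f z -> smooth_at A aX p z -> smooth_at A aX (fun w => act (f w) (p w)) z.
Proof.
move=> sf sp; have [_ _ sa] := act_smooth.
apply: (@smooth_at_comp _ _ _ _ _ _ _ _ _ _ _ (prod_atlas aG aX) _ (fun w => (f w, p w)) (fun q => act q.1 q.2)).
- by apply: covers_prod; exact: covers_atlas.
- exact: smooth_at_pair.
- exact: ((smooth_atT _ _ _).1 sa).
Qed.

Lemma mu_lin x : tvs_linear (mu^~ x : E -> R^o).
Proof.
have [+ _ _ _] := mu_moment => /(_ x)[l c]; split => //.
Qed.

Lemma muD u v x : mu (u + v) x = mu u x + mu v x.
Proof. exact: (tvs_linearD u v (mu_lin x)). Qed.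

Lemma muZ a v x : mu (a *: v) x = a * mu v x.
Proof. exact: (tvs_linearZ a v (mu_lin x)). Qed.

Lemma mu0 x : mu 0 x = 0.
Proof. exact: (tvs_linear0 (mu_lin x)). Qed.

Lemma muB u v x : mu (u - v) x = mu u x - mu v x.
Proof. by rewrite muD -scaleN1r muZ mulN1r. Qed.

Lemma mu_sm (V : E) x : smooth_at aX (@vec_atlas R R^o) (mu V : X -> R^o) x.
Proof. by have [_ + _ _] := mu_moment => /(_ V) /smooth_atT; exact. Qed.

Lemma mu_Ad (g : G) (V : E) x : mu (Ad g V) (act g x) = mu V x.
Proof. by have [_ _ _ a] := mu_moment. Qed.

(** Joint continuity along an orbit, from separate assumptions. Equivariance moves [h] out of the
    point, [mu w (act h x) = mu (Ad h^-1 w) x]; then [Ad_cvg] and the continuity of [mu] in its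
    vector at the fixed point [x] conclude. *)
Lemma mu_cvg (T : Type) (Z : set_system T) {FZ : Filter Z} (g : T -> G) (v : T -> E) g0 v0 x :
  g @ Z --> g0 -> v @ Z --> v0 -> (fun t => mu (v t) (act (g t) x) : R^o) @ Z --> (mu v0 (act g0 x) : R^o).
Proof.
move=> gg vv.
have H (h : G) w : mu w (act h x) = mu (Ad h^I w) x by rewrite -(mu_Ad h^I) actVK.
rewrite H; under eq_fun do rewrite H.
apply: (@cvg_comp_at _ _ _ _ (fun t => Ad (g t)^I (v t)) (mu^~ x : E -> R^o)); last exact: (mu_lin x).1.
apply: Ad_cvg => //.
apply: (@cvg_comp_at _ _ _ _ g (fun h : G => h^I)) => //.
by apply: (smooth_at_continuous (A := aG) (B := aG)); apply: sm_inv; exact: smooth_at_id.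
Qed.

Lemma rvel_precomp V W {hV : hausT V} {hW : hausT W} (f : V -> G) (g : W -> V) z v w :
  smG f (g z) -> diff_quot g z v h @[h --> (0 : R)^'] --> w ->
  rvel (fun y => f (g y)) z v = rvel f (g z) w.
Proof.
move=> sf dg; apply: (@mderiv_precomp _ _ _ G _ _ _ _ (fun w => f w ** (f (g z))^I) g) => //.
by apply: sm_mul => //; exact: smooth_at_cst.
Qed.

(** The moment map equation is stated for paths through [one] at time 0. The line [z + t v] provides
    the path [g (z + t v) (g z)^-1], of velocity [rvel g z v], acting on the point [act (g z) p]. *)
Lemma moment_dir V {hV : hausT V} (g : V -> G) z v p w : (forall z, smG g z) ->
  om (act (g z) p) (mderiv (fun y => act (g y) p) z v) w = - differential (mu (rvel g z v)) (act (g z) p) w.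
Proof.
move=> sg; have [_ _ + _] := mu_moment; apply.
have dq : diff_quot (fun t : R^o => z + t *: v) 0 1 h @[h --> (0 : R)^'] --> v.
  apply: near_cst_cvg; near=> h.
  rewrite /diff_quot add0r scale0r addr0 [z + _]addrC addrK.
  rewrite [h *: (1 : R^o)]mulr1 scalerA mulVf ?scale1r//.
  by near: h; exact: nbhs_dnbhs_neq.
have cl n : Ck n setT (fun t : R^o => z + t *: v).
  by apply: CT_add; [exact: CT_cst|apply: CT_scale; [exact: CT_id|exact: CT_cst]].
have z0 : z + (0 : R^o) *: v = z by rewrite scale0r addr0.
exists (fun t : R => g (z + t *: v) ** (g z)^I); split.
- apply/smooth_atT => t; apply: sm_mul; last exact: smooth_at_cst.
  exact: (@sm_precomp _ _ _ _ _ _ _ _ _ g (fun t : R^o => z + t *: v)).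
- by rewrite z0 mulgV.
- rewrite /velocity (@mderiv_precomp _ _ _ G _ _ _ _ (fun w => g w ** (g z)^I) (fun t : R^o => z + t *: v) 0 1 v) ?z0//.
  by apply: sm_mul => //; exact: smooth_at_cst.
- transitivity (@velocity _ _ X (fun t : R => act (g (z + t *: v)) p) 0); last first.
    by congr (velocity _ _); apply/funext => t; rewrite -actM mulgVK.
  rewrite /velocity (@mderiv_precomp _ _ _ X _ _ _ _ (fun w => act (g w) p) (fun t : R^o => z + t *: v) 0 1 v) ?z0//.
  by apply: sm_act => //; exact: smooth_at_cst.
Unshelve. all: by end_near. Qed.

(** Equivariance absorbs the [Ad] of [rvel_mul]. *)
Lemma mu_rvel_mul V {hV : hausT V} (f g : V -> G) z v y : smG f z -> smG g z ->
  mu (rvel (fun w => f w ** g w) z v) (act (f z) y) = mu (rvel f z v) (act (f z) y) + mu (rvel g z v) y.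
Proof. by move=> sf sg; rewrite rvel_mul// muD mu_Ad. Qed.

Lemma mu_rvel_continuous V V' {hV : hausT V} {hV' : hausT V'} (f : V' -> G) (w : V' -> E) x :
  (forall z, smG f z) -> continuous w ->
  continuous (fun z => mu (w z) (act (f z) x) : R^o).
Proof.
move=> sf cw z; apply: mu_cvg; last exact: cw.
by apply: smooth_at_continuous; exact: sf.
Qed.

Lemma rvel_continuous V {hV : hausT V} (f : V -> G) v : (forall z, smG f z) -> continuous (fun z => rvel f z v).
Proof. by move=> sf z; apply: smooth_at_continuous; exact: rvel_smooth. Qed.

Lemma CT_of_sm V (E' : tvsType R) (f : V -> E') : (forall z, smooth_at (@vec_atlas R V) (@vec_atlas R E') f z) ->
  forall n, Ck n setT f.
Proof.
move=> sf n; apply: Ck_pointwise => z _.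
by have [ O [ oO Oz kO]] := smooth_at_vecP (sf z); exists O => //; exact: kO.
Qed.

Definition mu_integral (phi : R^o -> G) (x : X) : R :=
  rint 0 1 (fun t => mu (rvel phi t 1) (act (phi t) x)).

Lemma mu_integrand_continuous (phi : R^o -> G) x : (forall t, smG phi t) ->
  continuous (fun t => mu (rvel phi t 1) (act (phi t) x) : R).
Proof.
move=> sp; apply: (@mu_rvel_continuous R^o R^o) => //; exact: rvel_continuous.
Qed.

Section Product.
Context (phi : R^o -> G) (f : R^o * R^o -> X).
Hypotheses (sphi : forall t, smG phi t) (sf : forall z, smX f z).
Let H (z : R^o * R^o) := act (phi z.2) (f z).

Lemma sm_phi2 z : smG (fun z : R^o * R^o => phi z.2) z.
Proof. by apply: (@sm_precomp _ _ _ _ _ _ _ _ _ phi (fun z : R^o * R^o => z.2)) => // n; ckt. Qed.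

Lemma sm_H z : smX H z.
Proof. by apply: sm_act; [exact: sm_phi2|exact: sf]. Qed.

(** Let [T] be the tangent map of the action of [phi z.2]. Then [H_r = T f_r], as [phi] does not
    depend on [r], while [H_t = A + T f_t] with [A] due to the motion of [phi]. Invariance of [om]
    gives the first term; [om (T f_r, A)] is the derivative of the Hamiltonian, by the moment map
    equation and antisymmetry. *)
Lemma pullback2_act z :
  pullback2 om H z = pullback2 om f z + ddiff (mu (rvel phi z.2 1) \o H : R^o * R^o -> R^o) z (1, 0).
Proof.
pose P (p : (R^o * R^o) * (R^o * R^o)) := act (phi p.1.2) (f p.2).
have sP : smX P (z, z).
  apply: sm_act.
    apply: (@sm_precomp _ _ _ _ _ _ _ _ _ phi (fun p : (R^o * R^o) * (R^o * R^o) => p.1.2)) => // n.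
    apply: Ck_linear; exact: (tvs_linear_comp (@tvs_linear_fst R _ _) (@tvs_linear_snd R _ _)).
  by apply: (@sm_precomp _ _ _ _ _ _ _ _ _ f (fun p : (R^o * R^o) * (R^o * R^o) => p.2)) => // n; ckt.
pose A v := mderiv (fun a : R^o * R^o => act (phi a.2) (f z)) z v.
pose T v := tangent_map (act (phi z.2)) (f z) (mderiv f z v).
have dH v : mderiv H z v = A v + T v.
  rewrite (mderiv_diag v sP); congr (_ + _).
  rewrite /T /P /= -(@tangent_map_comp _ _ _ _ _ X X _ _ f (act (phi z.2)) z v)//.
  by apply: sm_act; [exact: smooth_at_cst|exact: smooth_at_id].
have A0 : A (1, 0) = 0.
  rewrite /A (@mderiv_precomp _ _ _ X _ _ _ _ (fun t => act (phi t) (f z)) (fun a : R^o * R^o => a.2) z (1, 0) 0) ?mderiv0//.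
    by apply: sm_act => //; exact: smooth_at_cst.
  by apply: (@linear_diff_quot R (R^o * R^o)%type R^o snd); exact: tvs_linear_snd.
have rv : rvel (fun z : R^o * R^o => phi z.2) z (0, 1) = rvel phi z.2 1.
  apply: (@rvel_precomp _ _ _ _ phi (fun a : R^o * R^o => a.2)) => //.
  by apply: (@linear_diff_quot R (R^o * R^o)%type R^o snd); exact: tvs_linear_snd.
have mA : om (act (phi z.2) (f z)) (A (0, 1)) (T (1, 0)) = - differential (mu (rvel phi z.2 1)) (act (phi z.2) (f z)) (T (1, 0)).
  by rewrite -rv; exact: (@moment_dir _ _ (fun z : R^o * R^o => phi z.2) z (0, 1) (f z) (T (1, 0)) sm_phi2).
rewrite /pullback2 !dH A0 add0r (omDr som) (omC som) mA opprK.
rewrite {2}/H /T act_om addrC; congr (_ + _).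
have [_ ->] := @differential_comp _ _ _ X _ _ H (mu (rvel phi z.2 1)) z (1, 0) (sm_H z) (mu_sm _ _).
by rewrite dH A0 add0r.
Qed.

Context (psi : R^o -> G) (x0 x : X).
Hypotheses (spsi : forall t, smG psi t).
Hypotheses (f0 : forall t, f (0, t) = x0) (f1 : forall t, f (1, t) = act (psi t) x).

(** For fixed [t] the vector [rvel phi t 1] is fixed, so the extra term of [pullback2_act] is an
    exact derivative in [r] and integrates to [a t - b t]. On the product loop the integrand of the
    moment integral splits as [a t + c t]. *)
Lemma J_product :
  J om H - mu_integral (fun t => phi t ** psi t) x = (J om f - mu_integral psi x) - mu_integral phi x0.
Proof.
pose a t := mu (rvel phi t 1) (act (phi t ** psi t) x).
pose b t := mu (rvel phi t 1) (act (phi t) x0).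
pose c t := mu (rvel psi t 1) (act (psi t) x).
have cb : continuous b by exact: mu_integrand_continuous.
have cc : continuous c by exact: mu_integrand_continuous.
have ca : continuous a.
  apply: (@mu_rvel_continuous R^o R^o) => //; last exact: rvel_continuous.
  by move=> t; exact: sm_mul.
have -> : mu_integral (fun t => phi t ** psi t) x = rint 0 1 (fun t => a t + c t).
  by congr (rint _ _ _); apply/funext => t; rewrite actM mu_rvel_mul// /a /c actM.
have cp : continuous (pullback2 om f : R * R -> R) by exact: pullback2_continuous.
have inner t : rint 0 1 (fun r => pullback2 om H (r, t)) =
    rint 0 1 (fun r => pullback2 om f (r, t)) + (a t - b t).
  pose K (r : R^o) : R^o := mu (rvel phi t 1) (H (r, t)).
  have cl n : Ck n setT (fun r : R^o => (r, t) : (R^o * R^o)%type).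
    by apply: CT_pair; [exact: CT_id|exact: CT_cst].
  have sK r : smooth_at (@vec_atlas R R^o) (@vec_atlas R R^o) K r.
    apply: (@smooth_at_comp _ _ _ _ _ _ _ _ _ _ _ aX _ (fun r : R^o => H (r, t)) (mu (rvel phi t 1))).
    - exact: covers_atlas.
    - exact: (@sm_precomp _ _ _ _ _ _ _ _ _ H _ _ cl (sm_H _)).
    - exact: mu_sm.
  have [dK cK] := CT_derive (CT_of_sm sK).
  have E1 r : pullback2 om H (r, t) = pullback2 om f (r, t) + ddiff K r 1.
    rewrite pullback2_act; congr (_ + _); symmetry.
    have sM : smooth_at (@vec_atlas R (R^o * R^o)%type) (@vec_atlas R R^o) (mu (rvel phi t 1) \o H : R^o * R^o -> R^o) (r, t).
      apply: (@smooth_at_comp _ _ _ _ _ _ _ _ _ _ _ aX _ H (mu (rvel phi t 1))).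
      - exact: covers_atlas.
      - exact: sm_H.
      - exact: mu_sm.
    have [ O [ oO Oz kO]] := smooth_at_vecP sM.
    have dl : diff_quot (fun r : R^o => (r, t) : (R^o * R^o)%type) r 1 h @[h --> (0 : R)^'] --> ((1, 0) : (R^o * R^o)%type).
      by apply: diff_quot_pair; [exact: diff_quot_id|exact: diff_quot_cst].
    rewrite -(ddiffE dl); apply: (@ddiff_comp R R^o (R^o * R^o)%type R^o _ _ O (fun r => (r, t)) (mu (rvel phi t 1) \o H)) => //.
      by eexists; exact: dl.
  under eq_fun do rewrite E1.
  rewrite intD//; last exact: (section_r (t := t) cp).
  congr (_ + _); rewrite (int_FTC (F := K))//.
  by rewrite /K /H f0 f1 /a /b actM.
have cJ := @int_param_continuous R _ 0 1 ler01 cp.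
rewrite /J; under eq_fun do rewrite inner.
have cab : continuous (fun t => a t - b t) by move=> t; apply: cvgB; [exact: ca|exact: cb].
rewrite (@intD R _ _ 0 1 cJ cab) (@intB R _ _ 0 1 ca cb) (@intD R _ _ 0 1 ca cc).
by rewrite /mu_integral -/c -/b; ring.
Qed.

End Product.

(** Where both maps equal [one], [rvel] is [mderiv] and [Ad] is the identity, so the claim is
    [rvel_mul] for [p = (p q^-1) q]. *)
Lemma mderiv_quot V {hV : hausT V} (p q : V -> G) z v : smG p z -> smG q z -> p z = one -> q z = one ->
  mderiv (fun w => p w ** (q w)^I) z v = mderiv p z v - mderiv q z v.
Proof.
move=> sp sq pz qz.
have r1 (f : V -> G) : f z = one -> rvel f z v = mderiv f z v.
  by move=> fz; apply: near_mderiv; near=> w; rewrite fz invg1 mulg1.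
have := @rvel_mul _ _ _ G _ _ (fun w => p w ** (q w)^I) q z v.
rewrite pz qz invg1 mulg1 Ad1 (r1 q)// (r1 (fun w => p w ** _)) ?pz ?qz ?invg1 ?mulg1//.
have -> : rvel (fun w => p w ** (q w)^I ** q w) z v = mderiv p z v.
  by rewrite -r1//; apply: (f_equal (fun P => rvel P z v)); apply/funext => w; exact: mulgVK.
by move=> ->; rewrite ?addrK//; apply: sm_mul => //; exact: sm_inv.
Unshelve. all: by end_near. Qed.

(** * The area swept by an orbit along a group-valued tube *)

Section Stokes.
Context (Psi : R^o * R^o -> G) (x : X).
Hypothesis sPsi : forall z, smG Psi z.
Let C z := act (Psi z) x.
Let a z := mu (rvel Psi z (0, 1)) (C z).
Let b z := mu (rvel Psi z (1, 0)) (C z).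
Let W z := ddiff (fun w => rvel Psi w (1, 0)) z (0, 1).

Lemma CT_rvel v n : Ck n setT (fun w => rvel Psi w v).
Proof. by apply: CT_of_sm => z; exact: rvel_smooth. Qed.

Lemma W_continuous : continuous W.
Proof.
move=> z; apply: (@Ck_continuous R 0 _ _ setT) => //.
by apply: Ck_ddiff_dir; [exact: openT|move=> n; exact: CT_rvel].
Qed.

Lemma sm_C z : smX C z. Proof. by apply: sm_act => //; exact: smooth_at_cst. Qed.

(* K_h(tau) = Psi(r + h, tau) Psi(r, tau)^-1, divided on the right by its value
   at tau = t. *)
Let B (r t : R^o) (w : R^o * R^o) : G :=
  (Psi w ** (Psi (r, w.2))^I) ** (Psi (w.1, t) ** (Psi (r, t))^I)^I.

Let dq_r r t : diff_quot (fun r : R^o => (r, t) : (R^o * R^o)%type) r 1 h @[h --> (0 : R)^'] --> ((1, 0) : (R^o * R^o)%type).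
Proof. by apply: diff_quot_pair; [exact: diff_quot_id|exact: diff_quot_cst]. Qed.
Let dq_t r t : diff_quot (fun t : R^o => (r, t) : (R^o * R^o)%type) t 1 h @[h --> (0 : R)^'] --> ((0, 1) : (R^o * R^o)%type).
Proof. by apply: diff_quot_pair; [exact: diff_quot_cst|exact: diff_quot_id]. Qed.
Let CT_r t n : Ck n setT (fun r : R^o => (r, t) : (R^o * R^o)%type).
Proof. by apply: CT_pair; [exact: CT_id|exact: CT_cst]. Qed.
Let CT_t r n : Ck n setT (fun t : R^o => (r, t) : (R^o * R^o)%type).
Proof. by apply: CT_pair; [exact: CT_cst|exact: CT_id]. Qed.

Let sm_B r t w : smG (B r t) w.
Proof.
have s1 : smG (fun w : R^o * R^o => Psi (r, w.2)) w.
  apply: (@sm_precomp _ _ _ _ _ _ _ _ _ Psi (fun w : R^o * R^o => (r, w.2))) => // n.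
  by apply: CT_pair; [exact: CT_cst|exact: CT_snd].
have s2 : smG (fun w : R^o * R^o => Psi (w.1, t)) w.
  apply: (@sm_precomp _ _ _ _ _ _ _ _ _ Psi (fun w : R^o * R^o => (w.1, t))) => // n.
  by apply: CT_pair; [exact: CT_fst|exact: CT_cst].
by repeat (apply: sm_mul || apply: sm_inv) => //; exact: smooth_at_cst.
Qed.

Let Bt r t r' : B r t (r', t) = one. Proof. by rewrite /B /= mulgV. Qed.
Let Br r t t' : B r t (r, t') = one. Proof. by rewrite /B /= !mulgV. Qed.

(** Exact, without remainder: [Psi (r + h, tau) = K tau Psi (r, tau)], and [mu_rvel_mul] splits off
    [a (r, t)]. The limit then concerns only the vector argument of [mu] along a convergent
    orbit. *)
Let a_incr r t h : a (r + h, t) - a (r, t) = mu (mderiv (B r t) (r + h, t) (0, 1)) (C (r + h, t)).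
Proof.
pose K (tau : R^o) : G := Psi (r + h, tau) ** (Psi (r, tau))^I.
have sp r' : forall t, smG (fun t : R^o => Psi (r', t)) t.
  by move=> t'; exact: (@sm_precomp _ _ _ _ _ _ _ _ _ Psi _ _ (CT_t r')).
have sK : smG K t by apply: sm_mul; [exact: sp|apply: sm_inv; exact: sp].
have r1 r' : rvel Psi (r', t) (0, 1) = rvel (fun tau : R^o => Psi (r', tau)) t 1.
  by rewrite (rvel_precomp _ (@dq_t r' t)).
have e : (fun tau => K tau ** Psi (r, tau)) = (fun tau : R^o => Psi (r + h, tau)).
  by apply/funext => tau; rewrite /K mulgVK.
have := @mu_rvel_mul _ _ K (fun tau => Psi (r, tau)) t 1 (C (r, t)) sK (sp r t).
rewrite e -r1 -r1 -/(a (r, t)) -actM mulgVK -/(C (r + h, t)) -/(a (r + h, t)) => ->.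
rewrite addrK; congr (mu _ _).
by rewrite -(@mderiv_precomp _ _ _ G _ _ _ _ (B r t) _ _ _ _ (sm_B _ _ _) (@dq_t (r + h) t)).
Qed.

(** By [a_incr] the quotient is [mu] of a difference quotient of [ddiff m _ (0, 1)], with [m] the
    map [B r t] in the chart at [one]. [mu_cvg] passes to the limit and [Schwarz] turns the mixed
    derivative of [m] into [W]. *)
Lemma a_deriv r t : diff_quot (fun r : R^o => a (r, t) : R^o) r 1 h @[h --> (0 : R)^'] --> (mu (W (r, t)) (C (r, t)) : R^o).
Proof.
set c := chart_at one; have cz : chart_dom c one := chart_at_dom _.
have cA : atlas c := chart_at_atlas _.
have cB : chart_dom c (B r t (r, t)) by rewrite Bt.
have [ O [ oO Oz Od kO]] := smooth_at_vecE (sm_B r t (r, t)) cA cB.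
pose m := chart_to c \o B r t.
have mE w v : B r t w = one -> mderiv (B r t) w v = ddiff m w v by move=> Bw; rewrite /mderiv Bw.
(* [B r t] is constant on the line of first coordinate [r], so the increment of this derivative is
   its value at [(r + h, t)]. *)
have m0 : ddiff m (r, t) (0, 1) = 0.
  rewrite -mE ?Bt// -(@mderiv_precomp _ _ _ G _ _ _ _ (B r t) _ _ _ _ (sm_B _ _ _) (@dq_t r t)).
  rewrite (near_mderiv (g := fun=> one)) ?mderiv_cst//.
  by near=> w; exact: Br.
have k1 v : Ck 1 O (fun w => ddiff m w v) by exact: Ck_ddiff_dir.
have dk v u : ddifferentiable (fun w => ddiff m w v) (r, t) u by have [_ + _] := k1 v; apply.
(* The factor of [B] frozen at [t] subtracts a vector independent of [tau], which disappears on
   differentiating in [tau]. *)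
have dtau tau : ddiff m (r, tau) (1, 0) = rvel Psi (r, tau) (1, 0) - rvel Psi (r, t) (1, 0).
  rewrite -mE ?Br// -(@mderiv_precomp _ _ _ G _ _ _ _ (B r t) _ _ _ _ (sm_B _ _ _) (@dq_r r tau)).
  have sq s : smG (fun r' : R^o => Psi (r', s) ** (Psi (r, s))^I) r.
    apply: sm_mul; last exact: smooth_at_cst.
    exact: (@sm_precomp _ _ _ _ _ _ _ _ _ Psi _ _ (CT_r s)).
  rewrite /B /= mderiv_quot ?mulgV//.
  by rewrite -!(rvel_precomp _ (@dq_r r _)).
have WE : ddiff (fun w => ddiff m w (0, 1)) (r, t) (1, 0) = W (r, t).
  rewrite (@Schwarz R (R^o * R^o)%type E _ _ O m (r, t) (1, 0) (0, 1) oO (kO 2%N) Oz).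
  symmetry; apply: ddiffE; apply: near_cvg (ddiffP (dk (1, 0) (0, 1))).
  near=> h; rewrite /diff_quot; congr (_ *: _).
  have -> : (r, t) + h *: ((0, 1) : (R^o * R^o)%type) = (r, t + h) :> (R^o * R^o)%type.
    by congr pair; rewrite /= ?[_ *: _]mulr0 ?[_ *: _]mulr1 ?addr0.
  by rewrite !dtau subrr subr0.
have gc : (fun h => Psi (r + h, t)) @ (0 : R)^' --> Psi (r, t).
  apply: (@cvg_comp_at _ _ _ _ (fun h : R => (r + h, t)) Psi (r, t)); last exact: smooth_at_continuous.
  have := @line_cvg R (R^o * R^o)%type (r, t) (1, 0); apply: near_cvg; near=> h.
  by congr pair; rewrite /= ?[_ *: _]mulr0 ?[_ *: _]mulr1 ?addr0.
have vc : (fun h => diff_quot (fun w => ddiff m w (0, 1)) (r, t) (1, 0) h) @ (0 : R)^' --> W (r, t).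
  by rewrite -WE; exact: ddiffP.
have mc : (fun h => mu (diff_quot (fun w => ddiff m w (0, 1)) (r, t) (1, 0) h) (act (Psi (r + h, t)) x) : R^o) @ (0 : R)^' -->
    (mu (W (r, t)) (C (r, t)) : R^o) by exact: mu_cvg.
apply: near_cvg mc; near=> h.
rewrite /diff_quot [h *: (1 : R^o)]mulr1 a_incr m0 subr0 muZ.
have -> : (r, t) + h *: ((1, 0) : (R^o * R^o)%type) = (r + h, t) :> (R^o * R^o)%type.
  by congr pair; rewrite /= ?[_ *: _]mulr0 ?[_ *: _]mulr1 ?addr0.
by rewrite -mE ?Bt.
Unshelve. all: by end_near. Qed.

(** The increment of [b] is [mu] of the increment of the vector, at the new point, plus the
    increment along [C] of [mu V0] with [V0] frozen. The second part gives [- om (C_r, C_t)] by the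
    moment map equation. *)
Lemma b_deriv r t : diff_quot (fun t : R^o => b (r, t) : R^o) t 1 h @[h --> (0 : R)^'] -->
  (mu (W (r, t)) (C (r, t)) - pullback2 om C (r, t) : R^o).
Proof.
pose V0 := rvel Psi (r, t) (1, 0).
have gc : (fun h => Psi (r, t + h)) @ (0 : R)^' --> Psi (r, t).
  apply: (@cvg_comp_at _ _ _ _ (fun h : R => (r, t + h)) Psi (r, t)); last exact: smooth_at_continuous.
  have := @line_cvg R (R^o * R^o)%type (r, t) (0, 1); apply: near_cvg; near=> h.
  by congr pair; rewrite /= ?[_ *: _]mulr0 ?[_ *: _]mulr1 ?addr0.
have vc : (fun h => diff_quot (fun w => rvel Psi w (1, 0)) (r, t) (0, 1) h) @ (0 : R)^' --> W (r, t).
  by apply: ddiffP; have [_ + _] := CT_rvel (1, 0) 1; apply.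
have [d2 e2] := @differential_comp _ _ _ X _ _ C (mu V0) (r, t) (0, 1) (sm_C _) (mu_sm _ _).
have pE : - pullback2 om C (r, t) = ddiff (mu V0 \o C : R^o * R^o -> R^o) (r, t) (0, 1).
  by rewrite e2 /pullback2 (moment_dir _ _ _ _ sPsi) opprK.
rewrite pE.
have : (fun h => mu (diff_quot (fun w => rvel Psi w (1, 0)) (r, t) (0, 1) h) (act (Psi (r, t + h)) x) +
    diff_quot (mu V0 \o C : R^o * R^o -> R^o) (r, t) (0, 1) h : R^o) @ (0 : R)^' -->
    (mu (W (r, t)) (C (r, t)) + ddiff (mu V0 \o C : R^o * R^o -> R^o) (r, t) (0, 1) : R^o).
  apply: tvs_cvgD; last exact: ddiffP.
  exact: mu_cvg.
apply: near_cvg; near=> h.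
rewrite /diff_quot [h *: (1 : R^o)]mulr1 muZ.
have -> : (r, t) + h *: ((0, 1) : (R^o * R^o)%type) = (r, t + h) :> (R^o * R^o)%type.
  by congr pair; rewrite /= ?[_ *: _]mulr0 ?[_ *: _]mulr1 ?addr0.
rewrite muB -/V0 /= -/(C (r, t + h)) -/(b (r, t + h)) -[b (r, t)]/(mu V0 (C (r, t))).
rewrite -[LHS]mulrDr; congr (_ * _); ring.
Unshelve. all: by end_near. Qed.

(** [om (C_r, C_t)] is the [r]-derivative [M] of [a] minus the [t]-derivative [M - om (C_r, C_t)] of
    [b]. The first integrates to boundary values of [a]; after Fubini the second integrates to 0,
    since [b] is 1-periodic in [t]. *)
Lemma J_orbit (p q : R -> G) : tube Psi p q -> J om C = mu_integral q x - mu_integral p x.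
Proof.
move=> [_ per P0 P1].
pose M z := mu (W z) (C z).
have cM : continuous (M : R * R -> R).
  apply: (@mu_rvel_continuous (R^o * R^o)%type (R^o * R^o)%type) => //; exact: W_continuous.
have cp : continuous (pullback2 om C : R * R -> R) by apply: pullback2_continuous => // z; exact: sm_C.
have cN : continuous ((fun z => M z - pullback2 om C z) : R * R -> R).
  by move=> z; apply: cvgB; [exact: cM|exact: cp].
have iM t : rint 0 1 (fun r => M (r, t)) = a (1, t) - a (0, t).
  apply: (@int_FTC R _ (fun r => a (r, t))) => //; first exact: (section_r (t := t) cM).
  by move=> r _; apply: diff_quot_is_derive; exact: a_deriv.
have iN r : rint 0 1 (fun t => M (r, t) - pullback2 om C (r, t)) = 0.
  transitivity (b (r, 1) - b (r, 0)).
  - apply: (@int_FTC R _ (fun t => b (r, t))) => //; first exact: (section_t (r := r) cN).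
    by move=> t _; apply: diff_quot_is_derive; exact: b_deriv.
  - have per' w : Psi (w.1, w.2 + 1) = Psi w by rewrite per -surjective_pairing.
    have P10 : Psi (r, 1) = Psi (r, 0) by rewrite -[X in Psi (r, X)](add0r 1) per.
    suff rv10 : rvel Psi (r, 1) (1, 0) = rvel Psi (r, 0) (1, 0) by rewrite /b /C rv10 P10 subrr.
    transitivity (rvel (fun w : R^o * R^o => Psi (w.1, w.2 + 1)) (r, 0) (1, 0)); last first.
      exact: (f_equal (fun P => rvel P (r, 0) (1, 0)) (funext per')).
    rewrite (@rvel_precomp _ _ _ _ Psi (fun w : R^o * R^o => (w.1, w.2 + 1)) (r, 0) (1, 0) (1, 0))/= ?add0r//.
    apply: diff_quot_pair; first by apply: (@linear_diff_quot R (R^o * R^o)%type R^o fst); exact: tvs_linear_fst.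
    apply: near_cst_cvg; near=> h.
    by rewrite /diff_quot /= [h *: _]mulr0 addr0 subrr scaler0.
have -> : J om C = rint 0 1 (fun t => a (1, t) - a (0, t)).
  transitivity (rint 0 1 (fun t => rint 0 1 (fun r => M (r, t)) - rint 0 1 (fun r => M (r, t) - pullback2 om C (r, t)))).
    congr (rint _ _ _); apply/funext => t; rewrite -intB.
    - by congr (rint _ _ _); apply/funext => r; ring.
    - exact: (section_r (t := t) cM).
    - exact: (section_r (t := t) cN).
  rewrite intB; last first.
  - exact: (@int_param_continuous R _ 0 1 ler01 cN).
  - exact: (@int_param_continuous R _ 0 1 ler01 cM).
  rewrite (int_fubini 0 1 0 1 cN).
  under [X in _ - rint _ _ X]eq_fun do rewrite iN.
  rewrite rint0 subr0.
  by congr (rint _ _ _); apply/funext => t; exact: iM.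
have aE r (g : R -> G) : (forall t, Psi (r, t) = g t) -> (fun t => a (r, t)) = (fun t => mu (rvel (g : R^o -> G) t 1) (act (g t) x)).
  move=> gE; apply/funext => t; rewrite /a /C gE; congr (mu _ _).
  rewrite -(rvel_precomp _ (@dq_t r t))//; congr (rvel _ _ _); exact/funext.
have ca r : continuous (fun t => a (r, t) : R).
  rewrite (aE r (fun t => Psi (r, t)))//; apply: mu_integrand_continuous => t.
  exact: (@sm_precomp _ _ _ _ _ _ _ _ _ Psi _ _ (CT_t r)).
by rewrite intB// (aE 1 _ P1) (aE 0 _ P0).
Unshelve. all: by end_near. Qed.

End Stokes.
End MomentMap.

(** * Smoothing of homotopies *)

Section Chains.
Context {R : realType}.

Lemma near_snd (S T : topologicalType) (z : S * T) (U : set T) : open U -> U z.2 -> \forall w \near z, U w.2.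
Proof. by move=> oU Uz; apply: (@cvg_snd _ _ (nbhs z.1) (nbhs z.2)); exact: open_nbhs_nbhs. Qed.

Lemma near_fst (S T : topologicalType) (z : S * T) (U : set S) : open U -> U z.1 -> \forall w \near z, U w.1.
Proof. by move=> oU Uz; apply: (@cvg_fst _ _ (nbhs z.1) (nbhs z.2)); exact: open_nbhs_nbhs. Qed.

Lemma open_oo (a b : R) : open [set x : R^o | a < x < b].
Proof.
have := @interval_open R (BRight a) (BLeft b) isT isT.
by rewrite (_ : [set` _] = [set x : R^o | a < x < b])//; apply/seteqP; split => x /=; rewrite in_itv.
Qed.

Lemma near_snd_oo (S : topologicalType) (z : S * R^o) (a b : R) : a < z.2 < b -> \forall w \near z, a < w.2 < b.
Proof. by move=> ab; have H := @near_snd S R^o z [set x : R^o | a < x < b] (@open_oo a b) ab; apply: filterS H. Qed.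

(** [lam] of the fractional part is constant near every integer, so consecutive pieces only have to
    match in value at their common end; near an integer the map does not depend on its last
    coordinate. *)
Lemma smooth_chain (V F : tvsType R) {hV : hausT V} {hF : hausT F} (N : topologicalType) (B : set (chart N F))
    (k : int -> V * R^o -> N) :
  (forall n z, smooth_at (@vec_atlas R _) B (k n) z) ->
  (forall n v, k n (v, 1) = k (n + 1) (v, 0)) ->
  forall z, smooth_at (@vec_atlas R _) B
    (fun z : V * R^o => k (Num.floor (z.2 : R)) (z.1, lam (z.2 - (Num.floor (z.2 : R))%:~R))) z.
Proof.
move=> sk km z; set n := Num.floor (z.2 : R).
have /andP[z1 z2] := floor_itv (z.2 : R); rewrite -/n intrD in z1 z2.
(* In the first third a neighbourhood may reach into the last third of the previous piece; both
   pieces are constant in the last variable there. *)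
have [t3|t3] := ltP (z.2 - n%:~R) 3^-1.
  apply: (@near_smooth_at _ _ _ _ _ _ _ _ (fun z : V * R^o => k n (z.1, 0))); last first.
    apply: (@sm_precomp _ _ _ _ _ _ _ _ _ (k n) (fun z : V * R^o => (z.1, 0))) => // m; ckt.
  have : \forall w \near z, n%:~R - 3^-1 < w.2 < n%:~R + 3^-1.
    by apply: near_snd_oo; apply/andP; split; lra.
  apply: filterS => w /andP[w1 w2].
  have [wn|wn] := leP n%:~R w.2.
    have -> : Num.floor w.2 = n by apply: floor_def; rewrite intrD wn /=; lra.
    by rewrite lam0//; lra.
  have -> : Num.floor w.2 = n - 1.
    by apply: floor_def; rewrite subrK wn andbT intrB; lra.
  by rewrite lam1 ?km ?subrK// intrB; lra.
apply: (@near_smooth_at _ _ _ _ _ _ _ _ (fun z : V * R^o => k n (z.1, lam (z.2 - n%:~R)))); last first.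
  apply: (@sm_precomp _ _ _ _ _ _ _ _ _ (k n) (fun z : V * R^o => (z.1, lam (z.2 - n%:~R)))) => // m; ckt.
have : \forall w \near z, n%:~R < w.2 < n%:~R + 1.
  by apply: near_snd_oo; apply/andP; split; lra.
apply: filterS => w /andP[w1 w2].
by have -> : Num.floor w.2 = n by apply: floor_def; rewrite intrD ltW.
Qed.

Lemma continuous_chain (M : topologicalType) (k : int -> R * R -> M) :
  (forall n, continuous (k n)) -> (forall n s, k n (s, 1) = k (n + 1) (s, 0)) ->
  continuous (fun z : R * R => k (Num.floor z.2) (z.1, z.2 - (Num.floor z.2)%:~R)).
Proof.
move=> ck km z; set n := Num.floor z.2.
have /andP[z1 z2] := floor_itv z.2; rewrite -/n intrD in z1 z2.
have cs m : continuous (fun z : R * R => k m (z.1, z.2 - m%:~R)).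
  move=> w; apply: (@cvg_comp_at _ _ _ _ (fun z : R * R => (z.1, z.2 - m%:~R)) (k m)); last exact: ck.
  by apply: cvg_pairT; [exact: cvg_fst|apply: cvgB; [exact: cvg_snd|exact: cvg_cst]].
have [zn|zn] := eqVneq z.2 n%:~R; last first.
  apply: (near_cvg _ (cs n z)).
  have : \forall w \near z, n%:~R < w.2 < n%:~R + 1.
    by apply: near_snd_oo; rewrite /= z2 andbT lt_neqAle eq_sym zn.
  apply: filterS => w /andP[w1 w2].
  by have -> : Num.floor w.2 = n by apply: floor_def; rewrite intrD ltW.
move=> A An.
have A1 : \forall w \near z, A (k n (w.1, w.2 - n%:~R)) by exact: (cs n z).
have A2 : \forall w \near z, A (k (n - 1) (w.1, w.2 - (n - 1)%:~R)).
  apply: (cs (n - 1) z); rewrite intrB zn opprB addrCA subrr addr0 km subrK.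
  by rewrite -(subrr (n%:~R : R)) -{1}zn.
have A3 : \forall w \near z, n%:~R - 1 < w.2 < n%:~R + 1.
  by apply: near_snd_oo; apply/andP; split; lra.
apply: filterS3 A1 A2 A3 => w A1 A2 /andP[w1 w2].
have [wn|wn] := leP n%:~R w.2.
  by rewrite /=; have -> : Num.floor w.2 = n by apply: floor_def; rewrite intrD wn.
rewrite /=; have -> : Num.floor w.2 = n - 1 by apply: floor_def; rewrite subrK wn andbT intrB ltW.
exact: A2.
Qed.

End Chains.

(** * Convex chart neighbourhoods and the filling of squares *)

Section Balls.
Context {R : realType}.
Context (E : tvsType R) {hE : hausT E} (M : manifold E).
Notation aM := (@atlas R E M).
Notation sm f z := (smooth_at (@vec_atlas R _) aM f z).
Implicit Types b : chart M E * set E.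

(** Intended for the pairs of [convex_chart]: the second component is a convex open part of the
    chart's image, in which coordinates may be averaged without leaving the chart. *)
Definition cball b : set M := [set y | chart_dom b.1 y /\ b.2 (chart_to b.1 y)].

Definition convex_chart b := [/\ aM b.1, open b.2, convexs b.2 & b.2 `<=` chart_cod b.1].

Lemma cball_open b : convex_chart b -> open (cball b).
Proof.
case=> _ oK _ _; rewrite openE => y [yd yK]; apply: filterI.
  exact: open_nbhs_nbhs (conj (chart_dom_open _) yd).
by apply: (chart_to_continuous yd); exact: open_nbhs_nbhs.
Qed.

Lemma cball_ex (U : set M) x : open U -> U x ->
  exists b, [/\ convex_chart b, cball b x & cball b `<=` U].
Proof.
move=> oU Ux; set c := chart_at x; have cx : chart_dom c x := chart_at_dom x.
have yc := chart_to_cod cx.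
have : nbhs (chart_to c x) (chart_cod c `&` chart_from c @^-1` U).
  by apply: open_nbhs_nbhs; split; [exact: open_chart_pre|split => //=; rewrite chart_toK].
move=> /locally_convexs[K [oK cK Kx KU]]; exists (c, K); split => //.
- by split => //; [exact: chart_at_atlas|move=> y /KU[]].
- by move=> y [/= yd /KU[_ /=]]; rewrite chart_toK.
Qed.

Lemma cball_from b y : convex_chart b -> b.2 y ->
  cball b (chart_from b.1 y) /\ chart_to b.1 (chart_from b.1 y) = y.
Proof.
case=> _ _ _ Kc Ky; have yc := Kc _ Ky.
by rewrite chart_fromK//; split => //; split; [exact: chart_from_dom|rewrite chart_fromK].
Qed.

Lemma cball_sm_from V {hV : hausT V} b (g : V -> E) z : convex_chart b ->
  (forall n, Ck n setT g) -> b.2 (g z) -> sm (fun w => chart_from b.1 (g w)) z.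
Proof.
move=> [bA oK _ Kc] cg bz; apply: (@sm_precomp _ _ _ _ _ _ _ _ _ (chart_from b.1) g) => //.
by apply: smooth_at_chart_from => //; exact: Kc.
Qed.

Lemma cball_to_Ck V {hV : hausT V} b (f : V -> M) : convex_chart b ->
  (forall z, sm f z) -> (forall z, cball b (f z)) -> forall n, Ck n setT (fun z => chart_to b.1 (f z)).
Proof.
move=> [bA _ _ _] sf bf n; apply: Ck_pointwise => z _.
have : smooth_at (@vec_atlas R V) (@vec_atlas R E) (fun z => chart_to b.1 (f z)) z.
  apply: (@smooth_at_comp _ _ _ _ _ _ _ _ _ _ _ aM _ f (chart_to b.1)) => //; first exact: covers_atlas.
  by apply: smooth_at_chart_to => //; exact: (bf z).1.
by move=> /smooth_at_vecP[ O [ oO Oz kO]]; exists O.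
Qed.

Definition joined (U : set M) (x y : M) := exists g : R^o -> M,
  [/\ forall t, sm g t, g 0 = x, g 1 = y & forall t, U (g t)].

(** The two paths are concatenated as tubes independent of [t], so that [tube_catP] provides the
    smoothness. *)
Lemma joined_trans U x y z : joined U x y -> joined U y z -> joined U x z.
Proof.
move=> [g [sg g0 g1 gU]] [h [sh h0 h1 hU]].
have tg : tube (fun z : R^o * R^o => g z.1) (fun=> g 0) (fun=> h 0) by rewrite h0 -g1; exact: tube_path.
have th : tube (fun z : R^o * R^o => h z.1) (fun=> h 0) (fun=> h 1) by exact: tube_path.
have [sc _ c0 c1] : tube (tube_cat (fun z : R^o * R^o => g z.1) (fun z : R^o * R^o => h z.1)) (fun=> g 0) (fun=> h 1) by exact: (tube_catP tg th).
exists (fun r => tube_cat (fun z => g z.1) (fun z => h z.1) (r, 0)); split.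
- move=> t; apply: (@sm_precomp _ _ _ _ _ _ _ _ _ _ (fun r : R^o => (r, 0) : (R^o * R^o)%type)) => // n; ckt.
- by rewrite c0.
- by rewrite c1.
- by move=> t; rewrite /tube_cat; case: ifP.
Qed.

Lemma joined_cball b x y : convex_chart b -> cball b x -> cball b y -> joined (cball b) x y.
Proof.
move=> bc [xd xK] [yd yK].
pose g (t : R^o) := (1 - lam t) *: chart_to b.1 x + lam t *: chart_to b.1 y.
have gK t : b.2 (g t) by case: (bc) => _ _ cK _; apply: cK => //; rewrite lam_ge0 lam_le1.
exists (fun t => chart_from b.1 (g t)); split.
- by move=> t; apply: cball_sm_from => // n; rewrite /g; ckt; exact: Ck_lam.
- by rewrite /g lam0 ?subr0 ?scale1r ?scale0r ?addr0 ?chart_toK//; lra.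
- by rewrite /g lam1 ?subrr ?scale1r ?scale0r ?add0r ?chart_toK//; lra.
- by move=> t; exact: (cball_from bc (gK t)).1.
Qed.

Lemma joined_sub U V x y : U `<=` V -> joined U x y -> joined V x y.
Proof. by move=> UV [g [? ? ? gU]]; exists g; split => // t; exact: UV. Qed.

(** All points of a convex chart ball can be joined inside it, so both the points of [U] joined to
    [x] and the other points of [U] form open sets. A connected [C] inside [U] cannot meet both. *)
Lemma connected_joined (U C : set M) x y : open U -> connected C -> C `<=` U -> C x -> C y -> joined U x y.
Proof.
move=> oU cC CU Cx Cy.
suff : C `&` [set z | U z /\ joined U x z] = C by move/seteqP => [_ /(_ _ Cy)[_ []]].
apply: cC.
- exists x; split => //; split; first exact: CU.
  exists (fun=> x); split => // t; [exact: smooth_at_cst|exact: CU].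
- exists [set z | U z /\ joined U x z] => //.
  rewrite openE => z [Uz jz]; have [b [bc bz bU]] := cball_ex oU Uz.
  apply: filterS (open_nbhs_nbhs (conj (cball_open bc) bz)) => w bw; split; first exact: bU.
  by apply: joined_trans jz _; apply: (joined_sub bU); exact: joined_cball.
- exists (~` [set z | U z /\ ~ joined U x z]).
    apply: open_closedC; rewrite openE => z [Uz jz]; have [b [bc bz bU]] := cball_ex oU Uz.
    apply: filterS (open_nbhs_nbhs (conj (cball_open bc) bz)) => w bw; split; first exact: bU.
    move=> jw; apply: jz; apply: joined_trans jw _.
    by apply: (joined_sub bU); exact: joined_cball.
  apply/seteqP; split => z [Cz H]; split => //.
    by move=> [_]; apply; case: H.
  by split; [exact: CU|apply: contrapT => nj; apply: H; split => //; exact: CU].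
Qed.

Lemma convexs_cball b (u v : E) (t : R) : convex_chart b -> b.2 u -> b.2 v -> 0 <= t <= 1 ->
  b.2 ((1 - t) *: u + t *: v).
Proof. by case=> _ _ cK _; exact: cK. Qed.

(* The weights lam (3 s) - lam (3 s - 2), 1 - lam (3 s) and lam (3 s - 2) sum to
   1; the last two live near s = 0 and s = 1, where bo (lam s) and
   tp (lam s) are constant. *)
Lemma fill_square b (le ri bo tp : R^o -> M) : convex_chart b ->
  (forall t, sm le t) -> (forall t, sm ri t) -> (forall t, sm bo t) -> (forall t, sm tp t) ->
  (forall t, cball b (le t)) -> (forall t, cball b (ri t)) ->
  (forall t, cball b (bo t)) -> (forall t, cball b (tp t)) ->
  le 0 = bo 0 -> le 1 = tp 0 -> ri 0 = bo 1 -> ri 1 = tp 1 ->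
  exists c : R^o * R^o -> M, [/\ forall z, sm c z,
    (forall t, c (0, t) = le (lam t)) , (forall t, c (1, t) = ri (lam t)) &
    (forall s, c (s, 0) = bo (lam s)) /\ (forall s, c (s, 1) = tp (lam s))].
Proof.
move=> bc sl sr sb st bl br bb bt l0 l1 r0 r1.
pose e (f : R^o -> M) (t : R^o) := chart_to b.1 (f (lam t)).
have eC V (hV : hausT V) f (k : V -> R^o) n : (forall t, sm f t) -> (forall t, cball b (f t)) ->
    (forall n, Ck n setT k) -> Ck n setT (fun z => e f (k z)).
  move=> sf bf ck; apply: (@cball_to_Ck _ _ b (fun z => f (lam (k z)))) => // z.
  by apply: (@sm_precomp _ _ _ _ _ _ _ _ _ f (fun z => lam (k z))) => // m; apply: CT_lam.
have eK f t : (forall t, cball b (f t)) -> b.2 (e f t) by move=> bf; case: (bf (lam t)).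
have from_e f t : (forall t, cball b (f t)) -> chart_from b.1 (e f t) = f (lam t).
  by move=> bf; rewrite chart_toK//; case: (bf (lam t)).
pose B (z : R^o * R^o) := (1 - lam z.2) *: e bo z.1 + lam z.2 *: e tp z.1.
have BK z : b.2 (B z) by apply: convexs_cball => //; [exact: eK|exact: eK|rewrite lam_ge0 lam_le1].
pose g (z : R^o * R^o) := (lam (3 * z.1) - lam (3 * z.1 - 2)) *: B z
  + ((1 - lam (3 * z.1)) *: e le z.2 + lam (3 * z.1 - 2) *: e ri z.2).
have gl z : z.1 <= 2^-1 -> g z = (1 - lam (3 * z.1)) *: e le z.2 + lam (3 * z.1) *: B z.
  by move=> z1; rewrite /g (@lam0 _ (3 * z.1 - 2)) ?subr0 ?scale0r ?addr0 1?addrC//; lra.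
have gr z : 2^-1 <= z.1 -> g z = (1 - lam (3 * z.1 - 2)) *: B z + lam (3 * z.1 - 2) *: e ri z.2.
  by move=> z1; rewrite /g (@lam1 _ (3 * z.1)) ?subrr ?scale0r ?add0r//; lra.
have gK z : b.2 (g z).
  have [z1|/ltW z1] := leP z.1 2^-1; [rewrite gl//|rewrite gr//];
  by apply: convexs_cball => //; rewrite ?lam_ge0 ?lam_le1//; exact: eK.
have cf : forall n, Ck n setT (fun z : R^o * R^o => z.1) by move=> n; ckt.
have cs : forall n, Ck n setT (fun z : R^o * R^o => z.2) by move=> n; ckt.
exists (fun z => chart_from b.1 (g z)); split.
- move=> z; apply: cball_sm_from => // n; rewrite /g /B.
  by ckt; apply: eC.
- move=> t; rewrite gl ?invr_ge0//= mulr0 lam0 ?subr0 ?scale1r ?scale0r ?addr0 ?invr_ge0//.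
  exact: from_e.
- move=> t; rewrite gr ?invf_le1 ?ler1n//= mulr1 lam1 ?subrr ?scale1r ?scale0r ?add0r; last by lra.
  exact: from_e.
- have ends s (f : R^o -> M) t : (forall t, cball b (f t)) -> B (s, t) = e f s ->
      e le t = chart_to b.1 (f 0) -> e ri t = chart_to b.1 (f 1) -> g (s, t) = e f s.
    move=> bf Bf el er.
    have [s1|s1] := leP s 2^-1.
      rewrite gl// Bf el /=; have [s3|s3] := leP s 3^-1.
        by rewrite /e (lam0 s3) -scalerDl subrK scale1r.
      by rewrite lam1 ?subrr ?scale0r ?add0r ?scale1r//; lra.
    rewrite gr ?ltW// Bf er /=; have [s3|s3] := leP s (2 / 3).
      by rewrite lam0 ?subr0 ?scale0r ?addr0 ?scale1r//; lra.
    by rewrite /e (lam1 (ltW s3)) -scalerDl subrK scale1r.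
  have L0 : lam 0 = 0 :> R by rewrite lam0 ?invr_ge0.
  have L1 : lam 1 = 1 :> R by rewrite lam1//; lra.
  split => s.
    rewrite (ends s bo 0 bb) ?from_e//.
    - by rewrite /B /= L0 subr0 scale0r addr0 scale1r.
    - by rewrite /e L0 l0.
    - by rewrite /e L0 r0.
  rewrite (ends s tp 1 bt) ?from_e//.
  - by rewrite /B /= L1 subrr scale0r add0r scale1r.
  - by rewrite /e L1 l1.
  - by rewrite /e L1 r1.
Qed.

End Balls.

(** * Periodic extension of a homotopy to the plane *)

Section Extension.
Context {R : realType}.

Lemma floorDint (t : R) (n : int) : Num.floor (t + n%:~R) = Num.floor t + n.
Proof.
apply: floor_def; have /andP[t1 t2] := floor_itv t.
by rewrite addrAC !(intrD _ _ n) lerD2r ltrD2r t1.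
Qed.

Lemma periodic_int (S : Type) (f : R -> S) (T : R) : (forall t, f (t + T) = f t) ->
  forall (k : int) t, f (t + k%:~R * T) = f t.
Proof.
move=> fT; have fn (n : nat) t : f (t + n%:R * T) = f t.
  by elim: n t => [|n IH] t; rewrite ?mul0r ?addr0// -natr1 mulrDl mul1r addrA fT.
case=> n t; first exact: fn.
by rewrite NegzE mulrNz mulNr -(fn n.+1 (t - _)) subrK.
Qed.

Lemma periodic_mod (S : Type) (f : R -> S) (N : nat) (j : int) t : (forall t, f (t + N%:R) = f t) ->
  f ((j %% N%:Z)%Z%:~R + t) = f (j%:~R + t).
Proof.
move=> fN; have e : j%:~R = (j %/ N%:Z)%Z%:~R * N%:R + (j %% N%:Z)%Z%:~R :> R.
  by rewrite {1}(divz_eq j N%:Z) intrD; congr (_ + _); exact: (intrM R).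
by rewrite e -addrA addrC (periodic_int fN).
Qed.

Definition clamp (t : R) : R := Num.max 0 (Num.min t 1).

Lemma clamp_itv t : 0 <= clamp t <= 1.
Proof. by rewrite /clamp le_max lexx ge_max ler01 ge_min lexx orbT. Qed.

Lemma clamp_id t : 0 <= t <= 1 -> clamp t = t.
Proof. by move=> /andP[t0 t1]; rewrite /clamp min_l// max_r. Qed.

Lemma clamp0 t : t <= 0 -> clamp t = 0.
Proof. by move=> t0; rewrite /clamp max_l// ge_min t0. Qed.

Lemma clamp1 t : 1 <= t -> clamp t = 1.
Proof. by move=> t1; rewrite /clamp min_r// max_r. Qed.

Lemma clamp_dist s t : `|clamp s - clamp t| <= `|s - t|.
Proof.
have H a b : a <= b -> 0 <= clamp b - clamp a <= b - a.
  move=> ab; rewrite /clamp.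
  have [a1|a1] := leP a 1; have [b1|b1] := leP b 1; rewrite ?(max_r ler01);
  have [a0|a0] := leP a 0; have [b0|b0] := leP b 0; rewrite ?(max_r ler01); lra.
have [st|/ltW st] := leP s t.
  by have /andP[? ?] := H _ _ st; rewrite distrC (distrC s) !ger0_norm// subr_ge0.
by have /andP[? ?] := H _ _ st; rewrite !ger0_norm// subr_ge0.
Qed.

Lemma clamp_continuous : continuous clamp.
Proof.
move=> t; apply/cvgrPdist_lt => e e0; near=> s.
apply: le_lt_trans (clamp_dist _ _) _; near: s.
by apply: cvgr_dist_lt => //; exact: cvg_id.
Unshelve. all: by end_near. Qed.

Lemma within_comp_continuous (S T U : topologicalType) (A : set T) (f : T -> U) (g : S -> T) :
  {within A, continuous f} -> continuous g -> (forall x, A (g x)) -> continuous (fun x => f (g x)).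
Proof.
move=> /subspace_continuousP cf cg gA x B fB.
have := cf _ (gA x) _ fB; rewrite nbhs_simpl /= => /cg; rewrite /= !nbhs_simpl /=.
by apply: filterS => y; apply; exact: gA.
Qed.

(** Clamped in [s] and repeated in [t]: the condition on two opposite sides of the square makes the
    translates match, so that [continuous_chain] applies. *)
Lemma periodic_extension (M : topologicalType) (H : R * R -> M) :
  {within `[0%R, 1%R] `*` `[0%R, 1%R], continuous H} ->
  (forall s, 0 <= s <= 1 -> H (s, 0) = H (s, 1)) ->
  exists K : R * R -> M, [/\ continuous K, forall s t, K (s, t + 1) = K (s, t),
    forall s t, K (s, t) = K (clamp s, t) &
    forall s t, 0 <= s <= 1 -> 0 <= t <= 1 -> K (s, t) = H (s, t)].
Proof.
move=> cH H01.
pose k (n : int) (z : R * R) := H (clamp z.1, clamp z.2).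
have ck n : continuous (k n).
  apply: (within_comp_continuous cH) => [z|z]; last by split => /=; rewrite in_itv/= clamp_itv.
  by apply: cvg_pairT; apply: (@cvg_comp_at _ _ _ _ _ clamp); [exact: cvg_fst|exact: clamp_continuous|exact: cvg_snd|exact: clamp_continuous].
have c1 : clamp 1 = 1 by rewrite clamp1. have c0 : clamp 0 = 0 by rewrite clamp0.
have km n s : k n (s, 1) = k (n + 1) (s, 0) by rewrite /k /= c0 c1 H01// clamp_itv.
exists (fun z : R * R => k (Num.floor z.2) (z.1, z.2 - (Num.floor z.2)%:~R)); split.
- exact: continuous_chain.
- by move=> s t /=; rewrite -[t + 1]/(t + 1%:~R) floorDint intrD opprD addrACA subrr addr0.
- by move=> s t; rewrite /k /= [clamp (clamp s)]clamp_id// clamp_itv.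
- move=> s t s01 /andP[t0 t1]; rewrite /k /= (clamp_id s01).
  move: t1; rewrite le_eqVlt => /orP[/eqP->|t1].
    have -> : Num.floor (1 : R) = 1 by apply: floor_def; rewrite lexx /= ltr1n.
    by rewrite subrr c0 H01.
  have -> : Num.floor t = 0 by apply: floor_def; rewrite t0.
  by rewrite subr0 clamp_id// t0 ltW.
Qed.

End Extension.

(** * Smoothing of a homotopy over a grid *)

Section Grid.
Context {R : realType}.
Context (E : tvsType R) {hE : hausT E} (M : manifold E).
Notation aM := (@atlas R E M).
Notation sm f := (forall z, smooth_at (@vec_atlas R _) aM f z).

(** Compactness of the unit square gives a radius [d] valid at all of its points; any other cell is
    brought there by clamping the first variable and an integer shift of the second. *)
Lemma lebesgue_number (H : R * R -> M) : continuous H ->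
  (forall s t, H (s, t + 1) = H (s, t)) -> (forall s t, H (s, t) = H (clamp s, t)) ->
  exists2 N : nat, (0 < N)%N & forall i j : int, exists2 b, convex_chart b &
    forall s t, i%:~R <= s <= i%:~R + 1 -> j%:~R <= t <= j%:~R + 1 -> cball b (H (s / N%:R, t / N%:R)).
Proof.
move=> cH Hp Hc.
pose P (d : R) (z : R * R) := exists2 b, convex_chart b &
  forall w : R * R, `|w.1 - z.1| <= d -> `|w.2 - z.2| <= d -> cball b (H w).
have cK : compact (`[0%R, 1%R]%classic `*` `[0%R, 1%R]%classic : set (R * R)).
  by apply: compact_setX; exact: segment_compact.
have : \forall d \near (0 : R)^'+, `[0%R, 1%R]%classic `*` `[0%R, 1%R]%classic `<=` P d.
  apply: ((compact_near_coveringP _).1 cK) => z _.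
  have [b [bc bz _]] := @cball_ex _ _ M setT (H z) openT I.
  have : \forall w \near z, cball b (H w) by apply: cH; exact: open_nbhs_nbhs (conj (cball_open bc) bz).
  move=> [[A B] /= [/nbhs_ballP[e1 /= e10 A1] /nbhs_ballP[e2 /= e20 B1]] AB].
  exists (ball z.1 (e1 / 2) `*` ball z.2 (e2 / 2), [set d | d < Num.min (e1 / 2) (e2 / 2)]).
    split => /=.
      exists (ball z.1 (e1 / 2), ball z.2 (e2 / 2)) => //=.
      by split; apply: nbhsx_ballx; rewrite divr_gt0.
    by apply: nbhs_right_lt; rewrite lt_min !divr_gt0.
  move=> [z' d] [/= [zz1 zz2]]; rewrite lt_min => /andP[d1 d2].
  exists b => // w w1 w2; apply: AB; split => /=; [apply: A1|apply: B1]; rewrite /ball /=.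
    rewrite (_ : z.1 - w.1 = (z.1 - z'.1) - (w.1 - z'.1)); last by ring.
    rewrite (le_lt_trans (ler_normB _ _))// (splitr e1) ltrD//; exact: le_lt_trans d1.
  rewrite (_ : z.2 - w.2 = (z.2 - z'.2) - (w.2 - z'.2)); last by ring.
  rewrite (le_lt_trans (ler_normB _ _))// (splitr e2) ltrD//; exact: le_lt_trans d2.
move=> /(filterI (nbhs_right_gt (0 : R))) /filter_ex[d [/= d0 dP]].
(* Then [1 / N <= d], so that a cell stays within [d] of its lower left corner in each
   coordinate. *)
pose N := (Num.trunc d^-1).+1.
have N0 : 0 < N%:R :> R by rewrite ltr0n.
have Nd : N%:R^-1 <= d.
  by rewrite -[leRHS]invrK lef_pV2 ?posrE ?invr_gt0//; apply/ltW; exact: truncnS_gt.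
exists N => // i j.
pose m := Num.floor (j%:~R / N%:R : R).
have [|b bc bH] := dP (clamp (i%:~R / N%:R), j%:~R / N%:R - m%:~R).
  split => /=; rewrite in_itv /= ?clamp_itv//.
  have /andP[f1 f2] := floor_itv (j%:~R / N%:R : R); rewrite -/m intrD in f1 f2.
  by apply/andP; split; lra.
exists b => // s t /andP[s1 s2] /andP[t1 t2].
have -> : H (s / N%:R, t / N%:R) = H (clamp (s / N%:R), t / N%:R - m%:~R).
  rewrite Hc -[in RHS](periodic_int (f := fun t => H (_, t)) (T := 1) _ m)//.
  by rewrite mulr1 subrK.
have small u k : k%:~R <= u <= k%:~R + 1 -> `|u / N%:R - k%:~R / N%:R| <= d.
  move=> /andP[u1 u2]; rewrite -mulrBl ger0_norm ?divr_ge0 ?subr_ge0 ?ler0n//.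
  apply: le_trans Nd; rewrite -[leRHS]mul1r ler_wpM2r ?invr_ge0 ?ler0n//; lra.
apply: bH => /=.
  by apply: le_trans (clamp_dist _ _) _; apply: small; rewrite s1.
by rewrite opprB addrA subrK; apply: small; rewrite t1.
Qed.

(** Inside the grid only the vertices keep their values under [K]. Each edge becomes a smooth path
    in the balls of both adjacent cells, except on [i = 0] and [i = N], where [x] and [phi] are
    prescribed; each cell is then filled inside its ball. The three [lam] of the conclusion come
    from the edge [phi (j + lam t)], from [fill_square] and from [smooth_chain]. *)
Lemma smooth_grid (K : R * R -> M) (N : nat) (x : M) (phi : R^o -> M) :
  continuous K -> (forall s t, K (s, t + N%:R) = K (s, t)) ->
  (forall i j : int, exists2 b, convex_chart b &
    forall s t, i%:~R <= s <= i%:~R + 1 -> j%:~R <= t <= j%:~R + 1 -> cball b (K (s, t))) ->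
  (0 < N)%N -> sm phi -> (forall t, K (0, t) = x) -> (forall t, K (N%:R, t) = phi t) ->
  exists f : R^o * R^o -> M, [/\ sm f, forall s t, f (s, t + N%:R) = f (s, t), forall t, f (0, t) = x &
    forall t, f (N%:R, t) = phi ((Num.floor t)%:~R + lam (lam (lam (t - (Num.floor t)%:~R))))].
Proof.
move=> cK KN cells N0 sphi K0 K1.
(* All choices are made on residues modulo [N], so that the result is [N]-periodic in [t] by
   construction. *)
pose md (j : int) : int := (j %% N%:Z)%Z.
have mdN j : md (j + N%:Z) = md j by rewrite /md -{1}(mul1r N%:Z) addrC modzMDl.
have mdD j : md (md j + 1) = md (j + 1) by rewrite /md modzDml.
have Kmd s t j : K (s, (md j)%:~R + t) = K (s, j%:~R + t) by exact: (periodic_mod j t (KN s)).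
have bex (ij : int * int) : exists b, convex_chart b /\
    forall s t, ij.1%:~R <= s <= ij.1%:~R + 1 -> ij.2%:~R <= t <= ij.2%:~R + 1 -> cball b (K (s, t)).
  by have [b bc bK] := cells ij.1 ij.2; exists b.
have [bx bxP] := choice bex.
pose b i j := bx (i, md j).
have bC i j : convex_chart (b i j) by exact: (bxP _).1.
have bK i j s t : i%:~R <= s <= i%:~R + 1 -> j%:~R <= t <= j%:~R + 1 -> cball (b i j) (K (s, t)).
  move=> si tj; rewrite -(subrK j%:~R t) addrC -Kmd; apply: (bxP (i, md j)).2 => //=.
  by move: tj => /andP[? ?]; apply/andP; split; lra.
have bmd i j : b i (md j) = b i j by rewrite /b /md modz_mod.
have cKt (r : R) : continuous (fun t : R => K (r, t)).
  move=> t; apply: (@cvg_comp_at _ _ _ _ (fun t : R => (r, t) : R * R) K (r, t)); last exact: cK.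
  by apply: cvg_pairT; [exact: cvg_cst|exact: cvg_id].
have cKs (r : R) : continuous (fun s : R => K (s, r)).
  move=> t; apply: (@cvg_comp_at _ _ _ _ (fun s : R => (s, r) : R * R) K (t, r)); last exact: cK.
  by apply: cvg_pairT; [exact: cvg_id|exact: cvg_cst].
have ii (r : R) : r <= r <= r + 1 by rewrite lexx lerDl ler01.
have ii1 (i : int) (r : R) : r = i%:~R -> (i - 1)%:~R <= r <= (i - 1)%:~R + 1 by move=> ->; rewrite intrB; apply/andP; split; lra.
have il (i : int) (t : R) : i%:~R <= i%:~R + lam t <= i%:~R + 1 by rewrite lerDl lam_ge0 lerD2l lam_le1.
have vex (ij : int * int) : exists v : R^o -> M, let: (i, j) := ij in
    [/\ sm v, v 0 = K (i%:~R, j%:~R), v 1 = K (i%:~R, j%:~R + 1) &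
    [/\ forall t, cball (b i j) (v t), forall t, cball (b (i - 1) j) (v t), i = 0 -> forall t, v t = x &
      i = N%:Z -> forall t, v t = phi (j%:~R + lam t)]].
  case: ij => i j.
  have [i0|i0] := eqVneq i 0.
    exists (fun=> x); split.
    - by move=> z; exact: smooth_at_cst.
    - by rewrite i0 K0.
    - by rewrite i0 K0.
    split => //.
    - by move=> t; rewrite -(K0 j%:~R) i0; apply: bK => //; exact: (ii 0%R).
    - by move=> t; rewrite -(K0 j%:~R) i0; apply: bK => //; exact: ii1.
    - by move=> iN; move: N0; rewrite -ltz_nat -iN i0.
  have [iN|iN] := eqVneq i N%:Z.
    exists (fun t => phi (j%:~R + lam t)).
    have Kp t : phi (j%:~R + lam t) = K (i%:~R, j%:~R + lam t) by rewrite iN -K1.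
    split.
    - move=> z; apply: (@sm_precomp _ _ _ _ _ _ _ _ _ phi (fun t : R^o => (j%:~R + lam t : R^o))) => // n.
      by apply: CT_add; [exact: CT_cst|exact: Ck_lam].
    - by rewrite Kp lam0 ?addr0// invr_ge0.
    - by rewrite Kp lam1//; lra.
    split => //.
    - by move=> t; rewrite Kp; apply: bK.
    - by move=> t; rewrite Kp; apply: bK => //; exact: ii1.
    - by move=> i0'; rewrite i0' eqxx in i0.
  (* The intersection of two balls need not be connected. The image of the edge under [K] is, and it
     lies in this intersection, so its ends can be joined there. *)
  pose C : set M := (fun t => K (i%:~R, t)) @` `[j%:~R, j%:~R + 1]%classic.
  have [g [sg g0 g1 gU]] : joined (cball (b i j) `&` cball (b (i - 1) j)) (K (i%:~R, j%:~R)) (K (i%:~R, j%:~R + 1)).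
    apply: (@connected_joined _ _ _ _ _ C).
    - by apply: openI; exact: cball_open.
    - apply: connected_continuous_connected; first exact: segment_connected.
      exact: continuous_subspaceT.
    - by move=> _ [t /= + <-]; rewrite in_itv /= => tj; split; apply: bK => //; exact: ii1.
    - by exists j%:~R => //=; rewrite in_itv /= ii.
    - by exists (j%:~R + 1) => //=; rewrite in_itv /= lexx lerDl ler01.
  exists g; split => //; split.
  - by move=> t; case: (gU t).
  - by move=> t; case: (gU t).
  - by move=> i0'; rewrite i0' eqxx in i0.
  - by move=> iN'; rewrite iN' eqxx in iN.
have [v vP] := choice vex.
have hex (ij : int * int) : exists h : R^o -> M, let: (i, j) := ij in
    [/\ sm h, h 0 = K (i%:~R, j%:~R), h 1 = K (i%:~R + 1, j%:~R) &
     forall t, cball (b i j) (h t) /\ cball (b i (j - 1)) (h t)].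
  case: ij => i j.
  pose C : set M := (fun s => K (s, j%:~R)) @` `[i%:~R, i%:~R + 1]%classic.
  have [g [sg g0 g1 gU]] : joined (cball (b i j) `&` cball (b i (j - 1))) (K (i%:~R, j%:~R)) (K (i%:~R + 1, j%:~R)).
    apply: (@connected_joined _ _ _ _ _ C).
    - by apply: openI; exact: cball_open.
    - apply: connected_continuous_connected; first exact: segment_connected.
      exact: continuous_subspaceT.
    - by move=> _ [t /= + <-]; rewrite in_itv /= => tj; split; apply: bK => //; exact: ii1.
    - by exists i%:~R => //=; rewrite in_itv /= ii.
    - by exists (i%:~R + 1) => //=; rewrite in_itv /= lexx lerDl ler01.
  by exists g.
have [h hP] := choice hex.
pose V i j := v (i, md j). pose Hh i j := h (i, md j).
have Km0 s j : K (s, (md j)%:~R) = K (s, j%:~R) by rewrite -[(md j)%:~R]addr0 Kmd addr0.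
have bm1 i j : b i (md j - 1) = b i (j - 1) by rewrite /b /md modzDml.
have cP i j : exists c : R^o * R^o -> M, [/\ forall z, smooth_at (@vec_atlas R _) aM c z,
    (forall t, c (0, t) = V i j (lam t)) , (forall t, c (1, t) = V (i + 1) j (lam t)) &
    (forall s, c (s, 0) = Hh i j (lam s)) /\ (forall s, c (s, 1) = Hh i (j + 1) (lam s))].
  have [s1 v10 v11 [b1 _ _ _]] := vP (i, md j).
  have [s2 v20 v21 [_ b2 _ _]] := vP (i + 1, md j).
  have [s3 h30 h31 b3] := hP (i, md j).
  have [s4 h40 h41 b4] := hP (i, md (j + 1)).
  apply: (@fill_square _ _ _ _ (b i j)) => //.
  - by move=> t; rewrite -bmd; exact: b1.
  - by move=> t; rewrite -bmd -[X in b X](addrK 1 i); exact: b2.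
  - by move=> t; rewrite -bmd; exact: (b3 t).1.
  - by move=> t; move: (b4 t).2; rewrite bm1 addrK.
  - by rewrite /V /Hh v10 h30.
  - by rewrite /V /Hh v11 h40 Kmd Km0 intrD.
  - by rewrite /V /Hh v20 h31 intrD.
  - by rewrite /V /Hh v21 h41 Kmd Km0 !intrD.
have [c' c'P] := choice (fun ij : int * int => cP ij.1 ij.2).
pose c i j := c' (i, md j).
have VE i j : V i (md j) = V i j by rewrite /V /md modz_mod.
have HE i j : Hh i (md j) = Hh i j by rewrite /Hh /md modz_mod.
have HE1 i j : Hh i (md j + 1) = Hh i (j + 1) by rewrite /Hh mdD.
have sc i j z : smooth_at (@vec_atlas R _) aM (c i j) z by have [] := c'P (i, md j).
have c0 i j t : c i j (0, t) = V i j (lam t) by have [_ cc _ _] := c'P (i, md j); rewrite /c cc /= VE.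
have c1 i j t : c i j (1, t) = V (i + 1) j (lam t) by have [_ _ cc _] := c'P (i, md j); rewrite /c cc /= VE.
have cb i j s : c i j (s, 0) = Hh i j (lam s) by have [_ _ _ [cc _]] := c'P (i, md j); rewrite /c cc /= HE.
have ct i j s : c i j (s, 1) = Hh i (j + 1) (lam s) by have [_ _ _ [_ cc]] := c'P (i, md j); rewrite /c cc /= HE1.
have cN i j : c i (j + N%:Z) = c i j by rewrite /c mdN.
(* The cells of fixed [j] are glued along the first variable, with coordinates swapped to fit
   [smooth_chain]; [f0] then glues the rows along the second. *)
pose row j (z : R^o * R^o) := c (Num.floor (z.2 : R)) j (lam (z.2 - (Num.floor (z.2 : R))%:~R), z.1).
have srow j z : smooth_at (@vec_atlas R _) aM (row j) z.
  apply: (@smooth_chain R R^o E _ _ M aM (fun i (z : R^o * R^o) => c i j (z.2, z.1))).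
    move=> i w; apply: (@sm_precomp _ _ _ _ _ _ _ _ _ (c i j) (fun z : R^o * R^o => (z.2, z.1))) => // n; ckt.
  by move=> i t; rewrite /= c0 c1.
pose f0 (z : R^o * R^o) := row (Num.floor (z.2 : R)) (lam (z.2 - (Num.floor (z.2 : R))%:~R), z.1).
have sf z : smooth_at (@vec_atlas R _) aM f0 z.
  apply: (@smooth_chain R R^o E _ _ M aM (fun j (z : R^o * R^o) => row j (z.2, z.1))).
    move=> j w; apply: (@sm_precomp _ _ _ _ _ _ _ _ _ (row j) (fun z : R^o * R^o => (z.2, z.1))) => // n; ckt.
  by move=> j s; rewrite /row /= cb ct.
have fl (n : int) : Num.floor (n%:~R : R) = n by apply: floor_def; rewrite lexx /= intrD ltrDl ltr01.
have l0 : lam 0 = 0 :> R by rewrite lam0 ?invr_ge0.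
exists f0; split => //.
- move=> s t; rewrite /f0 /= -[N%:R]/(N%:Z%:~R) floorDint intrD opprD addrACA subrr addr0.
  by rewrite /row cN.
- move=> t; rewrite /f0 /row /= -[0 : R]/((0 : int)%:~R) fl subrr l0 c0 /V.
  by have [_ _ _ [_ _ v0 _]] := vP (0, md (Num.floor t)); exact: v0.
- move=> t; rewrite /f0 /row /= -[N%:R]/(N%:Z%:~R) fl subrr l0 c0 /V.
  have [_ _ _ [_ _ _ vN]] := vP (N%:Z, md (Num.floor t)).
  by rewrite vN// -!K1 Kmd.
Qed.

End Grid.

(** * Smooth representatives of null-homotopies and of loops *)

Section SmoothRepresentatives.
Context {R : realType}.

Lemma continuous_div (S : topologicalType) (f : S -> R) (c : R) : continuous f -> continuous (fun z => f z / c).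
Proof.
move=> cf z; apply: (@cvg_comp_at _ _ _ _ f (fun u : R => u / c)); first exact: cf.
exact: mulrr_continuous.
Qed.

Lemma continuous_mul (S : topologicalType) (f : S -> R) (c : R) : continuous f -> continuous (fun z => c * f z).
Proof.
move=> cf z; apply: (@cvg_comp_at _ _ _ _ f (fun u : R => c * u)); first exact: cf.
exact: mulrl_continuous.
Qed.

Context (E : tvsType R) {hE : hausT E} (M : manifold E).
Notation aM := (@atlas R E M).
Notation sm f := (forall z, smooth_at (@vec_atlas R _) aM f z).

Lemma smooth_path_ex x y : connected [set: M] -> exists g : R^o -> M, [/\ sm g, g 0 = x & g 1 = y].
Proof.
move=> cM; have [g [sg g0 g1 _]] : joined (M := M) setT x y.
  by apply: (@connected_joined _ _ _ _ _ [set: M]) => //; exact: openT.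
by exists g.
Qed.

(* rho induces a degree 1 map of R/Z which is flat at the multiples of 1/N. *)
Lemma CT_stairs (l : R^o -> R^o) (N : nat) : (forall n, Ck n setT l) -> l 0 = 0 -> l 1 = 1 -> (0 < N)%N ->
  exists rho : R^o -> R^o, [/\ forall n, Ck n setT rho, forall t, rho (t + 1) = rho t + 1 &
  forall t, rho t = N%:R^-1 * ((Num.floor (N%:R * t))%:~R + l (lam (N%:R * t - (Num.floor (N%:R * t))%:~R)))].
Proof.
move=> cl l0 l1 N0; have Nn0 : N%:R != 0 :> R by rewrite pnatr_eq0 -lt0n.
pose g (z : R^o * R^o) : R^o := (Num.floor (z.2 : R))%:~R + l (lam (z.2 - (Num.floor (z.2 : R))%:~R)).
have sg z : smooth_at (@vec_atlas R _) (@vec_atlas R R^o) g z.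
  apply: (@smooth_chain R R^o R^o _ _ R^o (@vec_atlas R R^o) (fun n (z : R^o * R^o) => (n%:~R + l z.2 : R^o))).
    move=> n w; apply: sm_of_CT => m; apply: CT_add; first exact: CT_cst.
    by apply: CT_comp; [exact: cl|exact: CT_snd].
  by move=> n v; rewrite /= l0 l1 addr0 intrD.
exists (fun t => N%:R^-1 * g (0, N%:R * t)); split => //.
- move=> n; apply: CT_mul; first exact: CT_cst.
  apply: (@Ck_comp R n _ _ _ _ _ _ (fun t : R^o => (0, N%:R * t) : (R^o * R^o)%type) g setT setT openT openT) => //.
    by apply: CT_pair; [exact: CT_cst|apply: CT_mul; [exact: CT_cst|exact: CT_id]].
  exact: CT_of_sm.
- move=> t; have gE (y : R) : g (0, y + N%:R) = g (0, y) + N%:R.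
    rewrite /g /=; have -> : Num.floor (y + N%:R) = Num.floor y + N%:Z := floorDint y N%:Z.
    have -> : y + N%:R - (Num.floor y + N%:Z)%:~R = y - (Num.floor y)%:~R.
      by rewrite intrD -[N%:Z%:~R]/(N%:R : R); ring.
    by set L := l _; rewrite intrD addrAC.
  have -> : N%:R * (t + 1) = N%:R * t + N%:R by ring.
  by rewrite gE; move: (g _) => c; rewrite mulrDr mulVf.
Qed.

(** The grid construction ends at [phi \o rho], with [rho] the staircase of [CT_stairs], instead of
    [phi]. As [rho] and the identity both advance by 1 per period, interpolating between them inside
    the argument of [phi] gives a second tube that repairs the end. *)
Lemma null_tube (x : M) (phi : R^o -> M) (H : R * R -> M) : sm phi -> (forall t, phi (t + 1) = phi t) ->
  {within `[0%R, 1%R] `*` `[0%R, 1%R], continuous H} ->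
  (forall t, 0 <= t <= 1 -> H (0, t) = x /\ H (1, t) = phi t) ->
  (forall s, 0 <= s <= 1 -> H (s, 0) = x /\ H (s, 1) = x) ->
  exists f, tube f (fun=> x) phi.
Proof.
move=> sphi phi1 cH H01 Hs.
have [|K [cK K1 Kc KH]] := periodic_extension cH; first by move=> s /Hs[-> ->].
have per t : exists2 t', 0 <= t' <= 1 & (forall s, K (s, t) = K (s, t')) /\ phi t = phi t'.
  exists (t - (Num.floor t)%:~R).
    by have := floor_itv t; rewrite intrD => /andP[? ?]; apply/andP; split; lra.
  split => [s|].
    by rewrite -[LHS](periodic_int (f := fun t => K (s, t)) (K1 s) (- Num.floor t)) mulr1 intrN.
  by rewrite -[LHS](periodic_int phi1 (- Num.floor t)) mulr1 intrN.
have K0E t : K (0, t) = x.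
  by have [t' t'01 [-> _]] := per t; rewrite KH ?lexx ?ler01//; case: (H01 _ t'01).
have K1E t : K (1, t) = phi t.
  by have [t' t'01 [-> ->]] := per t; rewrite KH ?lexx ?ler01//; case: (H01 _ t'01).
have [N N0 cells] := lebesgue_number cK K1 Kc.
have Nn0 : N%:R != 0 :> R by rewrite pnatr_eq0 -lt0n.
pose K' (z : R * R) := K (z.1 / N%:R, z.2 / N%:R).
have cK' : continuous K'.
  move=> z; apply: (@cvg_comp_at _ _ _ _ (fun z : R * R => (z.1 / N%:R, z.2 / N%:R) : R * R) K _); last exact: cK.
  by apply: cvg_pairT; apply: continuous_div; move=> w; [exact: cvg_fst|exact: cvg_snd].
have [f0 [sf0 f0N f00 f01]] : exists f : R^o * R^o -> M, [/\ sm f, forall s t, f (s, t + N%:R) = f (s, t), forall t, f (0, t) = x &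
    forall t, f (N%:R, t) = phi (((Num.floor t)%:~R + lam (lam (lam (t - (Num.floor t)%:~R)))) / N%:R)].
  apply: (@smooth_grid _ _ _ _ K' N x (fun t => phi (t / N%:R))) => //.
  - by move=> s t; rewrite /K' /= mulrDl divff// K1.
  - move=> t; apply: (@sm_precomp _ _ _ _ _ _ _ _ _ phi (fun t : R^o => (t / N%:R : R^o))) => // n.
    by apply: CT_mul; [exact: CT_id|exact: CT_cst].
  - by move=> t; rewrite /K' /= mul0r K0E.
  - by move=> t; rewrite /K' /= divff// K1E.
have l0 : lam 0 = 0 :> R by rewrite lam0 ?invr_ge0.
have l1 : lam 1 = 1 :> R by rewrite lam1//; lra.
have cll n : Ck n setT ((fun t => lam (lam t)) : R^o -> R^o) by do 2?[apply: CT_lam]; exact: CT_id.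
have [||rho [crho rho1 rhoE]] := CT_stairs cll _ _ N0; [by rewrite !l0|by rewrite !l1|].
have t1 : tube (fun z : R^o * R^o => f0 (N%:R * z.1, N%:R * z.2)) (fun=> x) (fun t => phi (rho t)).
  split.
  - apply: (@sm_rescale _ _ _ _ f0 (fun t => N%:R * t) (fun t => N%:R * t)) => // n;
    by apply: CT_mul; [exact: CT_cst|exact: CT_id].
  - by move=> r t; rewrite mulrDr mulr1 f0N.
  - by move=> t; rewrite mulr0 f00.
  - by move=> t; rewrite mulr1 f01 rhoE mulrC.
have t2 : tube (fun z : R^o * R^o => phi ((1 - lam z.1) * rho z.2 + lam z.1 * z.2)) (fun t => phi (rho t)) phi.
  split.
  - move=> z; apply: (@sm_precomp _ _ _ _ _ _ _ _ _ phi (fun z : R^o * R^o => ((1 - lam z.1) * rho z.2 + lam z.1 * z.2 : R^o))) => // n.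
    have cr : Ck n setT (fun z : R^o * R^o => rho z.2) by apply: CT_comp; [exact: crho|exact: CT_snd].
    by apply: CT_add; apply: CT_mul => //; ckt.
  - move=> r t; rewrite /= rho1 -[RHS]phi1; apply: (f_equal phi); ring.
  - by move=> t; rewrite lam0 ?invr_ge0// subr0 mul1r mul0r addr0.
  - by move=> t /=; rewrite lam1 ?subrr ?mul0r ?add0r ?mul1r//; lra.
by exists (tube_cat (fun z : R^o * R^o => f0 (N%:R * z.1, N%:R * z.2)) (fun z : R^o * R^o => phi ((1 - lam z.1) * rho z.2 + lam z.1 * z.2))); exact: (tube_catP t1 t2).
Qed.

Lemma smooth_loop_ex (x : M) (p : loop x) : exists phi : R^o -> M,
  [/\ sm phi, forall t, phi (t + 1) = phi t, phi 0 = x &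
  exists H : R * R -> M, [/\ continuous H, forall t, 0 <= t <= 1 -> H (0, t) = p t, forall t, H (1, t) = phi t &
    forall s, H (s, 0) = x /\ H (s, 1) = x]].
Proof.
(* The loop is seen as a homotopy constant in its first variable, so that [lebesgue_number] applies;
   only the cells [(0, j)] are used. *)
have cp : continuous (fun z : R * R => p (clamp z.2)).
  apply: (within_comp_continuous (@loop_continuous _ _ _ p)) => [z|z]; last by rewrite /= in_itv /= clamp_itv.
  by apply: (@cvg_comp_at _ _ _ _ _ clamp); [exact: cvg_snd|exact: clamp_continuous].
have [|K [cK K1 Kc KH]] := periodic_extension (continuous_subspaceT cp).
  by move=> s _ /=; rewrite clamp0// clamp1// loop0 loop1.
have Kp t : 0 <= t <= 1 -> K (0, t) = p t by move=> t01; rewrite KH ?lexx ?ler01//= clamp_id.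
have [N N0 cells] := lebesgue_number cK K1 Kc.
have Nn0 : N%:R != 0 :> R by rewrite pnatr_eq0 -lt0n.
pose ka t := K (0, t / N%:R).
have cka : continuous ka.
  move=> t; apply: (@cvg_comp_at _ _ _ _ (fun t : R => (0, t / N%:R) : R * R) K (0, t / N%:R)); last exact: cK.
  by apply: cvg_pairT; [exact: cvg_cst|apply: continuous_div => w; exact: cvg_id].
have kaN t : ka (t + N%:R) = ka t by rewrite /ka mulrDl divff// K1.
have ka0 : ka 0 = x by rewrite /ka mul0r Kp ?lexx ?ler01// loop0.
have bwex (j : int) : exists bw : (chart M E * set E) * (R^o -> M),
    [/\ convex_chart bw.1, forall t, j%:~R <= t <= j%:~R + 1 -> cball bw.1 (ka t), sm bw.2 &
     [/\ bw.2 0 = ka j%:~R, bw.2 1 = ka (j%:~R + 1) & forall t, cball bw.1 (bw.2 t)]].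
  have [b bc bK] := cells 0 j.
  have bk t : j%:~R <= t <= j%:~R + 1 -> cball b (ka t).
    by move=> tj; rewrite /ka -[X in (X, _)](mul0r N%:R^-1); apply: bK => //; rewrite lexx add0r ler01.
  have [w [sw w0 w1 wb]] : joined (cball b) (ka j%:~R) (ka (j%:~R + 1)).
    by apply: joined_cball => //; apply: bk; rewrite ?lexx ?lerDl ler01.
  by exists (b, w).
have [bw bwP] := choice bwex.
pose md (j : int) : int := (j %% N%:Z)%Z.
have mdN j : md (j + N%:Z) = md j by rewrite /md -{1}(mul1r N%:Z) addrC modzMDl.
have kamd j t : ka ((md j)%:~R + t) = ka (j%:~R + t) by exact: periodic_mod.
pose b j := (bw (md j)).1; pose w j := (bw (md j)).2.
have bC j : convex_chart (b j) by have [] := bwP (md j).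
have bk j s : cball (b j) (ka ((md j)%:~R + clamp s)).
  by have [_ bk _ _] := bwP (md j); apply: bk; have /andP[? ?] := clamp_itv s; apply/andP; split; lra.
have sw j : sm (w j) by have [] := bwP (md j).
have w0 j : w j 0 = ka j%:~R by have [_ _ _ [e _ _]] := bwP (md j); rewrite /w e -[_%:~R]addr0 kamd addr0.
have w1 j : w j 1 = ka (j%:~R + 1) by have [_ _ _ [_ e _]] := bwP (md j); rewrite /w e kamd.
have wb j t : cball (b j) (w j t) by have [_ _ _ [_ _ wb]] := bwP (md j); exact: wb.
have fl (n : int) : Num.floor (n%:~R : R) = n by apply: floor_def; rewrite lexx /= intrD ltrDl ltr01.
have l0 : lam 0 = 0 :> R by rewrite lam0 ?invr_ge0.
have l1 : lam 1 = 1 :> R by rewrite lam1//; lra.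
have c1 : clamp 1 = 1 :> R by rewrite clamp1. have c0 : clamp 0 = 0 :> R by rewrite clamp0.
pose g0 (z : R^o * R^o) := w (Num.floor (z.2 : R)) (lam (z.2 - (Num.floor (z.2 : R))%:~R)).
have sg0 : sm g0.
  apply: (@smooth_chain R R^o E _ _ M aM (fun j (z : R^o * R^o) => w j z.2)).
    move=> j z; apply: (@sm_precomp _ _ _ _ _ _ _ _ _ (w j) (fun z : R^o * R^o => z.2)) => // n; ckt.
  by move=> j v /=; rewrite w1 w0 intrD.
pose phi (t : R^o) := g0 (0, N%:R * t).
pose u j (z : R * R) := chart_to (b j).1 (ka ((md j)%:~R + clamp z.2)).
pose v j (z : R * R) := chart_to (b j).1 (w j (lam (clamp z.2))).
have uK j z : (b j).2 (u j z) by case: (bk j z.2).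
have vK j z : (b j).2 (v j z) by case: (wb j (lam (clamp z.2))).
(* The chart segment from the given arc [u] to the smooth arc [v]. At the ends of an arc the two
   coincide, so the homotopy is constant there. *)
pose q j (z : R * R) := (1 - clamp z.1 : R^o) *: u j z + (clamp z.1 : R^o) *: v j z.
have qK j z : (b j).2 (q j z) by apply: convexs_cball => //; exact: clamp_itv.
have ccl2 : continuous (fun z : R * R => clamp z.2).
  by move=> z; apply: (@cvg_comp_at _ _ _ _ _ clamp); [exact: cvg_snd|exact: clamp_continuous].
have ccl1 : continuous (fun z : R * R => clamp z.1).
  by move=> z; apply: (@cvg_comp_at _ _ _ _ _ clamp); [exact: cvg_fst|exact: clamp_continuous].
have cq j : continuous (fun z => chart_from (b j).1 (q j z)).
  move=> z; have [_ _ _ Kc'] := bC j.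
  apply: (@cvg_comp_at _ _ _ _ (q j) (chart_from (b j).1)); last exact: (chart_from_continuous (Kc' _ (qK j z))).
  apply: tvs_cvgD; apply: tvs_cvgZ.
  - by apply: cvgB; [exact: cvg_cst|exact: ccl1].
  - apply: (@cvg_comp_at _ _ _ _ (fun z : R * R => ka ((md j)%:~R + clamp z.2)) (chart_to (b j).1)).
      apply: (@cvg_comp_at _ _ _ _ (fun z : R * R => (md j)%:~R + clamp z.2) ka); last exact: cka.
      by apply: cvgD; [exact: cvg_cst|exact: ccl2].
    exact: chart_to_continuous (bk j z.2).1.
  - exact: ccl1.
  - apply: (@cvg_comp_at _ _ _ _ (fun z : R * R => w j (lam (clamp z.2))) (chart_to (b j).1)).
      apply: (@cvg_comp_at _ _ _ _ (fun z : R * R => lam (clamp z.2)) (w j)).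
        apply: (@cvg_comp_at _ _ _ _ (fun z : R * R => clamp z.2) lam); first exact: ccl2.
        exact: (Ck_continuous (@Ck_lam R 0) I).
      by apply: smooth_at_continuous; exact: sw.
    exact: chart_to_continuous (wb j _).1.
have qE j z y : u j z = chart_to (b j).1 y -> v j z = u j z -> cball (b j) y -> chart_from (b j).1 (q j z) = y.
  by move=> uy vu [yd _]; rewrite /q vu -scalerDl subrK scale1r uy chart_toK.
have q1 j s : chart_from (b j).1 (q j (s, 1)) = ka (j%:~R + 1).
  have := bk j 1; rewrite c1 kamd => B.
  by apply: qE => //; rewrite /v /u /= c1 ?kamd// l1 w1.
have q0 j s : chart_from (b j).1 (q j (s, 0)) = ka j%:~R.
  have := bk j 0; rewrite c0 kamd addr0 => B.
  by apply: qE => //; rewrite /v /u /= c0 kamd addr0// l0 w0.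
pose h0 (z : R * R) := chart_from (b (Num.floor z.2)).1 (q (Num.floor z.2) (z.1, z.2 - (Num.floor z.2)%:~R)).
have ch0 : continuous h0.
  apply: (@continuous_chain _ _ (fun j z => chart_from (b j).1 (q j z))) => //.
  by move=> j s; rewrite q1 q0 intrD.
have fr (t : R) : 0 <= t - (Num.floor t)%:~R <= 1.
  by have := floor_itv t; rewrite intrD => /andP[? ?]; apply/andP; split; lra.
exists phi; split.
- move=> t; apply: (@sm_precomp _ _ _ _ _ _ _ _ _ g0 (fun t : R^o => (0, N%:R * t) : (R^o * R^o)%type)) => // n.
  by apply: CT_pair; [exact: CT_cst|apply: CT_mul; [exact: CT_cst|exact: CT_id]].
- move=> t; rewrite /phi /g0 /=; have -> : N%:R * (t + 1) = N%:R * t + N%:R by ring.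
  move: (N%:R * t) => y; have -> : Num.floor (y + N%:R) = Num.floor y + N%:Z := floorDint y N%:Z.
  have -> : y + N%:R - (Num.floor y + N%:Z)%:~R = y - (Num.floor y)%:~R.
    by rewrite intrD -[N%:Z%:~R]/(N%:R : R); ring.
  by rewrite /w mdN.
- by rewrite /phi /g0 /= mulr0 (fl 0 : Num.floor (0 : R) = 0) subrr l0 w0 ka0.
exists (fun z => h0 (z.1, N%:R * z.2)); split.
- move=> z; apply: (@cvg_comp_at _ _ _ _ (fun z : R * R => (z.1, N%:R * z.2) : R * R) h0); last exact: ch0.
  by apply: cvg_pairT; [exact: cvg_fst|apply: continuous_mul => ?; exact: cvg_snd].
- move=> t t01; rewrite /h0 /q /= c0 subr0 scale1r scale0r addr0 /u /=.
  rewrite chart_toK; last exact: (bk _ _).1.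
  rewrite clamp_id// kamd addrC subrK /ka mulrAC divff// mul1r; exact: Kp.
- move=> t; rewrite /h0 /q /= c1 subrr scale1r scale0r add0r /v /=.
  by rewrite chart_toK ?clamp_id//; exact: (wb _ _).1.
- move=> s; rewrite /h0 /= mulr0 mulr1.
  rewrite (fl 0 : Num.floor (0 : R) = 0) (fl N%:Z : Num.floor (N%:R : R) = _) !subrr !q0 ka0.
  by split => //; rewrite -ka0 -(kaN 0) add0r.
Qed.

End SmoothRepresentatives.

(** * Disks, spheres and tubes *)

Section PlanarDisk.
Context {R : realType}.
Notation mu := (@lebesgue_measure R).
Notation R2 := (measurableTypeR R * measurableTypeR R)%type.

Lemma continuous_pair (S T U : topologicalType) (f : S -> T) (g : S -> U) :
  continuous f -> continuous g -> continuous (fun z => (f z, g z)).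
Proof. by move=> cf cg z; apply: cvg_pairT; [exact: cf|exact: cg]. Qed.

Lemma continuous_cmp (S T U : topologicalType) (f : S -> T) (g : T -> U) :
  continuous f -> continuous g -> continuous (fun z => g (f z)).
Proof. by move=> cf cg z; apply: (@cvg_comp_at _ _ _ _ f g) => //; [exact: cf|exact: cg]. Qed.

Lemma continuous_pr1 (S T : topologicalType) : continuous (fun z : S * T => z.1).
Proof. by move=> z; exact: cvg_fst. Qed.

Lemma continuous_pr2 (S T : topologicalType) : continuous (fun z : S * T => z.2).
Proof. by move=> z; exact: cvg_snd. Qed.

Lemma continuous_mulf (S : topologicalType) (f g : S -> R) :
  continuous f -> continuous g -> continuous (fun z => f z * g z).
Proof. by move=> cf cg z; apply: cvgM; [exact: cf|exact: cg]. Qed.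

Lemma continuous_addf (S : topologicalType) (f g : S -> R) :
  continuous f -> continuous g -> continuous (fun z => f z + g z).
Proof. by move=> cf cg z; apply: cvgD; [exact: cf|exact: cg]. Qed.

Lemma continuous_norm2 : continuous (fun z : R * R => z.1 ^+ 2 + z.2 ^+ 2).
Proof.
apply: continuous_addf; apply: continuous_mulf; do ?exact: continuous_pr1; exact: continuous_pr2.
Qed.

Lemma open_disk : open [set z : R * R | z.1 ^+ 2 + z.2 ^+ 2 < 1].
Proof.
apply: (@open_comp _ _ (fun z : R * R => z.1 ^+ 2 + z.2 ^+ 2) [set x | x < 1]); last exact: open_lt.
by move=> z _; exact: continuous_norm2.
Qed.

Lemma pihalf_ge0 : 0 <= pi / 2 :> R.
Proof. by rewrite divr_ge0 ?pi_ge0. Qed.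

Lemma cos_pihalfN : cos (- (pi / 2)) = 0 :> R.
Proof. by rewrite cosN cos_pihalf. Qed.

Lemma cos_ge0_pihalfc (v : R) : - (pi / 2) <= v <= pi / 2 -> 0 <= cos v.
Proof.
move=> /andP[]; rewrite le_eqVlt => /orP[/eqP<-|v1]; first by rewrite cos_pihalfN.
by rewrite le_eqVlt => /orP[/eqP->|v2]; [rewrite cos_pihalf|rewrite ltW// cos_gt0_pihalf// v1].
Qed.

(** Horizontal chords: at height [y] the substitution [x = c y s] normalises the chord of
    half-length [c y]; then [y = sin v] turns [c y] into [cos v], removing a square root that is not
    differentiable at the two extreme heights. Each substitution contributes one factor [cos v]. *)
Lemma disk_int (F : R * R -> R) : continuous F ->
  (\int[(mu \x mu)%E]_(z in [set z : R * R | (z.1 ^+ 2 + z.2 ^+ 2 < 1)%R]) F z)%R =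
  rint (- (pi / 2)) (pi / 2) (fun v => rint (-1) 1 (fun s => F (s * cos v, sin v) * cos v ^+ 2)).
Proof.
move=> cF; set D := [set z : R * R | _].
have mD : measurable (D : set R2) by apply: open_measurable_prod; exact: open_disk.
have mQ : measurable (`[-1, 1] `*` `[-1, 1] : set R2) by exact: measurableX.
have iD : (mu \x mu)%E.-integrable (D : set R2) (EFin \o F).
  apply: integrableS mQ mD _ (rect_integrable (-1) 1 (-1) 1 cF) => -[x y] xy.
  have {}xy : (x : R) ^+ 2 + (y : R) ^+ 2 < 1 := xy.
  have H (a b : R) : a ^+ 2 + b ^+ 2 < 1 -> -1 <= a <= 1 by move=> ab; apply/andP; split; nra.
  by split; rewrite /= in_itv /=; [exact: H xy|rewrite addrC in xy; exact: H xy].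
have := (@integrable_mkcond _ R2 R (mu \x mu)%E _ (EFin \o F) mD).1 iD.
set G := _ \_ _ => iG.
(* The square root of a negative number is 0, so [c] is continuous on the whole line. *)
pose c (y : R) := Num.sqrt (1 - y ^+ 2).
have cc : continuous c.
  apply: (@continuous_cmp _ _ _ (fun y : R => 1 - y ^+ 2) (@Num.sqrt R)); last exact: sqrt_continuous.
  by move=> y; apply: cvgB; [exact: cvg_cst|apply: cvgM; exact: cvg_id].
pose p (y : R) := rint (-1) 1 (fun s => F (c y * s, y) * c y).
have cF' : continuous (fun z : R * R => F (c z.2 * z.1, z.2) * c z.2).
  have c2 : continuous (fun z : R * R => c z.2) by apply: continuous_cmp; [exact: continuous_pr2|exact: cc].
  apply: continuous_mulf => //; apply: (@continuous_cmp _ _ _ (fun z : R * R => (c z.2 * z.1, z.2)) F) => //.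
  by apply: continuous_pair; [apply: continuous_mulf => //; exact: continuous_pr1|exact: continuous_pr2].
have cp : continuous p by apply: (@int_param_continuous R _ (-1) 1 _ cF'); lra.
have pE y : -1 <= y <= 1 -> (\int[mu]_x G (x, y))%E = (p y)%:E.
  move=> /andP[y1 y2]; have y0 : 0 <= 1 - y ^+ 2 by nra.
  have c0 : 0 <= c y by exact: sqrtr_ge0.
  have c2 : c y ^+ 2 = 1 - y ^+ 2 by rewrite sqr_sqrtr.
  have -> : p y = rint (- c y) (c y) (fun x => F (x, y)).
    have dk (x : R) : is_derive x (1 : R) (fun s : R => c y * s) (c y).
      apply: diff_quot_is_derive; rewrite -[X in _ --> X](mulr1 (c y)).
      exact: (@linear_diff_quot R R^o R^o (fun s => c y *: s) x 1 (tvs_linear_scale R^o (c y))).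
    have e := @int_subst R (fun x => F (x, y)) (fun s => c y * s) (fun=> c y) (-1) 1 _
      (section_r (t := y) cF) (fun z => cvg_cst _) dk.
    rewrite /p [LHS]e; last by lra.
    by rewrite mulrN !mulr1 ge0_cp.
  have GE x : G (x, y) = ((fun x => (F (x, y))%:E) \_ `]- c y, c y[) x.
    rewrite /G /patch; congr (if _ then _ else _).
    apply/idP/idP; rewrite !inE /D /= in_itv /=.
      move=> xy; apply/andP; split; nra.
    by move=> /andP[x1 x2]; nra.
  under eq_integral do rewrite GE.
  rewrite -integral_mkcond -(@integral_itv_bndoo _ (- c y) (c y) (fun x => (F (x, y))%:E) true false); last first.
    apply/measurable_EFinP; apply: measurable_funTS; apply: continuous_measurable_fun.
    exact: (section_r (t := y) cF).
  rewrite /rint /Rintegral fineK//.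
  apply: (@integrable_fin_num _ _ R mu `[- c y, c y]%classic _ (fun x => (F (x, y))%:E)); first exact: measurable_itv.
  exact: (int_integrable (- c y) (c y) (section_r (t := y) cF)).
transitivity (rint (-1) 1 p).
  rewrite /rint /Rintegral integral_mkcond -/G -integral21_prod_meas1//; congr fine.
  rewrite [RHS]integral_mkcond; apply: eq_integral => y _.
  rewrite /fubini_G [in RHS]/patch mem_setE in_itv /=.
  case: ifPn => [y1|y1]; first exact: pE.
  rewrite integral0_eq// => x _; rewrite /G /patch; case: ifPn => // /[!inE]; rewrite /D /= => xy.
  by case/negP: y1; apply/andP; split; nra.
have -> : rint (-1) 1 p = rint (- (pi / 2)) (pi / 2) (fun v => p (sin v) * cos v).
  have pp := pihalf_ge0.
  have -> := @int_subst R p sin cos (- (pi / 2)) (pi / 2) _ cp (@continuous_cos R) (@is_derive_sin R); last by lra.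
  by rewrite sinN sin_pihalf ifT//; lra.
apply: eq_int => v vI; have cv := cos_ge0_pihalfc vI.
have cE : c (sin v) = cos v by rewrite /c -cos2sin2 sqrtr_sqr ger0_norm.
rewrite /p cE mulrC -intZ; last first.
  have := section_r (t := sin v) cF'; rewrite /= cE; exact.
by apply: eq_int => s _; rewrite (mulrC s); ring.
Qed.

End PlanarDisk.

(** * Disks swept by chords *)

Section DiskTube.
Context {R : realType}.
Context (F : tvsType R) {hF : hausT F} (X : manifold F) (om : form2 X).
Hypothesis som : smooth_form2 om.
Notation aX := (@atlas R F X).
Notation v2 := (@vec_atlas R (R^o * R^o)%type).
Notation sm f := (forall z, smooth_at (@vec_atlas R _) aX f z).
Notation mu := (@lebesgue_measure R).

Lemma smooth_on_subset_comp V W {hV : hausT V} {hW : hausT W} (S : set V) (u : V -> X) (g : W -> V) z :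
  smooth_on_subset (@vec_atlas R V) aX S u -> (forall n, Ck n setT g) -> (forall w, S (g w)) ->
  smooth_at (@vec_atlas R W) aX (fun w => u (g w)) z.
Proof.
move=> su cg Sg; have [U [f [Uz [oU sU1 sU2] Uf]]] := su _ (Sg z).
apply: (@near_smooth_at _ _ _ _ _ _ _ _ (fun w => f (g w))).
  have : \forall w \near z, U (g w).
    by apply: (Ck_continuous (cg 0%N) (x := z)) => //; exact: open_nbhs_nbhs.
  by apply: filterS => w Uw; exact: Uf.
by apply: sm_precomp => //; exists U.
Qed.

(** Both derivatives are multiples of the velocity of [c], and the form is alternating. *)
Lemma pullback2_rank1 (c : R^o -> X) (h : R^o * R^o -> R^o) z : sm c -> (forall n, Ck n setT h) ->
  pullback2 om (fun w => c (h w)) z = 0.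
Proof.
move=> sc ch; have dh v : mderiv (fun w => c (h w)) z v = (ddiff h z v : R) *: mderiv c (h z) 1.
  rewrite -mderivZ// -[_ *: (1 : R^o)]/(_ * 1) mulr1.
  by apply: mderiv_precomp => //; apply: ddiffP; have [_ + _] := ch 1%N; apply.
by rewrite /pullback2 !dh (omZr som) (omZl som) (omxx som) !mulr0.
Qed.

Lemma J_eq0 (f : R^o * R^o -> X) : (forall z, pullback2 om f z = 0) -> J om f = 0.
Proof.
move=> f0; rewrite /J; under eq_fun do under eq_fun do rewrite f0.
by under eq_fun do rewrite rint0; exact: rint0.
Qed.

(** Radial approach from the open disk: identities between pull-backs known in the interior extend
    to boundary points by continuity. *)
Lemma closed_disk_approx (w : R^o * R^o) : closed_disk w ->
  (fun h : R => (1 - h) *: w) @ (0 : R)^'+ --> w /\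
  \forall h \near (0 : R)^'+, ((1 - h) *: w).1 ^+ 2 + ((1 - h) *: w).2 ^+ 2 < 1.
Proof.
case: w => a b; rewrite /closed_disk /= => ab; split.
  have h1 : (fun h : R => 1 - h : R^o) @ (0 : R)^'+ --> (1 : R^o).
    rewrite -[X in _ --> X](subr0 (1 : R)); apply: cvgB; first exact: cvg_cst.
    by apply: cvg_at_right_filter; exact: cvg_id.
  by rewrite -[X in _ --> X](scale1r (a, b)); apply: tvs_cvgZ => //; exact: cvg_cst.
near=> h.
have h0 : 0 < h by near: h; exact: nbhs_right_gt.
have h1 : h < 1 by near: h; exact: nbhs_right_lt.
rewrite -[(1 - h) *: a]/((1 - h) * a) -[(1 - h) *: b]/((1 - h) * b) !exprMn -mulrDr.
have : (1 - h) ^+ 2 < 1 by nra.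
have : 0 <= (1 - h) ^+ 2 by exact: sqr_ge0.
have : 0 <= a ^+ 2 + b ^+ 2 by rewrite addr_ge0// sqr_ge0.
by nra.
Unshelve. all: by end_near. Qed.

(* The local extensions of D have the same pull-back up to the boundary, by
   continuity from the interior; the density is then extended to the plane by
   the radial retraction. *)
Lemma disk_density (D : R^o * R^o -> X) : smooth_disk D ->
  exists H : R * R -> R, continuous H /\ forall z, closed_disk z ->
    exists U g, [/\ U z, smooth_on_open v2 aX U g, forall y, U y -> closed_disk y -> g y = D y &
      H z = pullback2 om g z].
Proof.
move=> sD.
have ex (z : R^o * R^o) : exists Ug : set (R^o * R^o) * (R^o * R^o -> X), closed_disk z ->
    [/\ Ug.1 z, smooth_on_open v2 aX Ug.1 Ug.2 & forall y, Ug.1 y -> closed_disk y -> Ug.2 y = D y].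
  have [zd|zd] := pselect (closed_disk z); last by exists (setT, D).
  by have [U [g [Uz sg gD]]] := sD _ zd; exists (U, g).
have [Ug UgP] := choice ex.
pose g z := (Ug z).2. pose G (z : R^o * R^o) : R := pullback2 om (g z) z.
have key z w : closed_disk z -> closed_disk w -> (Ug z).1 w -> G w = pullback2 om (g z) w.
  move=> zd wd Uw; have [Uz sz gz] := UgP _ zd; have [Uw' sw gw] := UgP _ wd.
  have [cw nw] := closed_disk_approx wd.
  have c1 : {for w, continuous (pullback2 om (g w) : R^o * R^o -> R^o)}.
    by apply: smooth_at_continuous; apply: pullback2_smooth => //; exists (Ug w).1.
  have c2 : {for w, continuous (pullback2 om (g z) : R^o * R^o -> R^o)}.
    by apply: smooth_at_continuous; apply: pullback2_smooth => //; exists (Ug z).1.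
  have l1 := cvg_comp_at cw c1; have l2 := cvg_comp_at cw c2.
  apply: (cvg_unique (@hausR R) l1); apply: near_cvg l2.
  have [oz _ _] := sz; have [ow _ _] := sw.
  have n1 : \forall h \near (0 : R)^'+, (Ug z).1 ((1 - h) *: w) by apply: cw; exact: open_nbhs_nbhs.
  have n2 : \forall h \near (0 : R)^'+, (Ug w).1 ((1 - h) *: w) by apply: cw; exact: open_nbhs_nbhs.
  apply: filterS3 nw n1 n2 => h dh Uz1 Uw1; apply: near_pullback2.
  have : \forall y \near (1 - h) *: w, [/\ (Ug z).1 y, (Ug w).1 y & y.1 ^+ 2 + y.2 ^+ 2 < 1].
    by apply: filterS3 (open_nbhs_nbhs (conj oz Uz1)) (open_nbhs_nbhs (conj ow Uw1))
      (open_nbhs_nbhs (conj (@open_disk R) dh)) => y.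
  by apply: filterS => y [y1 y2 /ltW y3]; rewrite /g gz// gw.
have cG : {within closed_disk, continuous (G : R * R -> R)}.
  apply/subspace_continuousP => z zd; have [Uz sz gz] := UgP _ zd; have [oz _ _] := sz.
  have c2 : {for z, continuous (pullback2 om (g z) : R^o * R^o -> R^o)}.
    by apply: smooth_at_continuous; apply: pullback2_smooth => //; exists (Ug z).1.
  move=> A /= nA; have n1 : \forall w \near z, A (pullback2 om (g z) w) by exact: c2.
  have n2 : \forall w \near z, (Ug z).1 w by exact: open_nbhs_nbhs.
  rewrite nbhs_simpl /=.
  by apply: filterS2 n1 n2 => w A1 U1 wd; change (A (G w)); rewrite (key z w zd wd U1).
pose m (z : R * R) : R := Num.max 1 (Num.sqrt (z.1 ^+ 2 + z.2 ^+ 2)).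
have m1 z : 1 <= m z by rewrite /m le_max lexx.
have cm : continuous m.
  move=> z; apply: (@continuous_max R _ (fun=> 1) (fun z : R * R => Num.sqrt (z.1 ^+ 2 + z.2 ^+ 2))); first exact: cvg_cst.
  by apply: (@continuous_cmp _ _ _ _ (@Num.sqrt R)); [exact: continuous_norm2|exact: sqrt_continuous].
have cmV : continuous (fun z => (m z)^-1).
  by move=> z; apply: cvgV; [rewrite gt_eqF// (lt_le_trans ltr01)|exact: cm].
pose ret (z : R * R) : R * R := (z.1 * (m z)^-1, z.2 * (m z)^-1).
have cret : continuous ret.
  by apply: continuous_pair; apply: continuous_mulf => //; [exact: continuous_pr1|exact: continuous_pr2].
have dret z : closed_disk (ret z).
  rewrite /closed_disk /= !exprMn -mulrDl exprVn ler_pdivrMr ?exprn_gt0 ?(lt_le_trans ltr01)// mul1r.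
  have : Num.sqrt (z.1 ^+ 2 + z.2 ^+ 2) <= m z by rewrite /m le_max lexx orbT.
  by rewrite -(ler_pXn2r (n := 2)) ?nnegrE ?sqrtr_ge0 ?(le_trans ler01)// sqr_sqrtr// addr_ge0// sqr_ge0.
exists (fun z => G (ret z)); split; first exact: within_comp_continuous cG cret dret.
move=> z zd; have [Uz sz gz] := UgP _ zd; exists (Ug z).1, (g z); split => //.
have -> : ret z = z; last by [].
have mz : m z = 1.
  by rewrite /m max_l// -(@sqrtr1 R) ler_wsqrtr.
by rewrite /ret mz invr1 !mulr1 -surjective_pairing.
Qed.

Lemma ddiff_at1 (f : R^o -> R^o) t : (forall n, Ck n setT f) -> diff_quot f t 1 h @[h --> (0 : R)^'] --> ddiff f t 1.
Proof. by move=> cf; apply: ddiffP; have [_ + _] := cf 1%N; apply. Qed.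

Section Strip.
Context (D : R^o * R^o -> X) (sD : smooth_disk D).

(** The disk swept by horizontal chords: the second coordinate fixes the height, the first runs
    along the chord from left to right. The chords at the angles [pi / 2] and [- (pi / 2)] are
    single points. [lam] keeps the abscissa between the ends of the chord, so the whole plane is
    sent into the closed disk. *)
Definition strip (z : R^o * R^o) : R^o * R^o := ((2 * lam z.1 - 1) * cos z.2, sin z.2).

Lemma CT_strip n : Ck n setT strip.
Proof. by rewrite /strip; ckt. Qed.

Lemma strip_disk z : closed_disk (strip z).
Proof.
rewrite /closed_disk /strip /=; have l0 := lam_ge0 z.1; have l1 := lam_le1 z.1.
have cs := cos2Dsin2 z.2; rewrite exprMn -[leRHS]cs lerD2r ler_piMl ?sqr_ge0//.
by move: l0 l1; move: (lam _) => l l0 l1; nra.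
Qed.

Lemma sm_strip : sm (fun z => D (strip z)).
Proof. by move=> z; apply: (smooth_on_subset_comp (S := closed_disk)) => // [n|w]; [exact: CT_strip|exact: strip_disk]. Qed.

Lemma strip_dr z : diff_quot strip z (1, 0) h @[h --> (0 : R)^'] --> ((2 * ddiff (@lam R) z.1 1 * cos z.2, 0) : (R^o * R^o)%type).
Proof.
apply: diff_quot_pair; last first.
  by apply: near_cst_cvg; near=> h; rewrite /diff_quot /= [h *: _]mulr0 addr0 subrr scaler0.
have H : (fun h => 2 * cos z.2 * diff_quot (@lam R) z.1 1 h : R^o) @ (0 : R)^' --> (2 * cos z.2 * ddiff (@lam R) z.1 1 : R^o).
  by apply: (@tvs_cvgZ _ R^o); [exact: cvg_cst|apply: ddiff_at1 => n; exact: Ck_lam].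
rewrite mulrAC; apply: near_cvg H; near=> h.
rewrite /diff_quot /= [h *: (0 : R^o)]mulr0 addr0.
by rewrite -![_ *: (_ - _)]/(_ * (_ - _)); ring.
Unshelve. all: by end_near. Qed.

Lemma strip_dv z : diff_quot strip z (0, 1) h @[h --> (0 : R)^'] --> ((- (2 * lam z.1 - 1) * sin z.2, cos z.2) : (R^o * R^o)%type).
Proof.
have dc : diff_quot (@cos R : R^o -> R^o) z.2 1 h @[h --> (0 : R)^'] --> (- sin z.2 : R^o).
  by apply: is_derive_diff_quot; exact: is_derive_cos.
have ds : diff_quot (@sin R : R^o -> R^o) z.2 1 h @[h --> (0 : R)^'] --> (cos z.2 : R^o).
  by apply: is_derive_diff_quot; exact: is_derive_sin.
apply: diff_quot_pair; last exact: ds.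
have H : (fun h => (2 * lam z.1 - 1) * diff_quot (@cos R : R^o -> R^o) z.2 1 h : R^o) @ (0 : R)^' -->
    ((2 * lam z.1 - 1) * - sin z.2 : R^o).
  by apply: (@tvs_cvgZ _ R^o); [exact: cvg_cst|exact: dc].
rewrite mulNr -mulrN; apply: near_cvg H; near=> h.
rewrite /diff_quot /= [h *: (0 : R^o)]mulr0 addr0.
by rewrite -![_ *: (_ - _)]/(_ * (_ - _)); ring.
Unshelve. all: by end_near. Qed.

(** [disk_int] applied to the density of [disk_density], followed by [s = 2 lam r - 1]: the factors
    [2 lam' r] and [cos v ^+ 2] make up the Jacobian of [strip]. *)
Lemma strip_integral : disk_integral om D =
  rint (- (pi / 2)) (pi / 2) (fun v => rint 0 1 (fun r => pullback2 om (fun z => D (strip z)) (r, v))).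
Proof.
have [H [cH HP]] := disk_density sD.
have -> : disk_integral om D = (\int[(mu \x mu)%E]_(z in [set z : R * R | (z.1 ^+ 2 + z.2 ^+ 2 < 1)%R]) H z)%R.
  apply: eq_Rintegral => z; rewrite inE /= => z1.
  have [U [g [Uz [oU _ _] gD ->]]] := HP z (ltW z1).
  apply: near_pullback2.
  have N1 : \forall y \near z, U y := open_nbhs_nbhs (conj oU Uz).
  have N2 : \forall y \near z, y.1 ^+ 2 + y.2 ^+ 2 < 1 := open_nbhs_nbhs (conj (@open_disk R) z1).
  by apply: filterS2 N1 N2 => y Uy /ltW y1; rewrite gD.
rewrite (disk_int cH); congr (rint _ _ _); apply/funext => v.
pose a (r : R^o) : R^o := 2 * lam r - 1.
have ca n : Ck n setT a by rewrite /a; ckt; exact: CT_id.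
have [da cda] := CT_derive ca.
pose k (s : R) := H (s * cos v, sin v) * cos v ^+ 2.
have ck : continuous k.
  apply: continuous_mulf; last by move=> ?; exact: cvg_cst.
  apply: (@continuous_cmp _ _ _ (fun s : R => (s * cos v, sin v)) H) => //.
  apply: continuous_pair; last by move=> ?; exact: cvg_cst.
  by apply: continuous_mulf; [move=> ?; exact: cvg_id|move=> ?; exact: cvg_cst].
have := @int_subst R k a (fun r => ddiff a r 1) 0 1 ler01 ck cda da.
have -> : a 0 = -1 by rewrite /a lam0 ?invr_ge0// mulr0 sub0r.
have -> : a 1 = 1 by rewrite /a lam1; lra.
rewrite ifT; last by lra.
move=> <-; congr (rint _ _ _); apply/funext => r.
have [U [g [Uz sU gD e]]] := HP _ (strip_disk (r, v)).
have [oU _ _] := sU.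
transitivity (pullback2 om (g \o strip) (r, v)); last first.
  apply: near_pullback2.
  have : \forall w \near (r, v), U (strip w).
    by apply: (Ck_continuous (CT_strip 0%N) (x := (r, v))) => //; exact: open_nbhs_nbhs.
  by apply: filterS => w Uw /=; rewrite gD//; exact: strip_disk.
rewrite (pullback2_jacobian som _ (@strip_dr (r, v)) (@strip_dv (r, v))); last by exists U.
rewrite -e /k /strip /= mul0r subr0.
have -> : ddiff a r 1 = 2 * ddiff (@lam R) r 1.
  apply: ddiffE.
  have G : (fun h => 2 * diff_quot (@lam R) r 1 h : R^o) @ (0 : R)^' --> (2 * ddiff (@lam R) r 1 : R^o).
    by apply: (@tvs_cvgZ _ R^o); [exact: cvg_cst|apply: ddiff_at1 => n; exact: Ck_lam].
  apply: near_cvg G; near=> h; rewrite /diff_quot /a.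
  by rewrite -![_ *: (_ - _)]/(_ * (_ - _)); ring.
by rewrite expr2; ring.
Unshelve. all: by end_near. Qed.

End Strip.
End DiskTube.

(** * The angle on the punctured plane *)

Section Circle.
Context {R : realType}.

Lemma twopi_gt0 : 0 < 2 * pi :> R.
Proof. by rewrite mulr_gt0 ?pi_gt0. Qed.

Lemma cos_circ (t : R) : cos (2 * pi * (t + 1)) = cos (2 * pi * t).
Proof.
by rewrite mulrDr mulr1 -[RHS]cosD2pi -(mulr_natl pi 2).
Qed.

Lemma sin_circ (t : R) : sin (2 * pi * (t + 1)) = sin (2 * pi * t).
Proof.
by rewrite mulrDr mulr1 -[RHS]sinD2pi -(mulr_natl pi 2).
Qed.

Lemma circle_angle (x y : R) : x ^+ 2 + y ^+ 2 = 1 -> exists t, x = cos (2 * pi * t) /\ y = sin (2 * pi * t).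
Proof.
move=> xy; have xI : -1 <= x <= 1 by apply/andP; split; nra.
have y2 : 1 - x ^+ 2 = y ^+ 2 by rewrite -xy addrC addKr.
have tp : 2 * pi != 0 :> R by rewrite gt_eqF// twopi_gt0.
have [y0|/ltW y0] := leP 0 y.
  exists (acos x / (2 * pi)); rewrite mulrC divfK// acosK// sin_acos// y2 sqrtr_sqr.
  by rewrite ger0_norm.
exists (- (acos x / (2 * pi))); rewrite mulrN mulrC divfK// cosN sinN acosK// sin_acos// y2 sqrtr_sqr.
by rewrite ler0_norm// opprK.
Qed.

(** The difference has cosine 1. Its representative [e] modulo [2 pi], or else [2 pi - e], lies in
    [[0, pi]], where [cos] is injective. *)
Lemma angle_unique (a b : R) : cos a = cos b -> sin a = sin b -> exists k : int, a = b + k%:~R * (2 * pi).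
Proof.
move=> ca sa; have c1 : cos (a - b) = 1 by rewrite cosB ca sa -!expr2 cos2Dsin2.
have tp := twopi_gt0; have pp := @pi_gt0 R.
pose k := Num.floor ((a - b) / (2 * pi)); exists k.
pose e := a - b - k%:~R * (2 * pi).
have ce : cos e = 1.
  rewrite -c1 -(periodic_int (f := @cos R) (T := 2 * pi) _ k e) ?subrK//.
  by move=> t; rewrite mulr_natl cosD2pi.
have := floor_itv ((a - b) / (2 * pi)); rewrite -/k intrD ler_pdivlMr// ltr_pdivrMr// => /andP[e0 e1].
suff : e = 0 by rewrite /e => /eqP; rewrite subr_eq0 subr_eq => /eqP; rewrite addrC.
have [ep|ep] := leP e pi.
  by apply: (@cos_inj R); rewrite ?in_itv /= ?lexx ?cos0// ?ep ?andbT /e; lra.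
have : 2 * pi - e = 0.
  apply: (@cos_inj R); rewrite ?in_itv /= ?lexx ?cos0//; first by rewrite /e in ep *; apply/andP; split; lra.
    by rewrite ltW.
  by rewrite -[RHS]ce -[RHS]cosN -[RHS]cosD2pi -(mulr_natl pi 2) addrC.
by rewrite /e; lra.
Qed.

(* An arbitrary, discontinuous choice of arg z / 2 pi; its value at the origin is junk. *)
Definition ang (z : R^o * R^o) : R :=
  xget 0 [set t | exists r, [/\ 0 < r, z.1 = r * cos (2 * pi * t) & z.2 = r * sin (2 * pi * t)]].

Lemma angP (z : R^o * R^o) : z.1 ^+ 2 + z.2 ^+ 2 != 0 ->
  exists r, [/\ 0 < r, z.1 = r * cos (2 * pi * ang z) & z.2 = r * sin (2 * pi * ang z)].
Proof.
move=> z0; rewrite /ang; set S := [set t | _].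
suff [t St] : exists t, S t by have H := xgetI 0 St; exact: H.
have n0 : 0 < z.1 ^+ 2 + z.2 ^+ 2 by rewrite lt_neqAle eq_sym z0 addr_ge0// sqr_ge0.
pose r := Num.sqrt (z.1 ^+ 2 + z.2 ^+ 2); have r0 : 0 < r by rewrite sqrtr_gt0.
have [|t [e1 e2]] := @circle_angle (z.1 / r) (z.2 / r).
  by rewrite !expr_div_n -mulrDl sqr_sqrtr ?divff// ltW.
by exists t, r; rewrite -e1 -e2 ![r * _]mulrC !divfK ?gt_eqF.
Qed.

Lemma ang_unique (z : R^o * R^o) r t : 0 < r -> z.1 = r * cos (2 * pi * t) -> z.2 = r * sin (2 * pi * t) ->
  exists k : int, ang z = t + k%:~R * 1.
Proof.
move=> r0 z1 z2.
have n2 s u : (s * cos u) ^+ 2 + (s * sin u) ^+ 2 = s ^+ 2 :> R by rewrite !exprMn -mulrDr cos2Dsin2 mulr1.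
have [|s [s0 e1 e2]] := @angP z; first by rewrite z1 z2 n2 expf_neq0// gt_eqF.
have rs : r = s.
  apply/eqP; rewrite -(@eqrXn2 _ 2)// ?ltW//; apply/eqP.
  by rewrite -(n2 r (2 * pi * t)) -(n2 s (2 * pi * ang z)) -e1 -e2 -z1 -z2.
subst s; have rn : r != 0 by rewrite gt_eqF.
have [||k e] := @angle_unique (2 * pi * ang z) (2 * pi * t).
- by apply: (mulfI rn); rewrite -e1 -z1.
- by apply: (mulfI rn); rewrite -e2 -z2.
exists k; have tp : 2 * pi != 0 :> R by rewrite gt_eqF// twopi_gt0.
by apply: (mulfI tp); rewrite e; ring.
Qed.

(** In the frame rotated by the angle of [z0], with coordinates [p] and [q], the arctangent of
    [q / p] is a smooth angle on the half-plane [p > 0]. It differs from [ang] by integers that may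
    change from point to point. *)
Lemma ang_branch (z0 : R^o * R^o) : z0.1 ^+ 2 + z0.2 ^+ 2 != 0 ->
  exists (b : R^o * R^o -> R^o) (O : set (R^o * R^o)), [/\ open O, O z0, forall n, Ck n O b &
    forall z, O z -> exists k : int, ang z = b z + k%:~R * 1].
Proof.
move=> z00; have [r0 [r00 e1 e2]] := angP z00; set t0 := ang z0 in e1 e2.
pose c := cos (2 * pi * t0) : R. pose s := sin (2 * pi * t0) : R.
have cs : c ^+ 2 + s ^+ 2 = 1 by exact: cos2Dsin2.
pose p (z : R^o * R^o) : R^o := c * z.1 + s * z.2.
pose q (z : R^o * R^o) : R^o := c * z.2 - s * z.1.
pose O := [set z | 0 < p z].
have cp n : Ck n setT p by rewrite /p; ckt.
have cq n : Ck n setT q by rewrite /q; ckt.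
have oO : open O.
  apply: (@open_comp _ _ p [set x : R^o | 0 < x]); last exact: open_gt.
  by move=> z _; exact: (Ck_continuous (cp 0%N)).
exists (fun z => t0 + (2 * pi)^-1 * atan (q z / p z)), O; split => //.
- change (0 < (c * z0.1 + s * z0.2 : R)); rewrite e1 e2 -/c -/s.
  have H (x y d : R) : x * (d * x) + y * (d * y) = d * (x ^+ 2 + y ^+ 2) by ring.
  by rewrite H cs mulr1.
- move=> n; apply: Ck_add => //; first exact: Ck_cst.
  apply: Ck_mul => //; first exact: Ck_cst.
  apply: (@Ck_comp R n _ _ _ _ _ _ (fun z => (q z / p z : R^o)) (@atan R : R^o -> R^o) O setT oO openT) => //; last exact: Ck_atan.
  apply: Ck_mul => //; first exact: Ck_subset (cq n).
  apply: (@Ck_comp R n _ _ _ _ _ _ p (fun x : R^o => x^-1 : R^o) O [set x : R^o | x != 0] oO (@open_neq0 R)).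
  + by move=> z Oz; rewrite /= gt_eqF.
  + exact: Ck_subset (cp n).
  + exact: Ck_inv.
- move=> z Oz; pose al := atan (q z / p z).
  have ca : 0 < cos al by apply: cos_gt0_pihalf; have [] := atan_def (q z / p z).
  have pn : p z != 0 by rewrite gt_eqF.
  have sa : sin al = q z / p z * cos al.
    by have [_ <-] := atan_def (q z / p z); rewrite /tan divfK// gt_eqF.
  have tp : 2 * pi != 0 :> R by rewrite gt_eqF// twopi_gt0.
  have aE : 2 * pi * (t0 + (2 * pi)^-1 * atan (q z / p z)) = 2 * pi * t0 + al.
    by rewrite mulrDr mulrA divff// mul1r.
  apply: (@ang_unique z (p z / cos al)); first by rewrite divr_gt0.
    rewrite aE cosD sa -/c -/s.
    transitivity (c * p z - s * q z); last by field; rewrite pn gt_eqF.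
    by rewrite /p /q -[LHS]mul1r -cs; ring.
  rewrite aE sinD sa -/c -/s.
  transitivity (s * p z + c * q z); last by field; rewrite pn gt_eqF.
  by rewrite /p /q -[LHS]mul1r -cs; ring.
Qed.

End Circle.

(** * Disks and spheres built from tubes, and tubes from spheres *)

Section DisksSpheres.
Context {R : realType}.
Context (F : tvsType R) {hF : hausT F} (X : manifold F) (om : form2 X).
Hypothesis som : smooth_form2 om.
Notation aX := (@atlas R F X).
Notation v2 := (@vec_atlas R (R^o * R^o)%type).
Notation sm f := (forall z, smooth_at (@vec_atlas R _) aX f z).

(** Periodicity of [f] hides the jumps of [ang], which may be replaced locally by a smooth
    branch. *)
Lemma smooth_polar V {hV : hausT V} (f : R^o * R^o -> X) (h : V -> R^o) (g : V -> R^o * R^o) w : sm f ->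
  (forall r t, f (r, t + 1) = f (r, t)) -> (forall n, Ck n setT h) -> (forall n, Ck n setT g) ->
  (g w).1 ^+ 2 + (g w).2 ^+ 2 != 0 ->
  smooth_at (@vec_atlas R V) aX (fun w => f (h w, ang (g w))) w.
Proof.
move=> sf per ch cg gw; have [b [ O [ oO Og kb bE]]] := ang_branch gw.
apply: (@near_smooth_at _ _ _ _ _ _ _ _ (fun w => f (h w, b (g w)))).
  have : \forall y \near w, O (g y).
    by apply: (Ck_continuous (cg 0%N) (x := w)) => //; exact: open_nbhs_nbhs.
  by apply: filterS => y /bE[k ->]; rewrite (periodic_int (f := fun t => f (h y, t))).
apply: (@smooth_at_comp _ _ _ _ _ _ _ _ _ _ _ v2 _ (fun w => (h w, b (g w))) f) => //; first exact: covers_vec.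
apply: smooth_at_pair_vec; first exact: sm_of_CT.
apply: (@smooth_at_comp _ _ _ _ _ _ _ _ _ _ _ v2 _ g b) => //; first exact: covers_vec.
  exact: sm_of_CT.
exact: (@smooth_at_vec _ _ _ _ O).
Qed.

(** The squared radius is smooth, and [lam] makes the map constant around the origin, where the
    angle has no smooth branch. *)
Lemma tube_disk f x0 (q : R -> X) : tube f (fun=> x0) q ->
  exists D, smooth_disk D /\ forall t : R, D (cos (2 * pi * t), sin (2 * pi * t)) = q t.
Proof.
move=> [sf per f0 f1].
pose D (w : R^o * R^o) := f (lam (w.1 * w.1 + w.2 * w.2), ang w).
have sD w : smooth_at v2 aX D w.
  have [w3|w3] := ltP (w.1 * w.1 + w.2 * w.2) 3^-1.
    apply: (@near_smooth_at _ _ _ _ _ _ _ _ (fun=> x0)); last exact: smooth_at_cst.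
    have : \forall y \near w, y.1 * y.1 + y.2 * y.2 < 3^-1.
      have cn : forall n, Ck n setT (fun w : R^o * R^o => (w.1 * w.1 + w.2 * w.2 : R^o)) by move=> n; ckt.
      exact: (Ck_continuous (cn 0%N) (x := w) I (open_nbhs_nbhs (conj (@open_lt R _) w3))).
    by apply: filterS => y /ltW y3; rewrite /D lam0// f0.
  rewrite /D; apply: (@smooth_polar (R^o * R^o)%type _ f (fun w : R^o * R^o => lam (w.1 * w.1 + w.2 * w.2) : R^o) (fun w : R^o * R^o => w) w sf per).
  - by move=> n; ckt.
  - by move=> n; ckt.
  - by rewrite !expr2 gt_eqF// (lt_le_trans _ w3)// invr_gt0.
exists D; split.
  by move=> z _; have [U Uz sU] := sD z; exists U, D.
move=> t; rewrite /D /= -!expr2 cos2Dsin2 lam1; last by lra.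
rewrite f1; have [|||k ->] := @ang_unique R (cos (2 * pi * t), sin (2 * pi * t)) 1 t; rewrite ?mul1r ?ltr01//.
by rewrite -f1 (periodic_int (f := fun t => f (1, t))) ?f1.
Qed.

Lemma CT_spherical n : Ck n setT (@spherical_coord R).
Proof. by rewrite /spherical_coord; ckt. Qed.

Lemma spherical_sphere z : sphere2 (@spherical_coord R z).
Proof.
rewrite /sphere2 /spherical_coord /= !exprMn -mulrDr cos2Dsin2 mulr1 addrC.
exact: cos2Dsin2.
Qed.

Lemma sm_spherical (u : R^o * R^o * R^o -> X) : smooth_sphere u -> sm (u \o @spherical_coord R).
Proof.
move=> su z; apply: (smooth_on_subset_comp (S := sphere2)) => // [n|w]; first exact: CT_spherical.
exact: spherical_sphere.
Qed.

Lemma sphere_integralE (u : R^o * R^o * R^o -> X) : smooth_sphere u -> sphere_integral om u =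
  rint 0 (2 * pi) (fun t => rint 0 pi (fun r => pullback2 om (u \o @spherical_coord R) (r, t))).
Proof.
move=> su; rewrite -rect_int_tr//; apply: pullback2_continuous => //; exact: sm_spherical.
Qed.

(** Spherical coordinates rescaled to the unit square; the two ends of the tube collapse to the
    poles. *)
Lemma sphere_tube (u : R^o * R^o * R^o -> X) : smooth_sphere u ->
  exists f x0 x1, tube f (fun=> x0) (fun=> x1) /\ J om f = sphere_integral om u.
Proof.
move=> su; have sus := sm_spherical su; have pp := @pi_gt0 R.
pose a (r : R^o) : R^o := pi * lam r. pose b (t : R^o) : R^o := 2 * pi * t.
have ca n : Ck n setT a by apply: CT_mul; [exact: CT_cst|exact: Ck_lam].
have cb n : Ck n setT b by apply: CT_mul; [exact: CT_cst|exact: CT_id].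
pose g (z : R^o * R^o) := u (spherical_coord (a z.1, z.2)).
have sg : sm g by apply: (@sm_rescale _ _ _ _ (u \o @spherical_coord R) a (fun t => t)) => // n; exact: CT_id.
pose f (z : R^o * R^o) := g (z.1, b z.2).
have sf : sm f by exact: (@sm_rescale _ _ _ _ (u \o @spherical_coord R) a b).
have l0 : lam 0 = 0 :> R by rewrite lam0 ?invr_ge0.
have l1 : lam 1 = 1 :> R by rewrite lam1//; lra.
have b1 r t : f (r, t + 1) = f (r, t) by rewrite /f /g /spherical_coord /b /= cos_circ sin_circ.
exists f, (u (0, 0, 1)), (u (0, 0, -1)); split.
  split => //.
  - by move=> t; rewrite /f /g /spherical_coord /a /= l0 mulr0 sin0 cos0 !mul0r.
  - by move=> t; rewrite /f /g /spherical_coord /a /= l1 mulr1 sinpi cospi !mul0r.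
have b0 : b 0 = 0 by rewrite /b mulr0.
have bT : b 1 = 2 * pi by rewrite /b mulr1.
have b01 : b 0 <= b 1 by rewrite b0 bT ltW// twopi_gt0.
have a0 : a 0 = 0 by rewrite /a l0 mulr0.
have a1 : a 1 = pi by rewrite /a l1 mulr1.
have E1 := @int_pullback_t _ _ _ _ _ som g b 0 1 0 1 sg cb ler01 b01 ler01.
have E2 t := @int_pullback_r _ _ _ _ _ som (u \o @spherical_coord R) a 0 1 t sus ca ler01.
rewrite (sphere_integralE su) /J; etransitivity; first exact: E1.
rewrite b0 bT; congr (rint _ _ _); apply/funext => t.
by etransitivity; [exact: E2|rewrite a0 a1 ltW].
Qed.

(** [h] goes from 0 at the north pole to 1 at the south pole, and the longitude supplies [t];
    through [lam] the map is constant near both poles. In spherical coordinates it becomes [f]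
    rescaled by [a] and [b], so the areas agree by substitution. *)
Lemma tube_sphere f x0 x1 : tube f (fun=> x0) (fun=> x1) ->
  exists2 u : R^o * R^o * R^o -> X, smooth_sphere u & J om f = sphere_integral om u.
Proof.
move=> [sf per f0 f1]; have pp := @pi_gt0 R; have tp := @twopi_gt0 R.
pose h (p : R^o * R^o * R^o) : R^o := (1 - p.2) / 2.
have ch n : Ck n setT h by rewrite /h; ckt.
have ch0 : continuous h by move=> p; exact: (Ck_continuous (ch 0%N)).
pose u (p : R^o * R^o * R^o) := f (lam (h p), ang p.1).
have su : smooth_sphere u.
  move=> p Sp; suff [U Up sU] : smooth_at (@vec_atlas R (R^o * R^o * R^o)%type) aX u p by exists U, u.
  have [p0|p0] := eqVneq (p.1.1 ^+ 2 + p.1.2 ^+ 2) 0; last first.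
    apply: (@smooth_polar _ _ f (fun p => lam (h p)) (fun p => p.1)) => // n; last by ckt.
    by apply: CT_lam; exact: ch.
  have : p.2 ^+ 2 = 1 by rewrite -Sp p0 add0r.
  move/eqP; rewrite sqrf_eq1 => /orP[/eqP p1|/eqP p1].
    apply: (@near_smooth_at _ _ _ _ _ _ _ _ (fun=> x0)); last exact: smooth_at_cst.
    have hp : h p < 3^-1 by rewrite /h p1 subrr mul0r invr_gt0.
    have : \forall w \near p, h w < 3^-1 := ch0 p _ (open_nbhs_nbhs (conj (@open_lt R _) hp)).
    by apply: filterS => w /ltW wh; rewrite /u lam0// f0.
  apply: (@near_smooth_at _ _ _ _ _ _ _ _ (fun=> x1)); last exact: smooth_at_cst.
  have hp : 2 / 3 < h p by rewrite /h p1; lra.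
  have : \forall w \near p, 2 / 3 < h w := ch0 p _ (open_nbhs_nbhs (conj (@open_gt R _) hp)).
  by apply: filterS => w /ltW wh; rewrite /u lam1// f1.
exists u => //.
pose a (r : R^o) : R^o := lam ((1 - cos r) / 2). pose b (t : R^o) : R^o := (2 * pi)^-1 * t.
have ca n : Ck n setT a by rewrite /a; ckt; exact: CT_id.
have cb n : Ck n setT b by apply: CT_mul; [exact: CT_cst|exact: CT_id].
pose g (z : R^o * R^o) := f (a z.1, z.2).
have sg : sm g by apply: (@sm_rescale _ _ _ _ f a (fun t => t)) => // n; exact: CT_id.
pose fb (z : R^o * R^o) := g (z.1, b z.2).
have sg2 : sm fb by exact: (@sm_rescale _ _ _ _ f a b).
have a0 : a 0 = 0 by rewrite /a cos0 subrr mul0r lam0 ?invr_ge0.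
have a1 : a pi = 1 by rewrite /a cospi opprK lam1//; lra.
have sus := sm_spherical su.
rewrite (sphere_integralE su).
have b0 : b 0 = 0 by rewrite /b mulr0.
have bT : b (2 * pi) = 1 by rewrite /b mulVf ?gt_eqF.
have bE t : 2 * pi * b t = t by rewrite /b mulrA divff ?gt_eqF// mul1r.
have b01 : b 0 <= b (2 * pi) by rewrite b0 bT ler01.
have E1 := @int_pullback_t _ _ _ _ _ som g b 0 (2 * pi) 0 pi sg cb (ltW tp) b01 (ltW pp).
have E2 t := @int_pullback_r _ _ _ _ _ som f a 0 pi t sf ca (ltW pp).
transitivity (rint 0 (2 * pi) (fun t => rint 0 pi (fun r => pullback2 om fb (r, t)))).
  symmetry; etransitivity; first exact: E1.
  rewrite b0 bT; congr (rint _ _ _); apply/funext => t.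
  by etransitivity; [exact: E2|rewrite a0 a1 ler01].
clear E1 E2.
(* At the poles [sin w.1] vanishes and [ang] is arbitrary, hence the restriction to the open
   interval. *)
congr (rint _ _ _); apply/funext => t; apply: eq_int_oo.
- exact: (section_r (t := t) (pullback2_continuous som sg2)).
- exact: (section_r (t := t) (pullback2_continuous som sus)).
move=> r /andP[r0 r1]; apply: near_pullback2.
have : \forall w \near (r, t), 0 < w.1 < pi.
  apply: filterS2 (@near_lt1 _ (r, t) _ r1) (@near_gt1 _ (r, t) _ r0) => w w1 w2.
  exact: introT andP (conj w2 w1).
apply: filterS => w /sin_gt0_pi sw; rewrite /u /= /spherical_coord /h /=.
have [|||k ->] := @ang_unique R (sin w.1 * cos w.2, sin w.1 * sin w.2) (sin w.1) (b w.2); rewrite ?bE//.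
by rewrite (periodic_int (f := fun t => f (lam ((1 - cos w.1) / 2), t))).
Qed.

End DisksSpheres.

(** * Tubes built from disks *)

Section DiskToTube.
Context {R : realType}.
Context (F : tvsType R) {hF : hausT F} (X : manifold F) (om : form2 X).
Hypothesis som : smooth_form2 om.
Notation aX := (@atlas R F X).
Notation v2 := (@vec_atlas R (R^o * R^o)%type).
Notation sm f := (forall z, smooth_at (@vec_atlas R _) aX f z).

Let par (n : int) : bool := (n %% 2)%Z == 0.
Let parS n : par (n + 1) = ~~ par n. Proof. by rewrite /par; lia. Qed.

Lemma floor_double (t : R) : Num.floor (2 * (t + 1)) = Num.floor (2 * t) + 2.
Proof.
by have -> : 2 * (t + 1) = 2 * t + (2%:Z)%:~R; [rewrite -[2%:Z%:~R]/(2 : R); ring|exact: floorDint].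
Qed.

Lemma floor_double0 (s : R) : 0 <= s < 2^-1 -> Num.floor (2 * s) = 0.
Proof. by move=> /andP[? ?]; apply: floor_def; rewrite /= mulr0z add0r mulr1z; apply/andP; split; lra. Qed.

Lemma floor_double1 (s : R) : 2^-1 <= s < 1 -> Num.floor (2 * s) = 1.
Proof. by move=> /andP[? ?]; apply: floor_def; rewrite intrD mulr1z; apply/andP; split; lra. Qed.

Lemma floor_frac (t : R) : 0 <= t - (Num.floor t)%:~R < 1.
Proof. by have := floor_itv t; rewrite intrD => /andP[? ?]; apply/andP; split; lra. Qed.

Section Boundary.
Context (c : R^o -> X) (sc : sm c).

(* The tube c ((1 - lam r) a + lam r b) has rank 1, so that it carries no area. *)
Lemma rank1_tube (a b : R^o -> R^o) : (forall n, Ck n setT a) -> (forall n, Ck n setT b) ->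
  (forall r t, c ((1 - lam r) * a (t + 1) + lam r * b (t + 1)) = c ((1 - lam r) * a t + lam r * b t)) ->
  exists2 f, tube f (fun t => c (a t)) (fun t => c (b t)) & J om f = 0.
Proof.
move=> ca cb per; pose h (z : R^o * R^o) : R^o := (1 - lam z.1) * a z.2 + lam z.1 * b z.2.
have ch n : Ck n setT h.
  have ca2 : Ck n setT (fun z : R^o * R^o => a z.2) by apply: CT_comp; [exact: ca|exact: CT_snd].
  have cb2 : Ck n setT (fun z : R^o * R^o => b z.2) by apply: CT_comp; [exact: cb|exact: CT_snd].
  by apply: CT_add; apply: CT_mul => //; ckt.
exists (fun z => c (h z)); last by apply: J_eq0 => z; exact: pullback2_rank1.
split.
- by move=> z; exact: (@sm_precomp _ _ _ _ _ _ _ _ _ c h).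
- by move=> r t; exact: per.
- by move=> t; rewrite /h /= lam0 ?invr_ge0// subr0 mul1r mul0r addr0.
- by move=> t; rewrite /h /= lam1 ?subrr ?mul0r ?add0r ?mul1r//; lra.
Qed.

End Boundary.

(** [D \o strip] need not be 1-periodic in [v]. It is closed up by letting [v] increase during the
    first half of the period and return along the left boundary, independently of [r], during the
    second half; the return has rank 1, hence no area. At [r = 0] the tube goes up and down the left
    half circle, a loop contracted by the rank 1 tube [g1]; at [r = 1] it goes once around the
    circle, and the rank 1 tube [g3] corrects the parametrisation. *)
Lemma disk_tube (D : R^o * R^o -> X) : smooth_disk D -> exists f x0,
  tube f (fun=> x0) (fun t => D (cos (2 * pi * t), sin (2 * pi * t))) /\ J om f = disk_integral om D.
Proof.
move=> sD; have pp := @pi_gt0 R; have pn : pi != 0 :> R by rewrite gt_eqF.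
have e21 : 2 - 1 = 1 :> R by ring.
have l0 : lam 0 = 0 :> R by rewrite lam0 ?invr_ge0.
have l1 : lam 1 = 1 :> R by rewrite lam1//; lra.
pose f1 (z : R^o * R^o) := D (strip z).
have sf1 : sm f1 by exact: sm_strip.
have top r : f1 (r, pi / 2) = D (0, 1) by rewrite /f1 /strip /= cos_pihalf mulr0 sin_pihalf.
have bot r : f1 (r, - (pi / 2)) = D (0, -1) by rewrite /f1 /strip /= cos_pihalfN mulr0 sinN sin_pihalf.
pose up (t : R^o) : R^o := - (pi / 2) + pi * t. pose dn (t : R^o) : R^o := pi / 2 - pi * t.
have up0 : up 0 = - (pi / 2) by rewrite /up mulr0 addr0.
have up1 : up 1 = pi / 2 by rewrite /up mulr1; field.
have dn0 : dn 0 = pi / 2 by rewrite /dn mulr0 subr0.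
have dn1 : dn 1 = - (pi / 2) by rewrite /dn mulr1; field.
have cup n : Ck n setT up by rewrite /up; ckt; exact: CT_id.
have cdn n : Ck n setT dn by rewrite /dn; ckt; exact: CT_id.
(* Even pieces sweep the chords upwards, odd pieces come back along the left ends. *)
pose k (n : int) (z : R^o * R^o) := if par n then f1 (z.1, up z.2) else f1 (0, dn z.2).
have sk n z : smooth_at v2 aX (k n) z.
  rewrite /k; case: (par n).
    apply: (@sm_precomp _ _ _ _ _ _ _ _ _ f1 (fun z : R^o * R^o => (z.1, up z.2))) => // m.
    by apply: CT_pair; [exact: CT_fst|apply: CT_comp; [exact: cup|exact: CT_snd]].
  apply: (@sm_precomp _ _ _ _ _ _ _ _ _ f1 (fun z : R^o * R^o => (0, dn z.2))) => // m.
  by apply: CT_pair; [exact: CT_cst|apply: CT_comp; [exact: cdn|exact: CT_snd]].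
have mk n r : k n (r, 1) = k (n + 1) (r, 0).
  by rewrite /k parS; case: (par n); rewrite /= ?up0 ?up1 ?dn0 ?dn1 ?top ?bot.
pose fl (t : R) : R := lam (2 * t - (Num.floor (2 * t))%:~R).
pose F0 (z : R^o * R^o) := k (Num.floor (z.2 : R)) (z.1, lam (z.2 - (Num.floor (z.2 : R))%:~R)).
have sF0 : sm F0 by exact: (@smooth_chain R R^o F _ _ X aX k sk mk).
pose f2 (z : R^o * R^o) := F0 (z.1, 2 * z.2).
have cd n : Ck n setT (fun t : R^o => 2 * t : R^o) by apply: CT_mul; [exact: CT_cst|exact: CT_id].
have sf2 : sm f2 by apply: (@sm_rescale _ _ _ _ F0 (fun r => r) (fun t => 2 * t)) => // n; exact: CT_id.
have f2E r t : f2 (r, t) = k (Num.floor (2 * t)) (r, fl t) by [].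
have flS t : fl (t + 1) = fl t.
  rewrite /fl floor_double intrD; congr lam.
  by rewrite -[2%:~R]/(2 : R); ring.
have parD n : par (n + 2) = par n by rewrite /par; lia.
have per r t : f2 (r, t + 1) = f2 (r, t) by rewrite !f2E /k /= flS floor_double parD.
pose bk (n : int) (z : R^o * R^o) : R^o := if par n then up z.2 else dn z.2.
pose be (t : R^o) : R^o := bk (Num.floor (2 * t : R)) (0, fl t).
have sbe : forall n, Ck n setT be.
  have sb n z : smooth_at v2 (@vec_atlas R R^o) (bk n) z.
    apply: sm_of_CT => m; rewrite /bk; case: (par n).
      by apply: CT_comp; [exact: cup|exact: CT_snd].
    by apply: CT_comp; [exact: cdn|exact: CT_snd].
  have mb n (r : R^o) : bk n (r, 1) = bk (n + 1) (r, 0).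
    by rewrite /bk parS; case: (par n); rewrite /= ?up0 ?up1 ?dn0 ?dn1.
  pose B0 (z : R^o * R^o) : R^o := bk (Num.floor (z.2 : R)) (z.1, lam (z.2 - (Num.floor (z.2 : R))%:~R)).
  have sc n : Ck n setT B0.
    by apply: CT_of_sm => z; exact: (@smooth_chain R R^o R^o _ _ R^o (@vec_atlas R R^o) bk sb mb).
  move=> n.
  apply: (@Ck_comp R n _ _ _ _ _ _ (fun t : R^o => (0, 2 * t) : (R^o * R^o)%type) B0 setT setT openT openT) => //.
  by apply: CT_pair; [exact: CT_cst|exact: cd].
have beS t : be (t + 1) = be t by rewrite /be /bk /= flS floor_double parD.
have f20 t : f2 (0, t) = f1 (0, be t) by rewrite f2E /k /be /bk /=; case: (par _).
have s0 : sm (fun v : R^o => f1 (0, v)).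
  move=> z; apply: (@sm_precomp _ _ _ _ _ _ _ _ _ f1 (fun v : R^o => (0, v) : (R^o * R^o)%type)) => // n.
  by apply: CT_pair; [exact: CT_cst|exact: CT_id].
have [g1 tg1 Jg1] : exists2 f, tube f (fun=> f1 (0, - (pi / 2))) (fun t => f1 (0, be t)) & J om f = 0.
  apply: (@rank1_tube (fun v => f1 (0, v)) s0 (fun=> - (pi / 2)) be) => // [n|r t]; first exact: CT_cst.
  by rewrite beS.
have [rho [crho rhoS rhoE]] := @CT_stairs R (fun t => t) 2 (fun n => @CT_id R n R^o _) erefl erefl isT.
pose c (t : R^o) := D (cos (2 * pi * t), sin (2 * pi * t)).
have sc : sm c.
  move=> z; apply: (smooth_on_subset_comp (S := closed_disk) (g := fun t : R^o => (cos (2 * pi * t), sin (2 * pi * t)) : (R^o * R^o)%type)) => //.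
    by move=> n; ckt; exact: CT_id.
  by move=> w; rewrite /closed_disk /= cos2Dsin2.
have cS t : c (t + 1) = c t by rewrite /c cos_circ sin_circ.
(* The circuit starts at the bottom point [(0, -1)], a quarter turn before angle 0; [rho], with two
   steps per period, is the pace along the two half circles. *)
pose rh (t : R^o) : R^o := rho t - 4^-1.
have crh n : Ck n setT rh by apply: CT_sub; [exact: crho|exact: CT_cst].
have [g3 tg3 Jg3] : exists2 f, tube f (fun t => c (rh t)) (fun t => c t) & J om f = 0.
  apply: rank1_tube => // [n|r t]; first exact: CT_id.
  rewrite -[RHS]cS /rh rhoS; congr c; ring.
have f21 t : f2 (1, t) = c (rh t).
  have f01 (s : R) : 0 <= s < 1 -> f2 (1, s) = c (rh s).
    move=> /andP[sg0 sg1]; rewrite f2E /c /rh rhoE -/(fl s) /k.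
    have [s2|s2] := ltP s 2^-1.
      have -> : Num.floor (2 * s) = 0 by apply: floor_double0; rewrite sg0.
      rewrite /f1 /strip /= l1 mulr1 e21 mul1r.
      by congr (D (cos _, sin _)); rewrite /up; field.
    have -> : Num.floor (2 * s) = 1 by apply: floor_double1; rewrite s2.
    rewrite /f1 /strip /= l0 mulr0 sub0r mulN1r.
    have -> : 2 * pi * (2^-1 * (1%:~R + fl s) - 4^-1) = pi - dn (fl s) by rewrite /dn mulr1z; field.
    by congr (D (_, _)); rewrite ?cosB ?sinB cospi sinpi; ring.
  have := f01 _ (floor_frac t).
  have := periodic_int (f := fun t => f2 (1, t)) (per 1) (Num.floor t) (t - (Num.floor t)%:~R).
  have cr s : c (rh (s + 1)) = c (rh s) by rewrite -[RHS]cS /rh rhoS; congr c; ring.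
  have := periodic_int (f := fun t => c (rh t)) cr (Num.floor t) (t - (Num.floor t)%:~R).
  by rewrite mulr1 subrK => -> ->.
have t2 : tube f2 (fun t => f1 (0, be t)) (fun t => c (rh t)) by split.
have cI : continuous (fun t => rint 0 1 (fun r => pullback2 om f2 (r, t))).
  by apply: int_param_continuous; [exact: ler01|exact: pullback2_continuous].
have J2 : J om f2 = disk_integral om D.
  have h0 : 0 <= 2^-1 :> R by rewrite invr_ge0.
  have h1 : 2^-1 <= 1 :> R by rewrite invf_le1// ler1n.
  rewrite /J (int_cat h0 h1 cI).
  have -> : rint 2^-1 1 (fun t => rint 0 1 (fun r => pullback2 om f2 (r, t))) = 0.
    transitivity (rint 2^-1 1 (fun=> 0 : R)); last exact: rint0.
    apply: eq_int_oo => [||t /andP[t1 t2']]; first exact: cI.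
      by move=> ?; exact: cvg_cst.
    transitivity (rint 0 1 (fun=> 0 : R)); last exact: rint0.
    apply: eq_int => r _.
    transitivity (pullback2 om (fun z : R^o * R^o => f1 (0, dn (lam (2 * z.2 - 1)))) (r, t)); last first.
      apply: (@pullback2_rank1 _ _ _ _ _ som (fun v => f1 (0, v)) (fun z : R^o * R^o => dn (lam (2 * z.2 - 1)))) => // n.
      by apply: CT_comp; [exact: cdn|ckt].
    apply: near_pullback2.
    have : \forall w \near (r, t), 2^-1 < w.2 < 1 by apply: near_snd_oo; rewrite t1.
    apply: filterS => -[u w] /= /andP[w1 w2].
    have fw : Num.floor (2 * w) = 1 by apply: floor_double1; rewrite w2 andbT; exact: ltW w1.
    by rewrite f2E /fl fw mulr1z.
  pose b (t : R^o) : R^o := up (lam (2 * t)).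
  have cb n : Ck n setT b by apply: CT_comp; [exact: cup|apply: CT_lam; exact: cd].
  have b0 : b 0 = - (pi / 2) by rewrite /b mulr0 l0 up0.
  have b1 : b 2^-1 = pi / 2 by rewrite /b mulfV// l1 up1.
  etransitivity; first exact: addr0.
  rewrite (strip_integral som sD) -b0 -b1.
  have bb : b 0 <= b 2^-1 by rewrite b0 b1 ge0_cp// pihalf_ge0.
  have E1 := @int_pullback_t _ _ _ _ _ som f1 b 0 2^-1 0 1 sf1 cb h0 bb ler01.
  etransitivity; last exact: E1.
  clear E1; pose fb (z : R^o * R^o) := f1 (z.1, b z.2).
  have sfb : sm fb by apply: (@sm_rescale _ _ _ _ f1 (fun r => r) b) => // n; exact: CT_id.
  apply: eq_int_oo => [||t /andP[t1 t2']]; first exact: cI.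
    by apply: int_param_continuous; [exact: ler01|exact: (pullback2_continuous som sfb)].
  apply: eq_int => r _; apply: near_pullback2.
  have : \forall w \near (r, t), 0 < w.2 < 2^-1 by apply: near_snd_oo; rewrite t1.
  apply: filterS => -[u w] /= /andP[w1 w2].
  have fw : Num.floor (2 * w) = 0 by apply: floor_double0; rewrite w2 andbT; exact: ltW w1.
  by rewrite f2E /fl fw mulr0z subr0.
exists (tube_cat g1 (tube_cat f2 g3)), (f1 (0, - (pi / 2))); split.
  exact: tube_catP tg1 (tube_catP t2 tg3).
by rewrite (J_cat som tg1 (tube_catP t2 tg3)) (J_cat som t2 tg3) Jg1 Jg3 J2 add0r addr0.
Qed.

End DiskToTube.

(** * The action homomorphism *)

Section Homotopy.
Context {R : realType} (T : topologicalType) (x : T).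
Implicit Types p q : loop (R := R) x.

Definition loop_of (f : R -> T) (cf : continuous f) (f0 : f 0 = x) (f1 : f 1 = x) : loop x :=
  Loop (continuous_subspaceT cf) f0 f1.

Lemma loop_homotopic_of p q (H : R * R -> T) : continuous H ->
  (forall t, 0 <= t <= 1 -> H (0, t) = p t) -> (forall t, 0 <= t <= 1 -> H (1, t) = q t) ->
  (forall s, 0 <= s <= 1 -> H (s, 0) = x /\ H (s, 1) = x) -> loop_homotopic p q.
Proof.
move=> cH H0 H1 Hs; exists H; split => //; first exact: continuous_subspaceT.
by move=> t t01; rewrite H0// H1.
Qed.

Lemma loop_homotopicE p q : loop_homotopic p q -> exists H : R * R -> T, [/\ continuous H,
  forall t, 0 <= t <= 1 -> H (0, t) = p t, forall t, 0 <= t <= 1 -> H (1, t) = q t &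
  forall s, H (s, 0) = x /\ H (s, 1) = x].
Proof.
move=> [H [cH H01 Hs]]; exists (fun z => H (clamp z.1, clamp z.2)); split.
- apply: (within_comp_continuous cH) => [|z]; last by split; rewrite /= in_itv /= clamp_itv.
  apply: continuous_pair; apply: continuous_cmp (@clamp_continuous R); [exact: continuous_pr1|exact: continuous_pr2].
- by move=> t t01; rewrite /= clamp0// clamp_id//; case: (H01 _ t01).
- by move=> t t01; rewrite /= (@clamp1 _ 1)// clamp_id//; case: (H01 _ t01).
- by move=> s; rewrite /= (@clamp0 _ 0)// (@clamp1 _ 1)//; exact: Hs (clamp_itv s).
Qed.

Lemma loop_homotopic_refl p : loop_homotopic p p.
Proof.
apply: (@loop_homotopic_of p p (fun z => p (clamp z.2))).
- apply: (within_comp_continuous (@loop_continuous _ _ _ p)) => [|z]; last by rewrite /= in_itv /= clamp_itv.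
  by apply: continuous_cmp (@clamp_continuous R); exact: continuous_pr2.
- by move=> t t01; rewrite /= clamp_id.
- by move=> t t01; rewrite /= clamp_id.
- by move=> s _; rewrite /= clamp0// clamp1// loop0 loop1.
Qed.

Lemma continuous_compl1 : continuous (fun s : R => 1 - s).
Proof. by move=> s; apply: cvgB; [exact: cvg_cst|exact: cvg_id]. Qed.

Lemma loop_homotopic_sym p q : loop_homotopic p q -> loop_homotopic q p.
Proof.
move=> /loop_homotopicE[H [cH H0 H1 Hs]]; apply: (@loop_homotopic_of _ _ (fun z => H (1 - z.1, z.2))).
- apply: continuous_cmp cH; apply: continuous_pair; last exact: continuous_pr2.
  by apply: continuous_cmp continuous_compl1; exact: continuous_pr1.
- by move=> t t01; rewrite /= subr0 H1.
- by move=> t t01; rewrite /= subrr H0.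
- by move=> s _; exact: Hs.
Qed.

Lemma loop_homotopic_trans p q r : loop_homotopic p q -> loop_homotopic q r -> loop_homotopic p r.
Proof.
move=> /loop_homotopicE[H [cH H0 H1 Hs]] /loop_homotopicE[K [cK K0 K1 Ks]].
(* A bi-infinite chain: [H] and [K] are the pieces 0 and 1, constant homotopies at [p] and [r]
   complete it on both sides. Time [2 s] ends exactly at the start of piece 2. The homotopy
   parameter comes second in a chain, hence the swapped coordinates. *)
pose k (n : int) (z : R * R) := if n == 0 then H (clamp z.2, clamp z.1) else
  if n == 1 then K (clamp z.2, clamp z.1) else if (n < 0)%R then p (clamp z.1) else r (clamp z.1).
have cc1 : continuous (fun z : R * R => clamp z.1) by apply: continuous_cmp (@clamp_continuous R); exact: continuous_pr1.
have cc2 : continuous (fun z : R * R => clamp z.2) by apply: continuous_cmp (@clamp_continuous R); exact: continuous_pr2.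
have cl (l : loop x) : continuous (fun z : R * R => l (clamp z.1)).
  by apply: (within_comp_continuous (@loop_continuous _ _ _ l)) => // z; rewrite /= in_itv /= clamp_itv.
have ck n : continuous (k n).
  have c21 : continuous (fun z : R * R => (clamp z.2, clamp z.1)) by exact: continuous_pair.
  rewrite /k; case: (n == 0); first exact: (@continuous_cmp _ _ _ (fun z : R * R => (clamp z.2, clamp z.1)) H).
  case: (n == 1); first exact: (@continuous_cmp _ _ _ (fun z : R * R => (clamp z.2, clamp z.1)) K).
  by case: (n < 0)%R; exact: cl.
have c0 : clamp 0 = 0 :> R by rewrite clamp0. have c1 : clamp 1 = 1 :> R by rewrite clamp1.
have mk n s : k n (s, 1) = k (n + 1) (s, 0).
  rewrite /k /= c0 c1; have sI := clamp_itv s.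
  have [->|n0] := eqVneq n 0; first by rewrite add0r /= H1// K0.
  have [->|n1] := eqVneq n 1; first by rewrite /= K1.
  have [->|n2] := eqVneq n (-1); first by rewrite /= H0.
  have -> : (n + 1 == 0) = false by lia.
  have -> : (n + 1 == 1) = false by lia.
  by have -> : (n + 1 < 0) = (n < 0) by lia.
have cL := continuous_chain ck mk.
have fl0 : Num.floor (0 : R) = 0 by apply: floor_def; rewrite mulr0z lexx add0r mulr1z ltr01.
have fl2 : Num.floor (2 * 1 : R) = 2 by apply: floor_def; rewrite mulr1 intrD mulr1z -[2%:~R]/(2 : R); apply/andP; split; lra.
apply: (@loop_homotopic_of _ _ (fun z => k (Num.floor (2 * z.1)) (z.2, 2 * z.1 - (Num.floor (2 * z.1))%:~R))).
- apply: (@continuous_cmp _ _ _ (fun z : R * R => (z.2, 2 * z.1)) _ _ cL).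
  by apply: continuous_pair; [exact: continuous_pr2|apply: continuous_mul; exact: continuous_pr1].
- by move=> t t01; rewrite /= mulr0 fl0 mulr0z subr0 /k /= c0 H0 ?clamp_itv// clamp_id.
- by move=> t t01; rewrite /= fl2 /k /= clamp_id.
- move=> s _; rewrite /k /= c0 c1 !loop0 !loop1.
  by case: (Num.floor _ == 0) => //; case: (Num.floor _ == 1) => //; case: (Num.floor _ < 0)%R.
Qed.

Lemma pi1_classP p q : pi1_class p = pi1_class q <-> loop_homotopic p q.
Proof.
split=> [e|pq].
  have e' : [set r | loop_homotopic p r] = [set r | loop_homotopic q r] := f_equal (@proj1_sig _ _) e.
  have : [set r | loop_homotopic q r] q by exact: loop_homotopic_refl.
  by rewrite -e'.
apply: eq_exist; apply/seteqP; split => r /=; last exact: loop_homotopic_trans.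
by apply: loop_homotopic_trans; exact: loop_homotopic_sym.
Qed.

Lemma pi1_reprK (a : @pi1 R T x) : pi1_class (pi1_repr a) = a.
Proof.
case: a => C CP; apply: eq_exist; rewrite /pi1_repr.
by case: (cid _) => p /= ->.
Qed.

End Homotopy.

(** * Values of the action and their independence of the choices *)

Section ActionHomomorphism.
Context {R : realType}.
Context (E F : tvsType R) {hE : hausT E} {hF : hausT F} (G : lieGroup E) (X : manifold F).
Context (om : form2 X) (act : G -> X -> X) (mu : E -> X -> R).
Hypotheses (som : smooth_form2 om) (act_smooth : smooth_action act)
  (act_om : preserves_form om act) (mu_moment : equivariant_moment_map om act mu).
Hypotheses (X_nonempty : [set: X] !=set0) (X_connected : connected [set: X])
  (X_pi1 : forall x : X, @pi1_trivial R X x).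
Notation "x ** y" := (lie_mul x y) (at level 40, left associativity).
Notation "x ^I" := (lie_inv x) (at level 3).
Notation one := (lie_one G).
Notation aG := (@atlas R E G).
Notation aX := (@atlas R F X).
Notation smG f := (forall z, smooth_at (@vec_atlas R _) aG f z).
Notation smX f := (forall z, smooth_at (@vec_atlas R _) aX f z).
Notation P := (spherical_periods om).

Lemma periodsP r : P r <-> exists f x0 x1, tube f (fun=> x0) (fun=> x1) /\ r = J om f.
Proof.
split=> [[u su ->]|[f [x0 [x1 [tf ->]]]]].
  by have [f [x0 [x1 [tf <-]]]] := sphere_tube som su; exists f, x0, x1.
by have [u su ->] := tube_sphere som tf; exists u.
Qed.

(** These tubes of area 0 allow spheres with different poles to be concatenated, and the base point
    of an orbit to be moved. *)
Lemma path_tube (x y : X) : exists2 f, tube f (fun=> x) (fun=> y) & J om f = 0.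
Proof.
have [g [sg g0 g1]] := smooth_path_ex x y X_connected.
exists (fun z => g z.1); last exact: J_path.
by rewrite -g0 -g1; exact: tube_path.
Qed.

(** The difference of two periods is the area of the first tube, followed by a path to the end of
    the second and by the second one reversed. *)
Lemma periods_subgroup : additive_subgroup P.
Proof.
have [x _] := X_nonempty; split.
  by apply/periodsP; have [f tf <-] := path_tube x x; exists f, x, x.
move=> r s /periodsP[f [x0 [x1 [tf ->]]]] /periodsP[g [y0 [y1 [tg ->]]]].
have [h th Jh] := path_tube x1 y1.
have tr : tube (fun z : R^o * R^o => g (1 - z.1, z.2)) (fun=> y1) (fun=> y0) by exact: tube_rev.
have thr : tube (tube_cat h (fun z : R^o * R^o => g (1 - z.1, z.2))) (fun=> x1) (fun=> y0) by exact: tube_catP th tr.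
apply/periodsP; exists (tube_cat f (tube_cat h (fun z => g (1 - z.1, z.2)))), x0, y0; split.
  exact: tube_catP tf thr.
have [sg _ _ _] := tg.
by rewrite (J_cat som tf thr) (J_cat som th tr) Jh add0r J_rev.
Qed.

Lemma tube_diff f g x0 x1 (q : R -> X) : tube f (fun=> x0) q -> tube g (fun=> x1) q -> P (J om f - J om g).
Proof.
move=> tf tg; have tr : tube (fun z : R^o * R^o => g (1 - z.1, z.2)) q (fun=> x1) by exact: tube_rev.
have [sg _ _ _] := tg.
apply/periodsP; exists (tube_cat f (fun z => g (1 - z.1, z.2))), x0, x1; split.
  exact: tube_catP tf tr.
by rewrite (J_cat som tf tr) J_rev.
Qed.

Lemma smooth_loop_sm (phi : R -> G) : smooth_loop phi -> smG (phi : R^o -> G).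
Proof. by move=> [sp _ _]; exact: ((smooth_atT _ _ _).1 sp). Qed.

Lemma sm_orbit (phi : R -> G) x : smooth_loop phi -> smX (fun t : R^o => act (phi t) x).
Proof. by move=> sl z; apply: sm_act => //; [exact: smooth_loop_sm|exact: smooth_at_cst]. Qed.

(* The values of A_mu, with tubes contracting the loop phi_t x in place of disks. *)
Definition action_values (phi : R -> G) (x : X) : set R := [set r | exists f x0,
  tube f (fun=> x0) (fun t => act (phi t) x) /\ r = J om f - mu_integral act mu phi x].

(** By [X_pi1] the orbit is homotopic to the constant loop, and [null_tube] smooths the homotopy. *)
Lemma orbit_tube (phi : R -> G) x : smooth_loop phi -> exists f, tube f (fun=> x) (fun t => act (phi t) x).
Proof.
move=> sl; have so := sm_orbit x sl; have [_ per p0] := sl.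
have co : continuous (fun t : R => act (phi t) x) by move=> t; exact: smooth_at_continuous (so t).
have o0 : act (phi 0) x = x by rewrite p0 (act1 act_smooth).
have o1 : act (phi 1) x = x by rewrite -[1 : R]add0r per.
have cx : continuous (fun _ : R => x) by move=> ?; exact: cvg_cst.
have : loop_homotopic (loop_of cx erefl erefl) (loop_of co o0 o1) by apply/pi1_classP; exact: X_pi1.
move=> [H [cH H01 Hs]].
by apply: (null_tube so _ cH) => // t; rewrite per.
Qed.

Lemma action_values_neq0 phi x : smooth_loop phi -> exists r, action_values phi x r.
Proof. by move=> /(orbit_tube x)[f tf]; exists (J om f - mu_integral act mu phi x), f, x. Qed.

Lemma action_values_coset phi x r s : action_values phi x r -> action_values phi x s -> P (r - s).
Proof.
move=> [f [x0 [tf ->]]] [g [y0 [tg ->]]].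
have -> a b c : (a - c) - (b - c) = a - b :> R by ring.
exact: tube_diff tf tg.
Qed.

Lemma smooth_loop_mul (phi psi : R -> G) : smooth_loop phi -> smooth_loop psi -> smooth_loop (fun t => phi t ** psi t).
Proof.
move=> sp sq; have [_ p1 p0] := sp; have [_ q1 q0] := sq; split.
- by apply/smooth_atT => t; apply: sm_mul; exact: smooth_loop_sm.
- by move=> t; rewrite p1 q1.
- by rewrite p0 q0 mulg1.
Qed.

Lemma smooth_loop_inv (phi : R -> G) : smooth_loop phi -> smooth_loop (fun t => (phi t)^I).
Proof.
move=> sp; have [_ p1 p0] := sp; split.
- by apply/smooth_atT => t; apply: sm_inv; exact: smooth_loop_sm.
- by move=> t; rewrite p1.
- by rewrite p0 invg1.
Qed.

Lemma smooth_loop1 : smooth_loop (fun _ : R => one).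
Proof. by split => //; apply/smooth_atT => t; exact: smooth_at_cst. Qed.

Lemma mu_integral1 x : mu_integral act mu (fun=> one) x = 0.
Proof.
transitivity (rint 0 1 (fun=> 0 : R)); last exact: rint0.
congr (rint _ _ _); apply/funext => t.
by rewrite /rvel mderiv_cst (mu0 mu_moment).
Qed.

(** [H] starts at the loop [act (phi t) x0], so it can follow the tube [g] that contracts this loop;
    areas add, and [J_product] accounts for the moment integrals. *)
Lemma action_values_product phi psi f x0 x r : smooth_loop phi -> smooth_loop psi ->
  tube f (fun=> x0) (fun t => act (psi t) x) -> action_values phi x0 r ->
  action_values (fun t => phi t ** psi t) x (r + (J om f - mu_integral act mu psi x)).
Proof.
have lin (a b c d e k : R) : b - e = (c - d) - k -> (a - k) + (c - d) = a + b - e by move=> h; lra.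
move=> sp sq tf [g [y0 [tg ->]]].
have [sf pf f0 f1] := tf; have [_ p1 _] := sp.
pose H (z : R^o * R^o) := act (phi z.2) (f z).
have tH : tube H (fun t => act (phi t) x0) (fun t => act (phi t ** psi t) x).
  split.
  - by move=> z; apply: sm_act => //; apply: sm_phi2; exact: smooth_loop_sm.
  - by move=> s t; rewrite /H /= p1 pf.
  - by move=> t; rewrite /H f0.
  - by move=> t; rewrite /H f1 (actM act_smooth).
exists (tube_cat g H), y0; split; first exact: tube_catP tg tH.
have JP : J om H - mu_integral act mu (fun t => phi t ** psi t) x = (J om f - mu_integral act mu psi x) - mu_integral act mu phi x0.
  by apply: J_product => //; exact: smooth_loop_sm.
rewrite (J_cat som tg tH).
exact: lin JP.
Qed.

Lemma action_values_base phi x y r : smooth_loop phi -> action_values phi x r -> action_values phi y r.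
Proof.
move=> sp vr; have [f tf Jf] := path_tube x y.
have e : (fun _ : R => y) = (fun t : R => act one y) by apply/funext => t; rewrite (act1 act_smooth).
rewrite e in tf.
have := action_values_product sp smooth_loop1 tf vr.
rewrite Jf mu_integral1 subr0 addr0.
by under eq_fun do rewrite mulg1.
Qed.

Lemma action_values_mul phi psi x y r s : smooth_loop phi -> smooth_loop psi ->
  action_values phi x r -> action_values psi y s -> action_values (fun t => phi t ** psi t) y (r + s).
Proof.
move=> sp sq vr [f [x0 [tf ->]]].
by apply: action_values_product => //; [exact: tf|exact: action_values_base vr].
Qed.

Lemma action_values_null phi x (H : R * R -> G) : smooth_loop phi -> continuous H ->
  (forall t, 0 <= t <= 1 -> H (0, t) = one) -> (forall t, 0 <= t <= 1 -> H (1, t) = phi t) ->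
  (forall s, H (s, 0) = one /\ H (s, 1) = one) -> action_values phi x 0.
Proof.
move=> sp cH H0 H1 Hs; have [_ p1 _] := sp.
have [Psi tPsi] : exists f, tube f (fun=> one) phi.
  apply: (@null_tube _ _ _ _ _ _ H (smooth_loop_sm sp) p1).
  - exact: continuous_subspaceT.
  - by move=> t t01; rewrite H0// H1.
  - by move=> s _; exact: Hs.
have [sPsi per P0 P1] := tPsi.
exists (fun z => act (Psi z) x), x; split.
  split.
  - by move=> z; apply: sm_act => //; exact: smooth_at_cst.
  - by move=> s t; rewrite per.
  - by move=> t; rewrite P0 (act1 act_smooth).
  - by move=> t; rewrite P1.
by rewrite (J_orbit som act_smooth mu_moment x sPsi tPsi) mu_integral1 subr0 subrr.
Qed.

Lemma continuous_lie_mul (S : topologicalType) (f g : S -> G) :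
  continuous f -> continuous g -> continuous (fun z => f z ** g z).
Proof.
move=> cf cg; apply: (@continuous_cmp _ _ _ (fun z => (f z, g z)) (fun gh : G * G => gh.1 ** gh.2)).
  exact: continuous_pair.
by move=> z; apply: (smooth_at_continuous (A := prod_atlas aG aG) (B := aG)); exact: ((smooth_atT _ _ _).1 (lie_mul_smooth G)).
Qed.

Lemma continuous_lie_inv (S : topologicalType) (f : S -> G) : continuous f -> continuous (fun z => (f z)^I).
Proof.
move=> cf; apply: (@continuous_cmp _ _ _ f (fun g : G => g^I)) => //.
by move=> z; apply: (smooth_at_continuous (A := aG) (B := aG)); exact: ((smooth_atT _ _ _).1 (lie_inv_smooth G)).
Qed.

Lemma smooth_loop_continuous phi : smooth_loop phi -> continuous (phi : R -> G).
Proof. by move=> sp t; exact: smooth_at_continuous (smooth_loop_sm sp t). Qed.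

Lemma smooth_loop_at1 phi : smooth_loop phi -> phi 1 = one.
Proof. by move=> [_ p1 p0]; rewrite -[1 : R]add0r p1. Qed.

Lemma represents_homotopic (phi psi : R -> G) (a : pi1 one) : smooth_loop phi -> smooth_loop psi ->
  represents phi a -> represents psi a -> exists H : R * R -> G, [/\ continuous H,
  forall t, 0 <= t <= 1 -> H (0, t) = phi t, forall t, 0 <= t <= 1 -> H (1, t) = psi t &
  forall s, H (s, 0) = one /\ H (s, 1) = one].
Proof.
move=> sp sq [p pE ->] [q qE /pi1_classP/loop_homotopicE[H [cH H0 H1 Hs]]].
by exists H; split => // t t01; rewrite ?H0 ?H1 ?pE ?qE.
Qed.

Lemma action_values_represents phi psi a x y r : smooth_loop phi -> smooth_loop psi ->
  represents phi a -> represents psi a -> action_values phi x r -> action_values psi y r.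
Proof.
move=> sp sq ra rb vr; have [H [cH H0 H1 Hs]] := represents_homotopic sp sq ra rb.
have sm := smooth_loop_mul sq (smooth_loop_inv sp).
have v0 : action_values (fun t => psi t ** (phi t)^I) y 0.
  (* [H] joins [phi] to [psi]; multiplied on the right by the inverse of [phi] it contracts the
     quotient loop. *)
  apply: (@action_values_null _ y (fun z => H z ** (phi (clamp z.2))^I) sm).
  - apply: continuous_lie_mul => //; apply: continuous_lie_inv.
    apply: (@continuous_cmp _ _ _ (fun z : R * R => clamp z.2) phi); last exact: smooth_loop_continuous.
    by apply: continuous_cmp (@clamp_continuous R); exact: continuous_pr2.
  - by move=> t t01; rewrite /= H0// clamp_id// mulgV.
  - by move=> t t01; rewrite /= H1// clamp_id.
  - have [_ _ p0] := sp; move=> s; have [-> ->] := Hs s.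
    by rewrite /= clamp0// clamp1// p0 (smooth_loop_at1 sp) mulgV.
have := action_values_mul sm sp v0 (action_values_base y sp vr).
rewrite add0r; suff -> : (fun t => psi t ** (phi t)^I ** phi t) = psi by [].
by apply/funext => t; exact: mulgVK.
Qed.

Lemma represents_ex (a : pi1 one) : exists phi, smooth_loop phi /\ represents phi a.
Proof.
have [phi [sp p1 p0 [H [cH H0 H1 Hs]]]] := smooth_loop_ex (pi1_repr a).
have sl : smooth_loop (phi : R -> G) by split => //; apply/smooth_atT.
exists phi; split => //.
exists (loop_of (smooth_loop_continuous sl) p0 (smooth_loop_at1 sl)) => //.
rewrite -{1}(pi1_reprK a); apply/pi1_classP; apply: (loop_homotopic_of cH) => //.
Qed.

(* The homotopy moves the reparametrisations min(2t,1) and max(2t-1,0) to the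
   identity while following the homotopies of both factors. *)
Lemma represents_mul phi psi (a b : pi1 one) : smooth_loop phi -> smooth_loop psi ->
  represents phi a -> represents psi b -> represents (fun t => phi t ** psi t) (pi1_mul a b).
Proof.
move=> sp sq [p pE ae] [q qE be]; have sm := smooth_loop_mul sp sq.
have [_ _ m0] := sm.
exists (loop_of (smooth_loop_continuous sm) m0 (smooth_loop_at1 sm)) => //.
rewrite /pi1_mul; apply/pi1_classP.
have /loop_homotopicE[H [cH H0 H1 Hs]] : loop_homotopic (pi1_repr a) p by apply/pi1_classP; rewrite pi1_reprK.
have /loop_homotopicE[K [cK K0 K1 Ks]] : loop_homotopic (pi1_repr b) q by apply/pi1_classP; rewrite pi1_reprK.
pose u (z : R * R) := (1 - z.1) * clamp (2 * z.2) + z.1 * z.2.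
pose v (z : R * R) := (1 - z.1) * clamp (2 * z.2 - 1) + z.1 * z.2.
have c1 : continuous (fun z : R * R => z.1) by exact: continuous_pr1.
have c2 : continuous (fun z : R * R => z.2) by exact: continuous_pr2.
have cu : continuous u.
  apply: continuous_addf; apply: continuous_mulf => //.
    exact: continuous_cmp c1 continuous_compl1.
  by apply: continuous_cmp (@clamp_continuous R); exact: continuous_mul.
have cv : continuous v.
  apply: continuous_addf; apply: continuous_mulf => //.
    exact: continuous_cmp c1 continuous_compl1.
  apply: (@continuous_cmp _ _ _ (fun z : R * R => 2 * z.2 - 1) clamp); last exact: clamp_continuous.
  by move=> z; apply: cvgB; [exact: continuous_mul|exact: cvg_cst].
apply: (@loop_homotopic_of _ _ _ _ _ (fun z => H (z.1, u z) ** K (z.1, v z))).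
- apply: continuous_lie_mul.
    by apply: (@continuous_cmp _ _ _ (fun z : R * R => (z.1, u z)) H) => //; exact: continuous_pair.
  by apply: (@continuous_cmp _ _ _ (fun z : R * R => (z.1, v z)) K) => //; exact: continuous_pair.
- move=> t t01; rewrite /u /v /= subr0 !mul1r !mul0r !addr0 H0 ?clamp_itv// K0 ?clamp_itv//.
  case: ifPn => [t2|]; last rewrite -ltNge => t2.
    by rewrite clamp_id ?(@clamp0 _ (2 * t - 1)) ?loop0 ?mulg1//; lra.
  by rewrite (@clamp1 _ (2 * t)) ?(@clamp_id _ (2 * t - 1)) ?loop1 ?lie_mul1g//; lra.
- by move=> t t01; rewrite /u /v /= subrr !mul0r !mul1r !add0r H1// K1// pE// qE.
- move=> s s01; rewrite /u /v /= !mulr0 !addr0 !mulr1 (@clamp0 _ 0)// (@clamp0 _ (0 - 1)); last by lra.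
  rewrite (@clamp1 _ 2) ?(@clamp1 _ (2 - 1)); [|lra|lra].
  rewrite !mulr0 !mulr1 subrK; have [-> ->] := Hs s; have [-> ->] := Ks s.
  by rewrite mulg1.
Qed.

Lemma action_value_disk phi x D : spanning_disk act phi x D -> action_values phi x (action_value om act mu phi x D).
Proof.
move=> [sD bD]; have [f [x0 [tf Jf]]] := disk_tube som sD.
exists f, x0; split; last by rewrite Jf.
by have <- : (fun t => D (cos (2 * pi * t), sin (2 * pi * t))) = (fun t => act (phi t) x) by apply/funext.
Qed.

Lemma spanning_disk_ex phi x : smooth_loop phi -> exists D, spanning_disk act phi x D.
Proof. by move=> /(orbit_tube x)[f tf]; have [D [sD bD]] := tube_disk tf; exists D. Qed.

Lemma coset_eq r s : P (r - s) -> coset P r = coset P s.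
Proof.
have [P0 PB] := periods_subgroup.
have sub r' s' : P (r' - s') -> coset P r' `<=` coset P s'.
  move=> rs t tr; rewrite /coset /=; have := PB _ _ tr (PB _ _ P0 rs).
  by congr P; ring.
move=> rs; apply/seteqP; split; first exact: sub.
by apply: sub; have := PB _ _ P0 rs; congr P; ring.
Qed.

Lemma coset_addE r s : coset_add (coset P r) (coset P s) = coset P (r + s).
Proof.
have [P0 PB] := periods_subgroup; apply/seteqP; split => t.
  move=> [u [v [ur vs ->]]]; rewrite /coset /=; have := PB _ _ ur (PB _ _ P0 vs).
  by congr P; ring.
move=> tP; exists (t - s), s; split; last by rewrite subrK.
  by move: tP; rewrite /coset /=; congr P; ring.
by rewrite /coset /= subrr.
Qed.

Lemma action_homomorphism : exists A : pi1 one -> set R,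
  (forall (a : pi1 one) (phi : R -> G) (x : X) (D : R^o * R^o -> X),
     smooth_loop phi -> represents phi a -> spanning_disk act phi x D ->
     A a = coset P (action_value om act mu phi x D)) /\
  (forall a b : pi1 one, A (pi1_mul a b) = coset_add (A a) (A b)).
Proof.
have [x0 _] := X_nonempty.
have ex (a : pi1 one) : exists pr : (R -> G) * R, [/\ smooth_loop pr.1, represents pr.1 a & action_values pr.1 x0 pr.2].
  have [phi [sp ra]] := represents_ex a; have [r vr] := action_values_neq0 x0 sp.
  by exists (phi, r).
have [pr prP] := choice ex.
exists (fun a => coset P (pr a).2); split.
  move=> a phi x D sp ra sD; have [sa raa va] := prP a.
  apply: coset_eq; apply: action_values_coset (action_value_disk sD).
  exact: (action_values_represents x sa sp raa ra va).
move=> a b; rewrite coset_addE; apply: coset_eq.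
have [sa ra va] := prP a; have [sb rb vb] := prP b; have [sab rab vab] := prP (pi1_mul a b).
apply: (@action_values_coset (fun t => (pr a).1 t ** (pr b).1 t) x0); last exact: action_values_mul va vb.
exact: (action_values_represents x0 sab (smooth_loop_mul sa sb) rab (represents_mul sa sb ra rb) vab).
Qed.

End ActionHomomorphism.

Theorem mainTheorem2 (R : realType) (E F : tvsType R)
    (G : lieGroup E) (X : manifold F) (om : form2 X)
    (act : G -> X -> X) (mu : E -> X -> R)
    (frechetE : frechet_space E) (frechetF : frechet_space F)
    (X_nonempty : [set: X] !=set0) (X_connected : connected [set: X])
    (X_pi1 : forall x : X, @pi1_trivial R X x)
    (om_symplectic : symplectic om)
    (act_smooth : smooth_action act)
    (act_om : preserves_form om act)
    (mu_moment : equivariant_moment_map om act mu) :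
  additive_subgroup (spherical_periods om) /\
  (forall a : pi1 (lie_one G), exists phi : R -> G,
     smooth_loop phi /\ represents phi a) /\
  (forall (phi : R -> G) (x : X), smooth_loop phi ->
     exists D : R^o * R^o -> X, spanning_disk act phi x D) /\
  exists A : pi1 (lie_one G) -> set R,
    (forall (a : pi1 (lie_one G)) (phi : R -> G) (x : X) (D : R^o * R^o -> X),
       smooth_loop phi -> represents phi a -> spanning_disk act phi x D ->
       A a = coset (spherical_periods om) (action_value om act mu phi x D)) /\
    (forall a b : pi1 (lie_one G), A (pi1_mul a b) = coset_add (A a) (A b)).
Proof.
have hE : hausT E by case: frechetE.
have hF : hausT F by case: frechetF.
have [som _ _] := om_symplectic.
split; first exact: periods_subgroup.
split; first by move=> a; exact: represents_ex.
split; first by move=> phi x sp; exact: spanning_disk_ex.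
exact: action_homomorphism.
Qed.
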